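(* Let $\theta\in[\tfrac12,1]$, let $n\in\{1,\dots,N\}$, and let $u_h^{n-1}\in V_{\mathcal P}$ be given. Consider the problem: find $u_h^n\in V_{\mathcal P}$ such that $$((u_h^n)^+,v_h)_\Omega+\Delta t\,\theta\, a_J((u_h^n)^+,v_h)+\Delta t\, s((u_h^n)^-,v_h)=F^n(v_h)\qquad\forall v_h\in V_{\mathcal P}.\qquad(\mathrm P_n)$$ Then: (a) There exists $u_h^n\in V_{\mathcal P}$ that solves $(\mathrm P_n)$. (b) $(u_h^n)^+\in V_{\mathcal P}^+$ satisfies $$((u_h^n)^+,v_h-(u_h^n)^+)_\Omega+\Delta t\,\theta\,a_J((u_h^n)^+,v_h-(u_h^n)^+)\ge F^n(v_h-(u_h^n)^+)\qquad\forall v_h\in V_{\mathcal P}^+.$$ (c) $(u_h^n)^-$ is the unique solution of $$\Delta t\, s((u_h^n)^-,v_h)=F^n(v_h)-((u_h^n)^+,v_h)_\Omega-\Delta t\,\theta\,a_J((u_h^n)^+,v_h)\qquad\forall v_h\in V_{\mathcal P}.$$ (d) The solution of $(\mathrm P_n)$ is unique.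
   Context: **Continuous problem.** $\Omega\subset\mathbb R^d$ ($d=2,3$) is an open bounded Lipschitz domain with polyhedral boundary and $T>0$. The data are: $\varepsilon>0$; $\mu\ge 0$; a convective field $\boldsymbol\beta\in L^\infty((0,T);W^{1,\infty}(\Omega))^d$ with $\operatorname{div}\boldsymbol\beta=0$ in $\Omega\times[0,T]$; $f\in L^2((0,T);L^2(\Omega))$; and an initial datum $u^0$. The problem is $$\partial_t u-\varepsilon\Delta u+\boldsymbol\beta\cdot\nabla u+\mu u=f\ \text{ in }(0,T]\times\Omega,\quad u=0\ \text{ on }(0,T]\times\partial\Omega,\quad u(\cdot,0)=u^0.$$ It is assumed that its weak solution satisfies $0\le u(\boldsymbol x,t)\le\kappa(t)$ for almost all $(\boldsymbol x,t)\in\Omega\times[0,T]$, where $\kappa$ is a known positive function on $[0,T]$. $(\cdot,\cdot)_\Omega$ is the $L^2(\Omega)$ inner product and $\|\cdot\|_{0,\infty,D}$ is the $L^\infty(D)$ norm. **Finite element space.** $\mathcal P$ is a conforming, shape-regular partition of $\Omega$ into simplices (or affine quadrilaterals/hexahedra). For $k\ge1$, $V_{\mathcal P}$ is the space of $v_h\in C^0(\overline\Omega)\cap H^1_0(\Omega)$ with $v_h|_K\in\mathbb P_k(K)$ (simplices) or $v_h|_K\in\mathbb Q_k(K)$ (mapped; quadrilaterals/hexahedra) for all $K\in\mathcal P$. Let $\boldsymbol x_1,\dots,\boldsymbol x_{N_{\mathcal P}}$ be the internal Lagrange nodes, with Lagrange basis $\phi_1,\dots,\phi_{N_{\mathcal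 P}}$ of $V_{\mathcal P}$. $h_G$ is the diameter of a set $G$. $\mathfrak h$ is the continuous piecewise linear mesh function whose value at each mesh vertex is the average of $h_K$ over the elements $K$ containing that vertex. $\mathcal F_I$ is the set of internal facets, $\llbracket\cdot\rrbracket$ is the jump across a facet, and $\omega_i=\bigcup\{K\in\mathcal P:\boldsymbol x_i\in K\}$. **Admissible set.** At time $t$, $V_{\mathcal P}^+=\{v_h\in V_{\mathcal P}: v_h(\boldsymbol x_i)\in[0,\kappa(t)],\ i=1,\dots,N_{\mathcal P}\}$. For $v_h\in V_{\mathcal P}$, $$v_h^+=\sum_{i=1}^{N_{\mathcal P}}\max\{0,\min\{v_h(\boldsymbol x_i),\kappa(t)\}\}\,\phi_i,\qquad v_h^-=v_h-v_h^+.$$ For functions at time level $n$ (resp. $n-1$) these are taken at $t=t_n$ (resp. $t=t_{n-1}$); in the claim, $V_{\mathcal P}^+$ is taken at $t=t_n$. **Time grid.** $N$ is a positive integer, $\Delta t=T/N$, $t_n=n\Delta t$, $t_{n-1+\theta}=\theta t_n+(1-\theta)t_{n-1}$, and $f^{n-1+\theta}\in L^2(\Omega)$ denotes $f$ at time $t_{n-1+\theta}$. **Forms.** With a fixed constant $\gamma\ge0$, $$a_J(w,v)=\varepsilon(\nabla w,\nabla v)_\Omega+(\boldsymbol\beta\cdot\nabla w,v)_\Omega+\mu(w,v)_\Omega+J(w,v),$$ $$J(w,v)=\gamma\sum_{F\in\mathcal F_I}\int_F\|\boldsymbol\beta\|_{0,\infty,F}\,h_F^2\,\llbracket\nabla w\rrbracket\cdot\llbracket\nabla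 v\rrbracket\,\mathrm ds.$$ With a fixed constant $\alpha>0$, $$s(v_h,w_h)=\alpha\sum_{i=1}^{N_{\mathcal P}}\Big(\varepsilon\,\mathfrak h(\boldsymbol x_i)^{d-2}+\|\boldsymbol\beta(\cdot,t_n)\|_{0,\infty,\omega_i}\mathfrak h(\boldsymbol x_i)^{d-1}+\big(\tfrac1{\Delta t}+\mu\big)\mathfrak h(\boldsymbol x_i)^d\Big)v_h(\boldsymbol x_i)w_h(\boldsymbol x_i).$$ $$F^n(v_h)=\Delta t(f^{n-1+\theta},v_h)_\Omega-\Delta t(1-\theta)\varepsilon(\nabla(u_h^{n-1})^+,\nabla v_h)_\Omega-\Delta t(1-\theta)(\boldsymbol\beta\cdot\nabla(u_h^{n-1})^+,v_h)_\Omega$$ $$\qquad-(\mu\Delta t(1-\theta)-1)((u_h^{n-1})^+,v_h)_\Omega-\Delta t(1-\theta)J((u_h^{n-1})^+,v_h).$$ The field $\boldsymbol\beta$ and $f$ are assumed to admit values at the discrete times used. In $a_J((u_h^n)^+,\cdot)$ the field is $\boldsymbol\beta(\cdot,t_n)$; in the terms of $F^n$ involving $(u_h^{n-1})^+$ it is $\boldsymbol\beta(\cdot,t_{n-1})$. *)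

(* Defs.v *)
From HB Require Import structures.
From mathcomp Require Import all_boot all_order all_algebra.
From mathcomp Require Import all_classical all_reals all_analysis.
Set Implicit Arguments.
Unset Strict Implicit.
Unset Printing Implicit Defensive.
Import Order.TTheory GRing.Theory Num.Theory.
Import numFieldNormedType.Exports.
Local Open Scope classical_set_scope.
Local Open Scope ring_scope.

(* 'rV[R]_n carries the sigma-algebra generated by the coordinates, which is the
   Borel sigma-algebra. *)
Section rv_measurable.
Context {R : realType} (n : nat).
Let coord (i : 'I_n) (x : 'rV[R]_n) : R := x ord0 i.
Let rv_set0 : g_sigma_preimage coord set0.
Proof. exact: sigma_algebra0. Qed.
Let rv_setC A : g_sigma_preimage coord A -> g_sigma_preimage coord (~` A).
Proof. exact: sigma_algebraC. Qed.
Let rv_bigcup (F : (set 'rV[R]_n)^nat) :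
  (forall i, g_sigma_preimage coord (F i)) ->
  g_sigma_preimage coord (\bigcup_i (F i)).
Proof. exact: sigma_algebra_bigcup. Qed.
HB.instance Definition _ := @isMeasurable.Build default_measure_display
  'rV[R]_n (g_sigma_preimage coord) rv_set0 rv_setC rv_bigcup.

Lemma measurable_rv_coord (i : 'I_n) :
  measurable_fun [set: 'rV[R]_n] (fun x : 'rV[R]_n => x ord0 i : R).
Proof.
move=> _ Y mY; rewrite setTI; apply: sub_sigma_algebra => /=.
rewrite -bigcup_seq/=; exists i => /=; first by rewrite mem_index_enum.
by exists Y => //; rewrite setTI.
Qed.

Lemma measurable_fun_rvP d (T : measurableType d) (f : T -> 'rV[R]_n) :
  (forall i, measurable_fun [set: T] (fun t => f t ord0 i : R)) ->
  measurable_fun [set: T] f.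
Proof.
move=> mf _ A mA; rewrite setTI.
pose D : set (set 'rV[R]_n) := [set B | measurable (f @^-1` B)].
suff : measurable `<=` D by exact.
apply: smallest_sub => [|B].
  split => [|B|F].
  - by rewrite /D/= preimage_set0.
  - by rewrite /D/= setTD preimage_setC => /measurableC.
  - by rewrite /D/= => DF; rewrite preimage_bigcup; exact: bigcupT_measurable.
rewrite -bigcup_seq/= => -[i _] [C mC <-]; rewrite /D/= setTI -comp_preimage.
by rewrite -[X in measurable X]setTI; exact: mf.
Qed.

End rv_measurable.

Definition rv_cons {R : realType} (n : nat) (z : R * 'rV[R]_n) : 'rV[R]_n.+1 :=
  \row_(j < n.+1) if unlift ord0 j is Some k then z.2 ord0 k else z.1.

Section lebesgue_rv.
Context {R : realType}.

Lemma measurable_rv_cons n :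
  measurable_fun [set: measurableTypeR R * 'rV[R]_n] (@rv_cons R n).
Proof.
apply: measurable_fun_rvP => i.
case: (unliftP ord0 i) => [k|] ->.
- apply: (eq_measurable_fun (fun z : measurableTypeR R * 'rV[R]_n => z.2 ord0 k)).
    by move=> z _; rewrite mxE liftK.
  exact: (measurableT_comp (measurable_rv_coord k)).
- apply: (eq_measurable_fun (fun z : measurableTypeR R * 'rV[R]_n => z.1)).
    by move=> z _; rewrite mxE unlift_none.
  exact: measurable_fst.
Qed.

Section step.
Context n (m : {sigma_finite_measure set 'rV[R]_n -> \bar R}).

Definition lebesgue_step : set 'rV[R]_n.+1 -> \bar R :=
  pushforward (@lebesgue_measure R \x m)%E
    (@rv_cons R n : measurableTypeR R * 'rV[R]_n -> 'rV[R]_n.+1).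


Let step0 : lebesgue_step set0 = 0%E.
Proof. by rewrite /lebesgue_step /pushforward preimage_set0 measure0. Qed.
Let step_ge0 A : (0 <= lebesgue_step A)%E.
Proof. by rewrite /lebesgue_step /pushforward; apply: measure_ge0. Qed.
Let mpre (A : set 'rV[R]_n.+1) :
  measurable A -> measurable (@rv_cons R n @^-1` A : set (measurableTypeR R * _)).
Proof.
by move=> mA; rewrite -[X in measurable X]setTI; exact: measurable_rv_cons.
Qed.
Let step_sigma_additive : semi_sigma_additive lebesgue_step.
Proof.
move=> F mF tF mUF; rewrite /lebesgue_step /pushforward preimage_bigcup.
apply: measure_semi_sigma_additive.
- by move=> k; exact: mpre.
- apply/trivIsetP => /= i j _ _ ij; rewrite -preimage_setI.
  by move/trivIsetP : tF => /(_ _ _ _ _ ij) -> //; rewrite preimage_set0.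
- by rewrite -preimage_bigcup; exact: mpre.
Qed.
HB.instance Definition _ := isMeasure.Build _ _ _ lebesgue_step
  step0 step_ge0 step_sigma_additive.

Let step_sigma_finite : sigma_finite setT lebesgue_step.
Proof.
have [F FT mF] := sigma_finiteT (@lebesgue_measure R).
have [G GT mG] := sigma_finiteT m.
pose H (ij : nat * nat) : set 'rV[R]_n.+1 :=
  [set x | F ij.1 (x ord0 ord0) /\ G ij.2 (\row_k x ord0 (lift ord0 k))].
have consK (z : R * 'rV[R]_n) ij : H ij (rv_cons z) = (F ij.1 `*` G ij.2) z.
  rewrite /H/= /setX/= mxE unlift_none; congr (_ /\ G _ _).
  by apply/rowP => k; rewrite !mxE liftK.
have mH ij : measurable (H ij).
  apply: measurableI.
  - rewrite -[X in measurable X]setTI.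
    exact: (measurable_rv_coord ord0 measurableT (mF ij.1).1).
  - rewrite -[X in measurable X]setTI.
    apply: (measurable_fun_rvP _ measurableT (mG ij.2).1) => k.
    apply: eq_measurable_fun (measurable_rv_coord (lift ord0 k)) => x _.
    by rewrite mxE.
exists (fun k => if unpickle k is Some ij then H ij else set0).
  apply/esym; rewrite -subTset => x _.
  have : [set: measurableTypeR R] (x ord0 ord0) by [].
  rewrite FT => -[i _ Fi].
  have : [set: 'rV[R]_n] (\row_k x ord0 (lift ord0 k)) by [].
  rewrite GT => -[j _ Gj].
  by exists (pickle (i, j)) => //=; rewrite pickleK.
move=> k; case: unpickle => [ij|]; last first.
  by split; [exact: measurable0|rewrite measure0].
split; first exact: mH.
rewrite /lebesgue_step /pushforward.
rewrite (_ : _ @^-1` _ = F ij.1 `*` G ij.2); last first.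
  by apply/funext => z; rewrite -consK.
have [? ?] := mF ij.1; have [? ?] := mG ij.2.
by rewrite product_measure1E// lte_mul_pinfty// ge0_fin_numE.
Qed.
HB.instance Definition _ := Measure_isSigmaFinite.Build _ _ _ lebesgue_step
  step_sigma_finite.

End step.

(* Lebesgue measure on R^n, as an iterated product measure. *)
Fixpoint lebesgue_rV (n : nat) : {sigma_finite_measure set 'rV[R]_n -> \bar R} :=
  match n with
  | 0 => @dirac _ _ (0 : 'rV[R]_0) R
  | k.+1 => lebesgue_step (lebesgue_rV k)
  end.

End lebesgue_rv.

Section euclidean.
Context {R : realType} {n : nat}.
Implicit Types (x y : 'rV[R]_n) (A : set 'rV[R]_n).

(* The library norm on 'rV[R]_n is the maximum norm, so the Euclidean structure
   is introduced separately; both norms induce the same topology. *)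
Definition dot x y : R := \sum_(j < n) x ord0 j * y ord0 j.

Definition enorm x : R := Num.sqrt (dot x x).

Definition diam A : R := sup [set enorm (z.1 - z.2) | z in A `*` A].

Definition inradius A : R :=
  sup [set r | 0 <= r /\
    exists c, [set x | enorm (x - c) <= r] `<=` A].

(* [F] is a (possibly empty) face of the convex set [K]. *)
Definition is_face (K F : set 'rV[R]_n) : Prop :=
  [/\ F `<=` K, convex_set F &
      forall x y (s : R), K x -> K y -> 0 < s < 1 ->
        F (s *: x + (1 - s) *: y) -> F x /\ F y].

Definition polytope (vs : seq 'rV[R]_n) : set 'rV[R]_n :=
  [set x | exists w : 'I_(size vs) -> R,
    [/\ forall i, 0 <= w i, \sum_i w i = 1 & x = \sum_i w i *: vs`_i]].

Definition polyhedral_boundary A : Prop :=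
  exists2 P : seq (seq 'rV[R]_n),
    (forall vs, vs \in P -> exists (a : 'rV[R]_n) (c : R),
       a != 0 /\ forall v, v \in vs -> dot a v = c)
    & closure A `\` A° = [set x | exists2 vs, vs \in P & polytope vs x].

End euclidean.

(* Near each boundary point, in suitable orthonormal coordinates, the set is the
   region above the graph of a Lipschitz function of the first p coordinates. *)
Definition lipschitz_boundary {R : realType} {p : nat}
    (A : set 'rV[R]_p.+1) : Prop :=
  forall x, (closure A `\` A°) x ->
  exists (r L : R) (Q : 'M[R]_p.+1) (g : 'rV[R]_p -> R),
    [/\ 0 < r, Q *m Q^T = 1%:M,
        forall y z, `|g y - g z| <= L * enorm (y - z)
      & forall y, enorm (y - x) < r ->
          let z := (y - x) *m Q in
          A y <-> g (\row_(j < p) z ord0 (widen_ord (leqnSn p) j))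
                    < z ord0 ord_max].

Definition polyhedral_lipschitz_domain {R : realType} {p : nat}
    (A : set 'rV[R]_p.+1) : Prop :=
  [/\ open A /\ connected A, A !=set0 /\ bounded_set A,
      lipschitz_boundary A & polyhedral_boundary A].

Section function_spaces.
Context {R : realType} {n : nat}.
Local Notation V := 'rV[R]_n.
Implicit Types (Omega D : set V) (v w psi : V -> R) (G H : V -> V).

Definition partial (j : 'I_n) v : V -> R := 'D_(delta_mx ord0 j : V) v.

Definition grad v : V -> V := fun x => \row_(j < n) partial j v x.

Definition smooth v : Prop :=
  forall (s : seq 'I_n) (x : V), differentiable (foldr partial v s) x.

Definition test_function Omega psi : Prop :=
  smooth psi /\
  exists K, [/\ compact K, K `<=` Omega & forall x, ~ K x -> psi x = 0].

Definition ip Omega v w : R :=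
  \int[lebesgue_rV n]_(x in Omega) (v x * w x).

Definition ipv Omega G H : R :=
  \int[lebesgue_rV n]_(x in Omega) dot (G x) (H x).

(* Norm of L^q(D); the restriction [v \_ D] extends [v] by zero outside [D]. *)
Definition normL D (q : \bar R) v : \bar R :=
  Lnorm (lebesgue_rV n) q (EFin \o (v \_ D)).

Definition L2 Omega v : Prop :=
  measurable_fun Omega v /\ (normL Omega 2%:E v < +oo)%E.

(* Weak gradients are sought in L^2: on a bounded [Omega] this covers both
   H^1 and W^{1,oo}. *)
Definition weak_gradient Omega v G : Prop :=
  forall j : 'I_n, L2 Omega (fun x => G x ord0 j) /\
  forall psi, test_function Omega psi ->
    ip Omega v (partial j psi) = - ip Omega (fun x => G x ord0 j) psi.

(* A representative of the weak gradient, which is unique almost everywhere. *)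
Definition wgrad Omega v : V -> V :=
  xget (fun=> 0) [set G | weak_gradient Omega v G].

Definition H1 Omega v : Prop :=
  L2 Omega v /\ exists G, weak_gradient Omega v G.

Definition H1_norm Omega v : \bar R :=
  (normL Omega 2%:E v + normL Omega 2%:E (enorm \o wgrad Omega v))%E.

Definition H10 Omega v : Prop :=
  H1 Omega v /\
  exists psi : nat -> V -> R, (forall m, test_function Omega (psi m)) /\
    H1_norm Omega (psi m \- v) @[m --> \oo] --> 0%E.

Definition W1inf_norm Omega v : \bar R :=
  (normL Omega +oo v + normL Omega +oo (enorm \o wgrad Omega v))%E.

Definition W1inf Omega v : Prop :=
  [/\ measurable_fun Omega v, exists G, weak_gradient Omega v G
    & (W1inf_norm Omega v < +oo)%E].

Definition div_free Omega G : Prop :=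
  {ae lebesgue_rV n, forall x, Omega x ->
    \sum_(j < n) wgrad Omega (fun y => G y ord0 j) x ord0 j = 0}.

(* The values at a fixed time of a convective field; continuity selects the
   representative that has a trace on the facets of a mesh. *)
Definition divfree_W1inf_field Omega G : Prop :=
  [/\ forall j : 'I_n, W1inf Omega (fun x => G x ord0 j),
      {within Omega, continuous G} & div_free Omega G].

Definition linf D G : R := fine (normL D +oo (enorm \o G)).

(* The Bochner space L^q((0,T); X), where X carries the norm [nrm]: strong
   measurability is approximation by simple functions for almost every time. *)
Definition simple_in (X : set (V -> R)) (s : R -> V -> R) : Prop :=
  exists (m : nat) (A : 'I_m -> set R) (c : 'I_m -> V -> R),
    (forall i, measurable (A i) /\ X (c i)) /\
    forall t x, s t x = \sum_(i < m) \1_(A i) t * c i x.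

Definition bochner (T : R) (q : \bar R) (X : set (V -> R))
    (nrm : (V -> R) -> \bar R) (g : R -> V -> R) : Prop :=
  [/\ {ae lebesgue_measure, forall t : R, 0 < t < T -> X (g t)},
      exists s : nat -> R -> V -> R, (forall m, simple_in X (s m)) /\
        {ae lebesgue_measure, forall t : R, 0 < t < T ->
          nrm (s m t \- g t) @[m --> \oo] --> 0%E}
    & (Lnorm lebesgue_measure q ((nrm \o g) \_ `]0%R, T[) < +oo)%E].

(* The forms below without stabilisation; [b] is the convective field. *)
Definition a_form Omega (eps mu : R) (b : V -> V) w v : R :=
  eps * ipv Omega (wgrad Omega w) (wgrad Omega v)
  + ip Omega (fun x => dot (b x) (wgrad Omega w x)) v
  + mu * ip Omega w v.

(* The weak formulation is tested with products of v in H^1_0 and of smooth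
   functions eta of time supported in [0,T), so that integration by parts in
   time carries the initial condition. *)
Definition weak_solution Omega (T eps mu : R) (beta : R -> V -> V)
    (f : R -> V -> R) (u0 : V -> R) (u : R -> V -> R) : Prop :=
  [/\ L2 Omega u0, bochner T 2%:E (H10 Omega) (H1_norm Omega) u &
  forall (v : V -> R) (eta : R -> R), H10 Omega v ->
    (forall (m : nat) (t : R), derivable (derive1n m eta) t 1) ->
    (exists2 tau, tau < T & forall t, tau <= t -> eta t = 0) ->
    - (\int[lebesgue_measure]_(t in `]0, T[) (ip Omega (u t) v * derive1 eta t))
    + \int[lebesgue_measure]_(t in `]0, T[)
        (a_form Omega eps mu (beta t) (u t) v * eta t)
    = \int[lebesgue_measure]_(t in `]0, T[) (ip Omega (f t) v * eta t)
    + ip Omega u0 v * eta 0].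

End function_spaces.

Variant cell_shape := Simplex | Cube.

(* Cell e is the image of the reference simplex or cube under the affine map
   y |-> corigin e + y *m cmat e; all the cells of a mesh have the same shape. *)
Record mesh (R : realType) (n : nat) := Mesh {
  mshape : cell_shape;
  ncell : nat;
  corigin : 'I_ncell -> 'rV[R]_n;
  cmat : 'I_ncell -> 'M[R]_n }.

Definition refcell {R : realType} (s : cell_shape) (n : nat) : set 'rV[R]_n :=
  match s with
  | Simplex => [set y | (forall j, 0 <= y ord0 j) /\ \sum_j y ord0 j <= 1]
  | Cube => [set y | forall j, 0 <= y ord0 j <= 1]
  end.

Arguments refcell {R} s n _.

(* Exponents of the monomials of P_k (Simplex) or Q_k (Cube); divided by k they
   are also the reference Lagrange nodes. *)
Definition exponent (s : cell_shape) (k n : nat)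
    (a : {ffun 'I_n -> 'I_k.+1}) : bool :=
  match s with
  | Simplex => (\sum_(j < n) a j <= k)%N
  | Cube => true
  end.

Section finite_elements.
Context {R : realType} {n : nat}.
Local Notation V := 'rV[R]_n.
Implicit Types (Omega : set V) (M : mesh R n) (v w : V -> R).

Definition cell_map M (e : 'I_(ncell M)) (y : V) : V :=
  corigin e + y *m cmat e.

Definition cell M (e : 'I_(ncell M)) : set V :=
  cell_map e @` refcell (mshape M) n.

Definition conforming_partition Omega M : Prop :=
  [/\ forall e : 'I_(ncell M), cmat e \in unitmx,
      closure Omega = \bigcup_(e in [set: 'I_(ncell M)]) cell e,
      forall e e' : 'I_(ncell M), e != e' ->
        (cell e)° `&` (cell e')° = set0
    & forall e e' : 'I_(ncell M), is_face (cell e) (cell e `&` cell e')].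

Definition shape_regular M (sigma : R) : Prop :=
  forall e : 'I_(ncell M), diam (cell e) <= sigma * (2 * inradius (cell e)).

Definition poly_space (s : cell_shape) (k : nat) (q : V -> R) : Prop :=
  exists c : {ffun 'I_n -> 'I_k.+1} -> R, forall y,
    q y = \sum_(a | exponent s a) c a * \prod_(j < n) y ord0 j ^+ a j.

Definition cell_space M (k : nat) (e : 'I_(ncell M)) v : Prop :=
  match mshape M with
  | Simplex => exists2 q, poly_space Simplex k q &
      forall x, cell e x -> v x = q x
  | Cube => exists2 q, poly_space Cube k q &
      forall y, refcell Cube n y -> v (cell_map e y) = q y
  end.

Definition fe_C0 Omega M (k : nat) v : Prop :=
  {within closure Omega, continuous v} /\
  forall e : 'I_(ncell M), cell_space k e v.

Definition fe_space Omega M (k : nat) v : Prop :=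
  fe_C0 Omega M k v /\ H10 Omega v.

Definition lagrange_node M (k : nat) : set V :=
  [set x | exists (e : 'I_(ncell M)) (a : {ffun 'I_n -> 'I_k.+1}),
    exponent (mshape M) a /\ x = cell_map e (\row_j ((a j)%:R / k%:R))].

(* An enumeration without repetition of the Lagrange nodes inside [Omega]. *)
Definition internal_nodes Omega M (k NP : nat) (x : 'I_NP -> V) : Prop :=
  injective x /\ range x = lagrange_node M k `&` Omega.

Definition lagrange_basis Omega M (k NP : nat) (x : 'I_NP -> V)
    (phi : 'I_NP -> V -> R) : Prop :=
  [/\ forall i, fe_space Omega M k (phi i),
      forall i j, phi i (x j) = (i == j)%:R
    & forall v, fe_space Omega M k v ->
        exists c : 'I_NP -> R, forall z, closure Omega z ->
          v z = \sum_(i < NP) c i * phi i z].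

(* The mesh vertices are the Lagrange nodes of degree 1. *)
Definition mesh_function Omega M (hh : V -> R) : Prop :=
  fe_C0 Omega M 1 hh /\
  forall z, lagrange_node M 1 z ->
    hh z = (\sum_(e < ncell M | `[< cell e z >]) diam (cell e))
           / #|[set e : 'I_(ncell M) | `[< cell e z >]]|%:R.

Definition patch_of M (z : V) : set V :=
  \bigcup_(e in [set e : 'I_(ncell M) | cell e z]) cell e.

Definition trunc (kap r : R) : R := Num.max 0 (Num.min r kap).

Definition vplus (NP : nat) (x : 'I_NP -> V) (phi : 'I_NP -> V -> R)
    (kap : R) v : V -> R :=
  fun z => \sum_(i < NP) trunc kap (v (x i)) * phi i z.

Definition vminus (NP : nat) (x : 'I_NP -> V) (phi : 'I_NP -> V -> R)
    (kap : R) v : V -> R :=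
  fun z => v z - vplus x phi kap v z.

Definition fe_admissible Omega M (k NP : nat) (x : 'I_NP -> V)
    (kap : R) v : Prop :=
  fe_space Omega M k v /\ forall i, 0 <= v (x i) <= kap.

Definition s_form M (alpha eps mu dt : R) (b : V -> V) (hh : V -> R)
    (NP : nat) (x : 'I_NP -> V) v w : R :=
  alpha * \sum_(i < NP)
    (eps * hh (x i) ^+ (n - 2)
     + linf (patch_of M (x i)) b * hh (x i) ^+ (n - 1)
     + (dt^-1 + mu) * hh (x i) ^+ n) * v (x i) * w (x i).

(* The trace at [x] of the gradient of [v], taken from inside cell [e]. *)
Definition grad_trace M (e : 'I_(ncell M)) v (x : V) : V :=
  lim (grad v y @[y --> within (cell e)° (nbhs x)]).

Definition grad_jump M (e e' : 'I_(ncell M)) v (x : V) : V :=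
  grad_trace e v x - grad_trace e' v x.

End finite_elements.

(* Facets are images of the reference cell of dimension p. Facet i of the
   reference simplex is opposite to vertex i; facet (j, b) of the reference cube
   is the one where coordinate j equals b. *)
Definition facet_index (s : cell_shape) (p : nat) : finType :=
  match s with Simplex => 'I_p.+2 | Cube => ('I_p.+1 * bool)%type end.

Section facets.
Context {R : realType} {p : nat}.
Local Notation V := 'rV[R]_p.+1.
Implicit Types (Omega : set V) (M : mesh R p.+1) (v w : V -> R) (b : V -> V).

Definition ref_vertex (i : 'I_p.+2) : V := \row_j (lift ord0 j == i)%:R.

Definition facet_origin (s : cell_shape) : facet_index s p -> V :=
  match s with
  | Simplex => fun i => ref_vertex (lift i ord0)
  | Cube => fun jb => (jb.2 : nat)%:R *: delta_mx ord0 jb.1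
  end.

Definition facet_mat (s : cell_shape) : facet_index s p -> 'M[R]_(p, p.+1) :=
  match s with
  | Simplex => fun i => \matrix_(l < p)
      (ref_vertex (lift i (lift ord0 l)) - ref_vertex (lift i ord0))
  | Cube => fun jb => \matrix_(l < p) delta_mx ord0 (lift jb.1 l)
  end.

Definition facet_map M (e : 'I_(ncell M)) (i : facet_index (mshape M) p)
    (y : 'rV[R]_p) : V :=
  cell_map e (facet_origin i + y *m facet_mat i).

Definition facet M (e : 'I_(ncell M)) (i : facet_index (mshape M) p) : set V :=
  facet_map e i @` refcell (mshape M) p.

(* Surface integral, with the Gram determinant as surface element. *)
Definition facet_integral M (e : 'I_(ncell M)) (i : facet_index (mshape M) p)
    (g : V -> R) : R :=
  let B := facet_mat i *m cmat e in
  Num.sqrt (\det (B *m B^T)) *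
  \int[lebesgue_rV p]_(y in refcell (mshape M) p) g (facet_map e i y).

(* Surface null sets of the facet correspond to null sets of R^p, hence this is
   the essential supremum for the surface measure. *)
Definition facet_linf M (e : 'I_(ncell M)) (i : facet_index (mshape M) p) b : R :=
  fine (normL (refcell (mshape M) p) +oo (fun y => enorm (b (facet_map e i y)))).

(* Each internal facet occurs once in the sum, as the facet i of cell e which is
   the intersection of cells e < e'. The sign of the jump is immaterial. *)
Definition J_form M (gamma : R) b w v : R :=
  gamma * \sum_(e < ncell M) \sum_(i : facet_index (mshape M) p)
    \sum_(e' < ncell M |
        (e < e')%N && `[< facet e i = cell e `&` cell e' >])
      facet_integral e i (fun x =>
        facet_linf e i b * diam (facet e i) ^+ 2
        * dot (grad_jump e e' w x) (grad_jump e e' v x)).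

Definition aJ_form Omega M (eps mu gamma : R) b w v : R :=
  a_form Omega eps mu b w v + J_form M gamma b w v.

(* [w] stands for the truncation of the discrete solution at the previous time
   and [b] for the convective field at that time. *)
Definition F_form Omega M (eps mu gamma theta dt : R) b (g w v : V -> R) : R :=
  dt * ip Omega g v
  - dt * (1 - theta) * eps * ipv Omega (wgrad Omega w) (wgrad Omega v)
  - dt * (1 - theta) * ip Omega (fun x => dot (b x) (wgrad Omega w x)) v
  - (mu * dt * (1 - theta) - 1) * ip Omega w v
  - dt * (1 - theta) * J_form M gamma b w v.

End facets.

(* Main.v *)
Require Import Defs.
From mathcomp Require Import all_boot all_order all_algebra.
From mathcomp Require Import all_classical all_reals all_analysis.
From mathcomp Require Import measurable_realfun ess_sup_inf lra ring.
Set Implicit Arguments.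
Unset Strict Implicit.
Unset Printing Implicit Defensive.
Import Order.TTheory GRing.Theory Num.Theory.
Import numFieldNormedType.Exports.
Local Open Scope classical_set_scope.
Local Open Scope ring_scope.

(** In nodal coordinates the scheme is a finite complementarity problem. Write
    [A] for the matrix of the form ((w, v) + dt theta a_J(w, v)) on the Lagrange
    basis, [d] for the positive diagonal weights of [dt s], [b] for the load and
    [P] for the componentwise projection onto the box of admissible nodal values.
    A vector [u] solves the scheme if and only if
      A P(u) + d (u - P(u)) = b.
    If [w = P(u)], then the residual [b - A w = d (u - P(u))] is in the normal
    cone of the box at [w], so [w] solves a variational inequality on the box;
    conversely a solution [w] of the inequality gives back
    [u = w + d^-1 (b - A w)]. Claims (b) and (c) are read off this
    correspondence, and (d) follows because [A] is positive definite and [P] is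
    monotone. For (a), the projected step w |-> P(w - s (A w - b)) strictly
    decreases distances when [s] is small, hence the residual of the step,
    minimised over the compact box, vanishes
    ([projection_fixpoint], [complementarity_exists]). This part only needs an
    abstract space with a nodal basis, a bilinear form that is positive on
    functions with a nonzero nodal value, a linear right-hand side and positive
    weights ([truncated_problem]).

    The rest of the file checks these hypotheses for the concrete forms.

    - Weak gradients are chosen arbitrarily among representatives, so the forms
      are bilinear only because two representatives agree almost everywhere
      ([weak_gradient_unique]). This is the fundamental lemma of the calculus of
      variations ([test_functions_separate]), obtained from products of
      functions exp(-1/t) that converge to indicators of boxes.
    - The form is positive because its convective part is skew on H^1_0
      ([transport_skew]): for a test function psi one has
      (b . grad psi) psi = b . grad (psi^2) / 2, which integrates to zero against
      a divergence free field, and the general case follows by density. The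
      density argument uses that a test function has its classical gradient as
      weak gradient, i.e. integration by parts without boundary terms, which is
      Fubini's theorem and the one-dimensional fundamental theorem of calculus
      ([integral_compact_derive]).
    - On a cell a finite element function is the restriction of a polynomial, so
      the one-sided limit of its gradient exists and is linear in the function
      ([grad_traceE]); this makes the jump form bilinear ([J_form_lin]).
    - The weights are positive because the mesh function is, on each cell, a
      convex combination of its values at the vertices, which are means of
      positive diameters ([mesh_function_gt0]). *)

(** * Boxes and measurability *)

Section rv_boxes.
Context {R : realType}.

Definition obox n (a b : 'rV[R]_n) : set 'rV[R]_n :=
  [set x | forall i, a ord0 i < x ord0 i < b ord0 i].

Lemma measurable_obox n (a b : 'rV[R]_n) : measurable (obox a b).
Proof.
rewrite (_ : obox a b = \bigcap_(i in [set: 'I_n])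
    ((fun x : 'rV[R]_n => x ord0 i) @^-1` `]a ord0 i, b ord0 i[)); last first.
  apply/seteqP; split=> [x xab i _ /=|x xab i]; first by rewrite in_itv/= xab.
  by have := xab i Logic.I; rewrite /= in_itv.
apply: fin_bigcap_measurable => // i _; rewrite -[X in measurable X]setTI.
exact: (measurable_rv_coord i measurableT).
Qed.

Lemma obox_setI n (a b c d : 'rV[R]_n) : obox a b `&` obox c d =
  obox (\row_i Num.max (a ord0 i) (c ord0 i)) (\row_i Num.min (b ord0 i) (d ord0 i)).
Proof.
apply/seteqP; split => [x [xab xcd] i|x h]; last first.
  by split=> i; have := h i; rewrite !mxE gt_max lt_min => /andP[/andP[h1 h2] /andP[h3 h4]]; rewrite ?h1 ?h2 ?h3 ?h4.
by rewrite !mxE gt_max lt_min; have /andP[-> ->] := xab i; have /andP[-> ->] := xcd i.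
Qed.

(** Rational corners keep the family of boxes countable, and a whole closed box
    inside [A] leaves room for the supports of test functions. *)
Lemma obox_nbhs n (A : set 'rV[R]_n) x : open A -> A x ->
  exists a b : 'rV[R]_n, [/\ forall i, exists q : rat, a ord0 i = ratr q,
    forall i, exists q : rat, b ord0 i = ratr q, obox a b x &
    forall y : 'rV[R]_n, (forall i, a ord0 i <= y ord0 i <= b ord0 i) -> A y].
Proof.
move=> oA Ax; have /nbhs_ballP[e /= e0 eA] := open_nbhs_nbhs (conj oA Ax).
have qa i : {q : rat | x ord0 i - e < ratr q < x ord0 i}.
  have : x ord0 i - e < x ord0 i by lra.
  by move=> /rat_in_itvoo /cid[q]; rewrite in_itv/= => ?; exists q.
have qb i : {q : rat | x ord0 i < ratr q < x ord0 i + e}.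
  have : x ord0 i < x ord0 i + e by lra.
  by move=> /rat_in_itvoo /cid[q]; rewrite in_itv/= => ?; exists q.
exists (\row_i ratr (sval (qa i))), (\row_i ratr (sval (qb i))); split.
- by move=> i; exists (sval (qa i)); rewrite mxE.
- by move=> i; exists (sval (qb i)); rewrite mxE.
- move=> i; rewrite !mxE.
  by case: (qa i) => q /= /andP[_ ->]; case: (qb i) => r /= /andP[->].
- move=> y yab; apply: eA; split => // i j; rewrite (ord1 i).
  have := yab j; rewrite !mxE.
  case: (qa j) => q /= /andP[h1 h2]; case: (qb j) => r /= /andP[h3 h4] /andP[h5 h6].
  by rewrite /ball/= ltr_norml; apply/andP; split; lra.
Qed.

Definition ratrv n (q : {ffun 'I_n -> rat}) : 'rV[R]_n := \row_i ratr (q i).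

(** The countable union is what makes open sets measurable for a sigma-algebra
    that is generated by coordinates, and it reduces statements that hold almost
    everywhere on an open set to boxes. *)
Lemma open_bigcup_obox n (A : set 'rV[R]_n) : open A ->
  A = \bigcup_(q : {ffun 'I_n -> rat} * {ffun 'I_n -> rat})
     (if `[< forall y : 'rV[R]_n, (forall i, (ratrv q.1) ord0 i <= y ord0 i
         <= (ratrv q.2) ord0 i) -> A y >] then obox (ratrv q.1) (ratrv q.2)
      else set0).
Proof.
move=> oA; apply/seteqP; split => [x Ax|x [q _]]; last first.
  by case: ifPn => // /asboolP qA xq; apply: qA => i; move: (xq i) => /andP[/ltW -> /ltW ->].
have [a [b [qa qb xab abA]]] := obox_nbhs oA Ax.
have [fa faE] := choice qa; have [fb fbE] := choice qb.
have aE : a = ratrv (finfun fa) by apply/rowP => i; rewrite mxE ffunE.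
have bE : b = ratrv (finfun fb) by apply/rowP => i; rewrite mxE ffunE.
by exists (finfun fa, finfun fb) => //=; rewrite -aE -bE; case: asboolP.
Qed.

Lemma open_measurable_rV n (A : set 'rV[R]_n) : open A -> measurable A.
Proof.
move=> /open_bigcup_obox ->; apply: countable_bigcupT_measurable.
  exact: countableP.
by move=> q; case: ifP => // _; exact: measurable_obox.
Qed.

Lemma continuous_measurable_rV n (f : 'rV[R]_n -> R) :
  continuous f -> measurable_fun [set: 'rV[R]_n] f.
Proof.
move=> cf; apply: (measurability _ (measurable_realfun.RGenOpens.measurableE R)).
move=> /= _ [_ [a [b ->]] <-]; rewrite setTI; apply: open_measurable_rV.
by apply: open_comp => // x _; exact: cf.
Qed.

End rv_boxes.

(** * Integration on R^n by iterated integrals *)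

Section rv_topology.
Context {R : realType}.

Lemma cvg_rowP (T : Type) n (F : set_system T) {FF : Filter F}
    (g : T -> 'rV[R]_n) (l : 'rV[R]_n) :
  (forall i, (fun t => g t ord0 i) @ F --> (l ord0 i : R)) -> g @ F --> l.
Proof.
move=> gl A [P Pl PA]; change (F (g @^-1` A)).
have H (i : 'I_n) : \forall t \near F, P ord0 i (g t ord0 i) by apply: gl; exact: Pl.
apply: (@filterS T F FF _ _ _ (filter_forall FF H)) => t Ht; apply: PA => i j.
by rewrite (ord1 i).
Qed.

Lemma rv_cons0 n (t : R) (y : 'rV[R]_n) : rv_cons (t, y) ord0 ord0 = t.
Proof. by rewrite mxE unlift_none. Qed.

Lemma rv_consS n (t : R) (y : 'rV[R]_n) k :
  rv_cons (t, y) ord0 (lift ord0 k) = y ord0 k.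
Proof. by rewrite mxE liftK. Qed.

Lemma continuous_rv_consl n (y : 'rV[R]_n) : continuous (fun t : R => rv_cons (t, y)).
Proof.
move=> t; apply: (@cvg_rowP _ _ (nbhs t)) => i; case: (unliftP ord0 i) => [k|] ->.
  by under eq_fun do rewrite rv_consS; rewrite rv_consS; exact: cvg_cst.
by under eq_fun do rewrite rv_cons0; rewrite rv_cons0; exact: cvg_id.
Qed.

Lemma continuous_rv_consr n (t : R) : continuous (fun y : 'rV[R]_n => rv_cons (t, y)).
Proof.
move=> y; apply: (@cvg_rowP _ _ (nbhs y)) => i; case: (unliftP ord0 i) => [k|] ->.
  by under eq_fun do rewrite rv_consS; rewrite rv_consS; exact: coord_continuous.
by under eq_fun do rewrite rv_cons0; rewrite rv_cons0; exact: cvg_cst.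
Qed.

End rv_topology.

Section lebesgue_rv_theory.
Context {R : realType}.
Local Open Scope ereal_scope.

Lemma lebesgue_rVS n (A : set 'rV[R]_n.+1) : lebesgue_rV n.+1 A =
  (@lebesgue_measure R \x lebesgue_rV n) (@rv_cons R n @^-1` A).
Proof. by []. Qed.

Lemma lebesgue_rV_obox n (a b : 'rV[R]_n) : (forall i, a ord0 i <= b ord0 i)%R ->
  lebesgue_rV n (obox a b) = (\prod_i (b ord0 i - a ord0 i))%:E.
Proof.
elim: n a b => [|n IH] a b ab.
  rewrite big_ord0 /= diracE mem_set// => i; by case: i.
rewrite lebesgue_rVS (_ : _ @^-1` _ =
    `]a ord0 ord0, b ord0 ord0[%classic `*` obox (\row_k a ord0 (lift ord0 k))
    (\row_k b ord0 (lift ord0 k))); last first.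
  apply/seteqP; split => [[t y] tyab|[t y] [/= tab yab] i].
    split => [|k]; first by have := tyab ord0; rewrite /= rv_cons0 in_itv.
    by have := tyab (lift ord0 k); rewrite /= rv_consS !mxE.
  case: (unliftP ord0 i) => [k|] ->; first by rewrite rv_consS; have := yab k; rewrite !mxE.
  by rewrite rv_cons0; move: tab; rewrite in_itv.
rewrite product_measure1E//; last exact: measurable_obox.
rewrite -[X in X * _]/(lebesgue_measure `]a ord0 ord0, b ord0 ord0[%classic).
rewrite lebesgue_measure_itv/= lte_fin IH; last by move=> i; rewrite !mxE.
rewrite big_ord_recl/= EFinM; congr (_ * _).
  case: ltP => // h; have /eqP -> : b ord0 ord0 == a ord0 ord0 by rewrite eq_le h ab.
  by rewrite subrr.
by congr EFin; apply: eq_bigr => i _; rewrite !mxE.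
Qed.

(** Both orders of integration are needed: which one isolates a partial
    derivative depends on the coordinate. *)
Lemma lebesgue_rV_integralS n (f : 'rV[R]_n.+1 -> \bar R) :
  (lebesgue_rV n.+1).-integrable setT f ->
  \int[lebesgue_rV n.+1]_x f x =
    \int[lebesgue_rV n]_y \int[@lebesgue_measure R]_t f (rv_cons (t, y)) /\
  \int[lebesgue_rV n.+1]_x f x =
    \int[@lebesgue_measure R]_t \int[lebesgue_rV n]_y f (rv_cons (t, y)).
Proof.
move=> intf; have mf := measurable_int _ intf.
have mc := @measurable_rv_cons R n.
have intfc : (@lebesgue_measure R \x lebesgue_rV n).-integrable setT
    (f \o (@rv_cons R n : measurableTypeR R * 'rV[R]_n -> 'rV[R]_n.+1)).
  apply/integrableP; split; first exact: (measurableT_comp mf mc).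
  have /integrableP[_] := intf; apply: le_lt_trans.
  rewrite -[X in _ <= X]/(\int[pushforward _ _]_x _).
  by rewrite ge0_integral_pushforward//; exact: measurableT_comp.
rewrite -[\int[lebesgue_rV n.+1]_x f x]/(\int[pushforward (@lebesgue_measure R \x lebesgue_rV n)
    (@rv_cons R n : measurableTypeR R * 'rV[R]_n -> 'rV[R]_n.+1)]_x f x).
rewrite integral_pushforward//.
by split; [rewrite -(integral21_prod_meas1 intfc)|rewrite -(integral12_prod_meas1 intfc)].
Qed.

Lemma integrable_bounded_obox n (f : 'rV[R]_n -> R) (a b : 'rV[R]_n) (C : R) :
  measurable_fun setT f -> (forall x, `|f x| <= C)%R ->
  (forall x, ~ obox a b x -> f x = 0%R) ->
  (lebesgue_rV n).-integrable setT (EFin \o f).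
Proof.
move=> mf fC f0.
pose a' : 'rV[R]_n := (\row_i Num.min (a ord0 i) (b ord0 i))%R.
have sub : obox a b `<=` obox a' b.
  by move=> x xab i; rewrite mxE; have := xab i; move=> /andP[h1 h2]; rewrite gt_min h1 h2.
have -> : EFin \o f = (EFin \o f) \_ (obox a' b).
  apply/funext => x; rewrite patchE; case: ifPn => // /negP; rewrite inE => nab.
  by rewrite /= f0// => /sub.
apply/(integrable_mkcond (EFin \o f) (measurable_obox a' b)).
apply: measurable_bounded_integrable.
- exact: measurable_obox.
- have h i : (a' ord0 i <= b ord0 i)%R by rewrite mxE ge_min lexx orbT.
  by have := ltry (\prod_i (b ord0 i - a' ord0 i))%R; rewrite -(lebesgue_rV_obox h).
- exact: measurable_funTS.
- by exists C; split; [exact: num_real|move=> M CM x _; apply: le_trans (fC x) (ltW CM)].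
Qed.

End lebesgue_rv_theory.

Section calculus.
Context {R : realType}.

Lemma continuous_box_bounded n (f : 'rV[R]_n -> R) (L : R) : continuous f ->
  (forall x, ~ obox (const_mx (- L)) (const_mx L) x -> f x = 0) ->
  exists C : R, forall x, `|f x| <= C.
Proof.
move=> cf f0.
pose K := [set v : 'rV[R]_n | forall i, `[- L, L]%classic (v ord0 i)].
have cK : compact K.
  by apply: (@rV_compact _  _ (fun=> `[- L, L]%classic)) => _; exact: segment_compact.
have : bounded_set (f @` K).
  apply: compact_bounded; apply: continuous_compact => //.
  exact: continuous_subspaceT.
case=> M [_ fM]; exists (Num.max 0 (M + 1)) => x.
have [Kx|Kx] := pselect (obox (const_mx (- L)) (const_mx L) x); last first.
  by rewrite f0// normr0 le_max lexx.
rewrite le_max; apply/orP; right; apply: (fM _ _ (f x)); first by rewrite ltrDl.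
exists x => // i; rewrite /= in_itv/=; have := Kx i; rewrite !mxE.
by move=> /andP[/ltW -> /ltW ->].
Qed.

Lemma is_derive_rv_consl n (F : 'rV[R]_n.+1 -> R) (y : 'rV[R]_n) (t d : R) :
  is_derive (rv_cons (t, y)) (delta_mx ord0 ord0 : 'rV[R]_n.+1) F d ->
  is_derive t 1 (fun t => F (rv_cons (t, y))) d.
Proof.
move=> dF; rewrite (_ : (is_derive t 1 _ _) =
  is_derive (rv_cons (t, y)) (delta_mx ord0 ord0 : 'rV[R]_n.+1) F d)//.
have E : (fun h : R => h^-1 *: (((fun t => F (rv_cons (t, y))) \o shift t) (h *: (1 : R))
    - F (rv_cons (t, y)))) =
  (fun h => h^-1 *: ((F \o shift (rv_cons (t, y))) (h *: (delta_mx ord0 ord0 : 'rV[R]_n.+1))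
    - F (rv_cons (t, y)))).
  apply/funext => h; congr (_ *: (F _ - _)); apply/rowP => i.
  case: (unliftP ord0 i) => [k|] ->; rewrite !mxE ?liftK ?unlift_none ?eqxx ?mulr1 ?mulr0 ?add0r//.
  by rewrite /GRing.scale /= mulr1.
by apply/propext; split => -[e1 e2]; split; move: e1 e2; rewrite /derivable /derive E.
Qed.

Lemma is_derive_rv_consr n (F : 'rV[R]_n.+1 -> R) (y : 'rV[R]_n) (t d : R) k :
  is_derive (rv_cons (t, y)) (delta_mx ord0 (lift ord0 k) : 'rV[R]_n.+1) F d ->
  is_derive y (delta_mx ord0 k : 'rV[R]_n) (fun y => F (rv_cons (t, y))) d.
Proof.
move=> dF; rewrite (_ : (is_derive y _ _ _) =
  is_derive (rv_cons (t, y)) (delta_mx ord0 (lift ord0 k) : 'rV[R]_n.+1) F d)//.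
have E : (fun h : R => h^-1 *: (((fun y => F (rv_cons (t, y))) \o shift y)
    (h *: (delta_mx ord0 k : 'rV[R]_n)) - F (rv_cons (t, y)))) =
  (fun h => h^-1 *: ((F \o shift (rv_cons (t, y))) (h *: (delta_mx ord0 (lift ord0 k) : 'rV[R]_n.+1))
    - F (rv_cons (t, y)))).
  apply/funext => h; congr (_ *: (F _ - _)); apply/rowP => i.
  case: (unliftP ord0 i) => [l|] ->; rewrite !mxE ?liftK ?unlift_none/=.
    by rewrite !mxE (inj_eq lift_inj).
  by rewrite mulr0 add0r.
by apply/propext; split => -[e1 e2]; split; move: e1 e2; rewrite /derivable /derive E.
Qed.

(** Integration by parts without boundary terms. Integrating first in the
    direction of differentiation gives zero by the fundamental theorem of calculus
    if that direction is the first one; otherwise the inner integral vanishes by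
    induction on the dimension. *)
Lemma integral_compact_derive n (j : 'I_n) (F f : 'rV[R]_n -> R) (L : R) :
  (forall x, is_derive x (delta_mx ord0 j : 'rV[R]_n) F (f x)) -> continuous f ->
  (forall x, ~ obox (const_mx (- L)) (const_mx L) x -> F x = 0 /\ f x = 0) ->
  (\int[lebesgue_rV n]_x (f x)%:E = 0)%E.
Proof.
elim: n j F f => [[]//|n IH] j F f dF cf Ff0.
have f0 x : ~ obox (const_mx (- L)) (const_mx L) x -> f x = 0 by move=> /Ff0[].
have [C fC] := continuous_box_bounded cf f0.
have intf : (lebesgue_rV n.+1).-integrable setT (EFin \o f).
  by apply: (integrable_bounded_obox _ fC f0); exact: continuous_measurable_rV.
have [E1 E2] := lebesgue_rV_integralS intf.
case: (unliftP ord0 j) dF => [k|] -> dF; last first.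
  rewrite E1; apply: integral0_eq => y _.
  (* A nondegenerate interval that contains the support even if [L] is negative. *)
  pose L' := Num.max L 0 + 1.
  have LL' : L < L' by rewrite /L' (@le_lt_trans _ _ (Num.max L 0)) ?le_max ?lexx// ltrDl.
  have L'0 : 0 < L' by rewrite /L' (@le_lt_trans _ _ (Num.max L 0)) ?le_max ?lexx ?orbT// ltrDl.
  have out t : (t <= - L') || (L' <= t) -> ~ obox (const_mx (- L)) (const_mx L) (rv_cons (t, y)).
    move=> ht /(_ ord0); rewrite !mxE unlift_none/= => /andP[h1 h2].
    by case/orP: ht => ht; move: h1 h2 ht LL'; clear; lra.
  transitivity (\int[@lebesgue_measure R]_(t in `[(- L')%R, L']%classic) (f (rv_cons (t, y)))%:E)%E.
    rewrite [RHS]integral_mkcond; apply: eq_integral => t _; rewrite patchE.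
    case: ifPn => // /negP; rewrite inE/= in_itv/= => /negP.
    rewrite negb_and -!ltNge => h; rewrite f0//; apply: out.
    by case/orP: h => /ltW ->//; rewrite orbT.
  have dG t := is_derive_rv_consl (dF (rv_cons (t, y))).
  rewrite (@continuous_FTC2 _ _ (fun t => F (rv_cons (t, y)))).
  - by rewrite (Ff0 _ (out L' _)).1 ?lexx ?orbT// (Ff0 _ (out (- L') _)).1 ?lexx// sube0.
  - by move: L'0; clear; lra.
  - apply: continuous_subspaceT => t; apply: continuous_comp; last exact: cf.
    exact: continuous_rv_consl.
  - have cG t : {for t, continuous (fun t => F (rv_cons (t, y)))}.
      by apply/differentiable_continuous/derivable1_diffP; exact: ex_derive.
    split.
    + by move=> t _; exact: ex_derive.
    + by apply: cvg_at_right_filter; exact: cG.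
    + by apply: cvg_at_left_filter; exact: cG.
  - by move=> t _; rewrite derive1E derive_val.
rewrite E2; apply: integral0_eq => t _.
apply: (IH k (fun y => F (rv_cons (t, y))) (fun y => f (rv_cons (t, y)))).
- by move=> y; apply: is_derive_rv_consr; exact: dF.
- move=> y; apply: continuous_comp; last exact: cf.
  exact: continuous_rv_consr.
- move=> y ny; apply: Ff0 => h; apply: ny => i.
  by have := h (lift ord0 i); rewrite rv_consS !mxE.
Qed.

End calculus.

(** * A smooth function flat at the origin *)

Section flat.
Context {R : realType}.
Implicit Types (q : {poly R}) (t y : R).

Lemma exprn_le_expR i y : 0 <= y -> y ^+ i <= i`!%:R * expR y.
Proof.
move=> y0; case: i => [|i]; first by rewrite expr0 fact0 mul1r -expR0 ler_expR.
rewrite mulrC -ler_pdivrMr ?ltr0n ?fact_gt0//.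
by apply: le_trans (expR_ge1Dxn i y0); rewrite lerDr.
Qed.

Lemma horner_le_expR q : exists2 C, 0 <= C & forall y, 0 <= y -> `|q.[y]| <= C * expR y.
Proof.
exists (\sum_(i < size q) `|q`_i| * i`!%:R) => [|y y0].
  by apply: sumr_ge0 => i _; rewrite mulr_ge0.
rewrite horner_coef mulr_suml; apply: le_trans (ler_norm_sum _ _ _) _.
apply: ler_sum => i _; rewrite normrM -mulrA ler_wpM2l// ger0_norm ?exprn_ge0//.
exact: exprn_le_expR.
Qed.

(** [flat 1] is the standard function exp(-1/t) that is flat at the origin. *)
Definition flat q t : R := if 0 < t then q.[t^-1] * expR (- t^-1) else 0.

(** The chain rule for q(1/t) exp(-1/t), written on the polynomial [q]. *)
Definition flat_deriv q : {poly R} := 'X^2 * (q - q^`()).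

(** A quadratic bound is all that differentiability at the origin needs; it
    comes from exp(y) dominating every polynomial in y = 1/t. *)
Lemma flat_le q : exists2 C, 0 <= C & forall t, `|flat q t| <= C * t ^+ 2.
Proof.
have [C C0 qC] := horner_le_expR (q * 'X^2).
exists C => // t; rewrite /flat; case: ifPn => t0; last first.
  by rewrite normr0 mulr_ge0// sqr_ge0.
have := qC t^-1; rewrite invr_ge0 (ltW t0) => /(_ isT).
rewrite hornerM hornerXn normrM [`|t^-1 ^+ 2|]ger0_norm ?sqr_ge0// exprVn.
rewrite ler_pdivrMr ?exprn_gt0// => h.
rewrite normrM [`|expR _|]ger0_norm ?expR_ge0// expRN ler_pdivrMr ?expR_gt0//.
by rewrite mulrAC.
Qed.

(** The functions [flat q] are stable by differentiation, hence all of them are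
    smooth. *)
Lemma is_derive_flat q t : is_derive t 1 (flat q) (flat (flat_deriv q) t).
Proof.
have [t0|t0|->] := ltrgtP t 0.
- have E : \forall s \near t, (fun=> 0 : R) s = flat q s.
    near=> s; rewrite /flat ltNge ifN// negbK; apply/ltW.
    by near: s; exact: lt_nbhsl.
  rewrite {2}/flat ltNge (ltW t0)/=.
  by apply: near_eq_is_derive E _; exact: is_derive_cst.
- have E : \forall s \near t, (fun s => q.[s^-1] * expR (- s^-1)) s = flat q s.
    by near=> s; rewrite /flat ifT//; near: s; exact: lt_nbhsr.
  apply: near_eq_is_derive E _.
  have dV : is_derive t 1 (fun s : R => s^-1) (- t ^- 2).
    have [a b] := (@is_deriveV R id t 1 1 (lt0r_neq0 t0) (is_derive_id _ _)).
    by split=> //; rewrite b /GRing.scale/= mulr1.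
  have dq : is_derive t^-1 1 (horner q) (q^`()).[t^-1].
    by split; [exact: derivable_horner|rewrite derivE derive1E].
  have d1 := is_derive1_comp dq dV.
  have d2 : is_derive t 1 (expR \o (fun s : R => - s^-1)) (expR (- t^-1) * - - t ^- 2).
    exact: is_derive1_comp.
  have [e1 e2] := is_deriveM d1 d2; split => //.
  rewrite e2 /flat t0 /flat_deriv !hornerE exprVn /GRing.scale/=.
  by ring.
- have fq0 : flat q 0 = 0 by rewrite /flat ltxx.
  have -> : flat (flat_deriv q) 0 = 0 by rewrite /flat ltxx.
  have [C C0 fC] := flat_le q.
  suff h0 : (fun h : R => h^-1 *: ((flat q \o shift 0) (h *: (1 : R)) - flat q 0)) @ 0^' --> (0 : R).
    split; first by apply/cvg_ex; exists 0.
    exact/cvg_lim.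
  apply/cvgrPdist_le => e e0; near=> h.
  have hn0 : h != 0 by near: h; exact: nbhs_dnbhs_neq.
  rewrite sub0r normrN /= fq0 subr0 addr0 /GRing.scale/= mulr1 normrM normfV.
  rewrite mulrC ler_pdivrMr ?normr_gt0//; apply: le_trans (fC h) _.
  rewrite -real_normK ?num_real// expr2 mulrA ler_wpM2r//.
  have he : `|h| <= e / (C + 1).
    by near: h; apply: dnbhs0_le; rewrite divr_gt0// ltr_wpDl.
  have C1 : 0 < C + 1 by rewrite ltr_wpDl.
  rewrite ler_pdivlMr// in he; apply: le_trans he.
  by rewrite mulrC ler_wpM2l// lerDl.
Unshelve. all: by end_near. Qed.

Lemma flat_eq0 q t : t <= 0 -> flat q t = 0.
Proof. by move=> t0; rewrite /flat ltNge t0. Qed.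

Lemma flat1_ge0_le1 t : 0 <= flat 1 t <= 1.
Proof.
rewrite /flat; case: ifPn => [t0|_]; last by rewrite lexx ler01.
by rewrite hornerC mul1r expR_ge0 expR_le1 oppr_le0 invr_ge0 ltW.
Qed.

(** Rescaling exp(-1/t) to exp(-1/(m t)) makes it tend to the indicator of the
    positive half-line without moving its support. *)
Lemma cvg_flat1 t : 0 < t -> flat 1 (m.+1%:R * t) @[m --> \oo] --> (1 : R).
Proof.
move=> t0.
rewrite (_ : (fun m => _) = (fun m => expR (- (m.+1%:R^-1 * t^-1)))); last first.
  by apply/funext => m; rewrite /flat mulr_gt0// hornerC mul1r invfM.
rewrite -{2}expR0; apply: continuous_cvg; first exact: continuous_expR.
rewrite -oppr0; apply: cvgN; rewrite -[X in _ --> X](mul0r t^-1).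
by apply: cvgM; [exact: cvg_harmonic|exact: cvg_cst].
Qed.

End flat.

(** * Smooth functions and mollified boxes *)

Section partials.
Context {R : realType} {n : nat}.
Local Notation V := 'rV[R]_n.
Implicit Types (f g : V -> R) (j : 'I_n).

Lemma partialD j f g x : differentiable f x -> differentiable g x ->
  partial j (fun x => f x + g x) x = partial j f x + partial j g x.
Proof. by move=> df dg; exact: deriveD (diff_derivable df) (diff_derivable dg). Qed.

Lemma partialZ j c f x : differentiable f x ->
  partial j (fun x => c * f x) x = c * partial j f x.
Proof. by move=> df; exact: deriveZ (diff_derivable df). Qed.

Lemma partialM j f g x : differentiable f x -> differentiable g x ->
  partial j (fun x => f x * g x) x = partial j f x * g x + f x * partial j g x.
Proof.
move=> df dg; rewrite addrC [partial j f x * _]mulrC.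
exact: deriveM (diff_derivable df) (diff_derivable dg).
Qed.

Lemma partial_near j f g x : (\near x, f x = g x) -> partial j f x = partial j g x.
Proof. exact: near_eq_derive. Qed.

Lemma partial_cst j (c : R) (x : V) : partial j (fun=> c) x = 0.
Proof. exact: derive_cst. Qed.

Lemma differentiable_affine_coord (a b : R) i x :
  differentiable (fun x : V => a * x ord0 i + b) x.
Proof.
apply: differentiableD; last exact: differentiable_cst.
by apply: differentiableM; [exact: differentiable_cst|exact: differentiable_coord].
Qed.

Global Instance is_derive_coord i (x v : V) :
  is_derive x v (fun y : V => y ord0 i : R) (v ord0 i).
Proof.
suff l0 : (fun h : R => h^-1 *: (((fun y : V => y ord0 i : R) \o shift x) (h *: v) - x ord0 i)) @ 0^' -->
    (v ord0 i : R).
  by split; [apply/cvg_ex; exists (v ord0 i)|exact/cvg_lim].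
apply: cvg_near_cst; near=> h.
have hn0 : h != 0 by near: h; exact: nbhs_dnbhs_neq.
by rewrite /= !mxE addrK /GRing.scale/= mulKf.
Unshelve. all: by end_near. Qed.

(** Stated for a profile [h] of one variable so that it applies to all the
    functions [flat q]. *)
Lemma partial_affine_comp j (h h' : R -> R) (a b : R) i (x : V) :
  (forall t : R, is_derive t (1 : R) h (h' t)) ->
  partial j (fun x => h (a * x ord0 i + b)) x =
    (i == j)%:R * (a * h' (a * x ord0 i + b)).
Proof.
move=> dh.
pose l := fun x : V => a * x ord0 i + b.
have dl : differentiable l x by exact: differentiable_affine_coord.
have dh1 : differentiable h (l x).
  by apply/derivable1_diffP; exact: ex_derive.
have Dl : 'D_(delta_mx ord0 j : V) l x = (i == j)%:R * a.
  rewrite /l deriveD ?derive_cst ?addr0; [|exact: derivableZ|exact: derivable_cst].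
  by rewrite deriveZ// derive_val /GRing.scale/= mxE eqxx mulrC.
change ('D_(delta_mx ord0 j : V) (h \o l) x = (i == j)%:R * (a * h' (l x))).
rewrite deriveE; last exact: differentiable_comp.
rewrite deriveE// in Dl; rewrite diff_comp//= Dl.
rewrite -[(i == j)%:R * a]mulr1 -/(((i == j)%:R * a) *: (1 : R)) linearZ/=.
by rewrite -deriveE// derive_val /GRing.scale/= mulrA.
Qed.

Lemma differentiable_affine_comp (h h' : R -> R) (a b : R) i (x : V) :
  (forall t : R, is_derive t (1 : R) h (h' t)) ->
  differentiable (fun x : V => h (a * x ord0 i + b)) x.
Proof.
move=> dh.
apply: (@differentiable_comp _ _ _ _ (fun x : V => a * x ord0 i + b) h).
  exact: differentiable_affine_coord.
by apply/derivable1_diffP; exact: ex_derive.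
Qed.

End partials.

Section smooth.
Context {R : realType} {n : nat}.
Local Notation V := 'rV[R]_n.
Implicit Types (f g : V -> R) (j : 'I_n).

Lemma smooth_differentiable f x : smooth f -> differentiable f x.
Proof. by move=> /(_ [::]). Qed.

Lemma smooth_partial j f : smooth f -> smooth (partial j f).
Proof. by move=> sf s x; have := sf (rcons s j) x; rewrite foldr_rcons. Qed.

Lemma smooth_continuous f : smooth f -> continuous f.
Proof. by move=> sf x; apply: differentiable_continuous; exact: smooth_differentiable. Qed.

(** Coinduction: smoothness is the largest class of differentiable functions
    stable by partial derivatives. *)
Lemma smooth_coind (P : (V -> R) -> Prop) :
  (forall f, P f -> (forall x, differentiable f x) /\ forall j, P (partial j f)) ->
  forall f, P f -> smooth f.
Proof.
move=> HP f Pf s; elim/last_ind: s f Pf => [|s j IH] f Pf x.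
  exact: (HP f Pf).1.
by rewrite foldr_rcons; apply: IH; exact: (HP f Pf).2.
Qed.

(** An algebra of functions that partial derivatives preserve by the Leibniz
    rule: closure of smooth functions under sums and products follows by
    coinduction. *)
Inductive smooth_alg : (V -> R) -> Prop :=
| SmoothBase f of smooth f : smooth_alg f
| SmoothCst c : smooth_alg (fun=> c)
| SmoothFlat q a b i : smooth_alg (fun x => flat q (a * x ord0 i + b))
| SmoothAdd f g of smooth_alg f & smooth_alg g : smooth_alg (fun x => f x + g x)
| SmoothMul f g of smooth_alg f & smooth_alg g : smooth_alg (fun x => f x * g x).

Lemma smooth_algP f : smooth_alg f -> smooth f.
Proof.
apply: smooth_coind => {}f; elim => {f} [f sf|c|q a b i|f g _ [df IHf] _ [dg IHg]|f g sf [df IHf] sg [dg IHg]].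
- split=> [x|j]; first exact: smooth_differentiable.
  by apply: SmoothBase; exact: smooth_partial.
- split=> // j; rewrite (_ : partial j _ = fun=> 0); first exact: SmoothCst.
  by apply/funext => x; exact: partial_cst.
- split=> [x|j]; first by apply: differentiable_affine_comp => t; exact: is_derive_flat.
  rewrite (_ : partial j _ = fun x => (i == j)%:R * a * flat (flat_deriv q) (a * x ord0 i + b)).
    by apply: SmoothMul; [exact: SmoothCst|exact: SmoothFlat].
  by apply/funext => x; rewrite (partial_affine_comp j a b i x (is_derive_flat q)) mulrA.
- split=> [x|j]; first exact: differentiableD.
  rewrite (_ : partial j _ = fun x => partial j f x + partial j g x).
    by apply: SmoothAdd.
  by apply/funext => x; exact: partialD.
- split=> [x|j]; first exact: differentiableM.
  rewrite (_ : partial j _ = fun x => partial j f x * g x + f x * partial j g x).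
    by apply: SmoothAdd; apply: SmoothMul.
  by apply/funext => x; exact: partialM.
Qed.

Lemma smoothD f g : smooth f -> smooth g -> smooth (fun x => f x + g x).
Proof. by move=> sf sg; apply: smooth_algP; apply: SmoothAdd; exact: SmoothBase. Qed.

Lemma smoothM f g : smooth f -> smooth g -> smooth (fun x => f x * g x).
Proof. by move=> sf sg; apply: smooth_algP; apply: SmoothMul; exact: SmoothBase. Qed.

Lemma smoothZ c f : smooth f -> smooth (fun x => c * f x).
Proof.
by move=> sf; apply: smooth_algP; apply: SmoothMul; [exact: SmoothCst|exact: SmoothBase].
Qed.

(** A mollified indicator of the box: it increases to the indicator of
    [obox a b] as [m] tends to infinity, since [flat 1] is exp(-1/t). *)
Definition box_bump (a b : V) (m : nat) (x : V) : R :=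
  \prod_(i < n) (flat 1 (m.+1%:R * (x ord0 i - a ord0 i)) *
                 flat 1 (m.+1%:R * (b ord0 i - x ord0 i))).

Lemma smooth_box_bump a b m : smooth (box_bump a b m).
Proof.
apply: smooth_algP; rewrite /box_bump.
elim: (index_enum _) => [|i s IH].
  rewrite (_ : (fun _ => _) = fun=> 1); first exact: SmoothCst.
  by apply/funext => x; rewrite big_nil.
rewrite [X in smooth_alg X](_ : _ = fun x : V => flat 1 (m.+1%:R * x ord0 i + - (m.+1%:R * a ord0 i))
    * flat 1 (- m.+1%:R * x ord0 i + m.+1%:R * b ord0 i) *
    \prod_(i <- s) (flat 1 (m.+1%:R * (x ord0 i - a ord0 i)) *
                 flat 1 (m.+1%:R * (b ord0 i - x ord0 i)))).
  apply: SmoothMul => //; apply: SmoothMul; exact: SmoothFlat.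
apply/funext => x; rewrite big_cons; congr (flat _ _ * flat _ _ * _).
  by rewrite mulrBr.
by rewrite mulrBr addrC mulNr.
Qed.

Lemma box_bump_ge0_le1 a b m x : 0 <= box_bump a b m x <= 1.
Proof.
apply/andP; split.
  apply: prodr_ge0 => i _; apply: mulr_ge0.
    by have /andP[] := flat1_ge0_le1 (m.+1%:R * (x ord0 i - a ord0 i)).
  by have /andP[] := flat1_ge0_le1 (m.+1%:R * (b ord0 i - x ord0 i)).
apply: prodr_ile1 => i _; have /andP[h1 h2] := flat1_ge0_le1 (m.+1%:R * (x ord0 i - a ord0 i)).
have /andP[h3 h4] := flat1_ge0_le1 (m.+1%:R * (b ord0 i - x ord0 i)).
by rewrite mulr_ge0//= mulr_ile1.
Qed.

Lemma box_bump_out a b m x : ~ obox a b x -> box_bump a b m x = 0.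
Proof.
move=> /existsNP[i /negP]; rewrite negb_and -!leNgt => h.
apply/eqP; rewrite /box_bump prodf_seq_eq0; apply/hasP; exists i; first exact: mem_index_enum.
rewrite /= mulf_eq0; apply/orP; case/orP: h => h; [left|right];
  by rewrite flat_eq0// mulr_ge0_le0// subr_le0.
Qed.

Lemma cvg_box_bump a b x : box_bump a b m x @[m --> \oo] --> (\1_(obox a b) x : R).
Proof.
have [xab|xab] := pselect (obox a b x); last first.
  rewrite indicE memNset//; apply: cvg_near_cst; near=> m; exact: box_bump_out.
rewrite indicE mem_set// (_ : 1%:R = \prod_(i < n) (1 * 1) :> R); last first.
  by rewrite big1// => i _; rewrite mulr1.
apply: cvg_big => [|i _]; first exact: mul_continuous.
have /andP[h1 h2] := xab i.
by apply: cvgM; apply: cvg_flat1; rewrite subr_gt0.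
Unshelve. all: by end_near. Qed.

End smooth.

(** * Functions with zero integral on all boxes *)

Section box_generation.
Context {R : realType} {n : nat}.
Local Notation V := 'rV[R]_n.

Definition oboxes : set (set V) := [set A | exists a b, A = obox a b].

Lemma oboxesI : setI_closed oboxes.
Proof.
by move=> _ _ [a [b ->]] [c [d ->]]; rewrite obox_setI; do 2 eexists.
Qed.

(** Boxes form a pi-system that generates the sigma-algebra, which is what an
    induction on measurable sets requires. *)
Lemma measurable_oboxes : @measurable _ V = <<s oboxes >>.
Proof.
apply/seteqP; split; last first.
  apply: smallest_sub; first exact: sigma_algebra_measurable.
  by move=> _ [a [b ->]]; exact: measurable_obox.
apply: smallest_sub; first exact: smallest_sigma_algebra.
move=> A; rewrite -bigcup_seq => -[i _] [C mC <-]; rewrite setTI.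
suff : measurable_fun setT ((fun x => x ord0 i) : g_sigma_algebraType oboxes -> R).
  by move=> /(_ measurableT C mC); rewrite setTI.
apply: (measurability _ (measurable_realfun.RGenOpens.measurableE R)).
move=> _ [_ [a [b ->]] <-]; rewrite setTI.
have /open_bigcup_obox -> : open ((fun x : V => x ord0 i) @^-1` `]a, b[).
  by apply: open_comp => // x _; exact: coord_continuous.
apply: countable_bigcupT_measurable; first exact: countableP.
move=> q; case: ifP => _; last exact: measurable0.
by apply: sub_sigma_algebra; do 2 eexists.
Qed.

End box_generation.

Section integral_boxes.
Context {R : realType} {n : nat}.
Local Notation V := 'rV[R]_n.
Local Notation mu := (lebesgue_rV n).
Local Open Scope ereal_scope.

(** The sets on which [h] has zero integral form a Dynkin system that contains
    the boxes. *)
Lemma integral_boxes_eq0 (h : V -> \bar R) : mu.-integrable setT h ->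
  \int[mu]_x h x = 0 ->
  (forall a b, \int[mu]_(x in obox a b) h x = 0) ->
  ae_eq mu setT h (cst 0).
Proof.
move=> inth h0 hab; apply: integral_ae_eq => // E _ mE.
rewrite integral0; move: (mE); rewrite measurable_oboxes; move: E {mE}.
apply: dynkin_induction => //.
- exact: measurable_oboxes.
- exact: oboxesI.
- by move=> _ [a [b ->]]; exact: hab.
- move=> S mS hS.
  have : \int[mu]_(x in S `|` ~` S) h x = 0 by rewrite setUv.
  rewrite integral_setU//.
  + by rewrite hS add0e.
  + exact: measurableC.
  + by apply: measurable_funTS; exact: measurable_int inth.
  + by apply/disj_setPS; rewrite setICr.
- move=> F mF tF hF.
  rewrite integral_bigcup//.
    by rewrite eseries0.
  by apply: integrableS inth => //; exact: bigcupT_measurable.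
Qed.

End integral_boxes.

(** * Test functions *)

Section test_functions.
Context {R : realType} {n : nat}.
Local Notation V := 'rV[R]_n.
Local Notation mu := (lebesgue_rV n).
Implicit Types (Omega D K : set V) (psi chi f g : V -> R) (j : 'I_n).

Lemma rV_hausdorff : hausdorff_space V.
Proof. exact: (@norm_hausdorff R V). Qed.

Lemma bounded_set_obox K : bounded_set K ->
  exists L : R, K `<=` obox (const_mx (- L)) (const_mx L).
Proof.
case=> M [_ KM]; exists (M + 2) => x Kx i; rewrite !mxE -ltr_norml.
have h : `|x| <= M + 1 by apply: KM => //; rewrite ltrDl.
apply: (@le_lt_trans _ _ (M + 1)); last by rewrite ltrD2l ltr1n.
apply: le_trans h.
rewrite [leRHS]/Num.norm/= mx_normrE.
by apply/bigmax_geP; right => /=; exists (ord0, i).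
Qed.

Lemma bounded_lebesgue_lty D : measurable D -> bounded_set D -> (mu D < +oo)%E.
Proof.
move=> mD /bounded_set_obox[L DL].
(* The bound [L] may be negative when [D] is empty. *)
pose L' := Num.max L 0.
have h (i : 'I_n) : (const_mx (- L') : V) ord0 i <= (const_mx L' : V) ord0 i.
  by rewrite !mxE ge0_cp// le_max lexx orbT.
apply: (@le_lt_trans _ _ (mu (obox (const_mx (- L')) (const_mx L')))).
  apply: le_measure; rewrite ?inE//; first exact: measurable_obox.
  move=> x /DL xL i; have := xL i; rewrite !mxE => /andP[h1 h2].
  by rewrite -ltr_norml (@lt_le_trans _ _ L)// ?le_max ?lexx// ltr_norml h1.
by have := ltry (\prod_i ((const_mx L' : V) ord0 i - (const_mx (- L') : V) ord0 i)); rewrite -(lebesgue_rV_obox h).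
Qed.

Lemma partial_out K psi j : closed K -> (forall x, ~ K x -> psi x = 0) ->
  forall x, ~ K x -> partial j psi x = 0.
Proof.
move=> cK psi0 x nKx; rewrite (@partial_near _ _ j psi (fun=> 0)) ?partial_cst//.
have : \forall y \near x, (~` K) y.
  by apply: open_nbhs_nbhs; split => //; exact: closed_openC.
by apply: filterS => y; exact: psi0.
Qed.

Lemma test_function_partial Omega psi j :
  test_function Omega psi -> test_function Omega (partial j psi).
Proof.
move=> [spsi [K [cK KO psi0]]]; split; first exact: smooth_partial.
exists K; split=> // x; apply: partial_out => //.
by apply: compact_closed => //; exact: rV_hausdorff.
Qed.

Lemma test_functionD Omega psi chi : test_function Omega psi ->
  test_function Omega chi -> test_function Omega (fun x => psi x + chi x).
Proof.
move=> [spsi [K [cK KO psi0]]] [schi [K' [cK' KO' chi0]]]; split; first exact: smoothD.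
exists (K `|` K'); split; first exact: compactU.
  by move=> x [/KO|/KO'].
by move=> x /not_orP[/psi0 -> /chi0 ->]; rewrite addr0.
Qed.

Lemma test_functionM Omega psi chi : test_function Omega psi ->
  smooth chi -> test_function Omega (fun x => psi x * chi x).
Proof.
move=> [spsi [K [cK KO psi0]]] schi; split; first exact: smoothM.
by exists K; split=> // x /psi0 ->; rewrite mul0r.
Qed.

Lemma test_functionZ Omega psi c : test_function Omega psi ->
  test_function Omega (fun x => c * psi x).
Proof.
move=> [spsi [K [cK KO psi0]]]; split; first exact: smoothZ.
by exists K; split=> // x /psi0 ->; rewrite mulr0.
Qed.

Lemma test_function_continuous Omega psi : test_function Omega psi -> continuous psi.
Proof. by move=> [spsi _]; exact: smooth_continuous. Qed.

Lemma test_function_obox Omega psi : test_function Omega psi ->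
  exists L : R, forall x, ~ obox (const_mx (- L)) (const_mx L) x -> psi x = 0.
Proof.
move=> [_ [K [cK _ psi0]]]; have [L KL] := bounded_set_obox (compact_bounded cK).
by exists L => x nx; apply: psi0 => /KL.
Qed.

Lemma test_function_integrable Omega psi : test_function Omega psi ->
  mu.-integrable setT (EFin \o psi).
Proof.
move=> tpsi; have [L psi0] := test_function_obox tpsi.
have cpsi := test_function_continuous tpsi.
have [C psiC] := continuous_box_bounded cpsi psi0.
by apply: (integrable_bounded_obox _ psiC psi0); exact: continuous_measurable_rV.
Qed.

Lemma test_function_out Omega psi x : test_function Omega psi -> ~ Omega x -> psi x = 0.
Proof. by move=> [_ [K [_ KO psi0]]] Ox; apply: psi0 => /KO. Qed.

(** Test functions vanish near the boundary of [Omega], so the integral over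
    [Omega] is one over the whole space. *)
Lemma integral_partial_test Omega psi j : test_function Omega psi ->
  (\int[mu]_(x in Omega) (partial j psi x)%:E = 0)%E.
Proof.
move=> tpsi; have tdpsi := test_function_partial j tpsi.
rewrite integral_mkcond; under eq_integral => x _.
  rewrite (_ : _ x = (partial j psi x)%:E); first over.
  rewrite patchE; case: ifPn => // /negP; rewrite inE => nO.
  by rewrite (test_function_out tdpsi).
have [K [cK KO psi0]] := tpsi.2; have [L KL] := bounded_set_obox (compact_bounded cK).
apply: (@integral_compact_derive _ _ j psi _ L).
- by move=> x; split => //; apply: diff_derivable; exact: smooth_differentiable tpsi.1.
- exact: test_function_continuous tdpsi.
- move=> x nx; have nKx : ~ K x by move=> /KL.
  split; first exact: psi0.
  by apply: partial_out nKx => //; apply: compact_closed => //; exact: rV_hausdorff.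
Qed.

Lemma test_box_bump Omega (a b : V) m :
  (forall x : V, (forall i, a ord0 i <= x ord0 i <= b ord0 i) -> Omega x) ->
  test_function Omega (box_bump a b m).
Proof.
move=> abO; split; first exact: smooth_box_bump.
exists [set x : V | forall i, `[a ord0 i, b ord0 i]%classic (x ord0 i)]; split.
- by apply: (@rV_compact _  _ (fun i => `[a ord0 i, b ord0 i]%classic)) => i; exact: segment_compact.
- by move=> x /= xab; apply: abO => i; have := xab i; rewrite in_itv.
- move=> x nx; apply: box_bump_out => xab; apply: nx => i /=.
  by rewrite in_itv/=; have /andP[/ltW -> /ltW ->] := xab i.
Qed.

End test_functions.

(** * Square integrable functions *)

Section L2_theory.
Context {R : realType} {n : nat}.
Local Notation V := 'rV[R]_n.
Local Notation mu := (lebesgue_rV n).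
Variables (D : set V) (mD : measurable D).
Implicit Types (v w u : V -> R).

Definition sq v : \bar R := (\int[mu]_(x in D) (v x ^+ 2)%:E)%E.

Lemma normL2E v : normL D 2%:E v = (sq v `^ 2^-1)%E.
Proof.
rewrite /normL unlock /sq; congr (_ `^ _)%E; rewrite [RHS]integral_mkcond.
apply: eq_integral => x _; rewrite /=; rewrite !patchE; case: ifPn => _ /=.
  by rewrite powR_mulrn ?normr_ge0// real_normK ?num_real.
by rewrite normr0 powR0// pnatr_eq0.
Qed.

(** Square integrals are quadratic in the function, hence easier to combine than
    norms. *)
Lemma L2P v : L2 D v <-> measurable_fun D v /\ (sq v < +oo)%E.
Proof.
rewrite /L2 normL2E; split => -[mv h]; split=> //.
  by apply: (@lty_poweRy _ _ 2^-1) => //; rewrite invr_neq0// pnatr_eq0.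
exact: poweR_lty.
Qed.

Lemma L2_sq_integrable v : L2 D v -> mu.-integrable D (fun x => (v x ^+ 2)%:E).
Proof.
move=> /L2P[mv vlty]; apply/integrableP; split.
  by apply/measurable_EFinP; exact: measurable_funX.
by under eq_integral => x _ do rewrite /= ger0_norm ?sqr_ge0//.
Qed.

(** The product is dominated by the sum of the squares. *)
Lemma L2M_integrable v w : L2 D v -> L2 D w -> mu.-integrable D (fun x => (v x * w x)%:E).
Proof.
move=> Lv Lw; have /L2P[mv _] := Lv; have /L2P[mw _] := Lw.
apply: (@le_integrable _ _ _ mu D mD _ (fun x => (v x ^+ 2)%:E + (w x ^+ 2)%:E)%E).
- by apply/measurable_EFinP; exact: measurable_funM.
- move=> x _; rewrite -EFinD !abse_EFin lee_fin.
  rewrite [leRHS]ger0_norm ?addr_ge0 ?sqr_ge0// ler_norml; apply/andP; split; nra.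
- by apply: integrableD => //; exact: L2_sq_integrable.
Qed.

Lemma L2_dom v (g : V -> R) : measurable_fun D v -> mu.-integrable D (EFin \o g) ->
  (forall x, D x -> v x ^+ 2 <= g x) -> L2 D v.
Proof.
move=> mv intg vg; apply/L2P; split=> //.
have /integrableP[_] := intg; apply: le_lt_trans.
apply: ge0_le_integral => //.
- by move=> x _; rewrite lee_fin sqr_ge0.
- by apply/measurable_EFinP; exact: measurable_funX.
- by apply: measurableT_comp => //; exact: measurable_int intg.
- by move=> x Dx; rewrite abse_EFin lee_fin (le_trans (vg _ Dx))// ler_norm.
Qed.

Lemma L2D v w : L2 D v -> L2 D w -> L2 D (fun x => v x + w x).
Proof.
move=> Lv Lw; have /L2P[mv _] := Lv; have /L2P[mw _] := Lw.
apply: (@L2_dom _ (fun x => 2 * v x ^+ 2 + 2 * w x ^+ 2)).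
- exact: measurable_funD.
- apply: (integrableD mD (f := fun x => (2 * v x ^+ 2)%:E) (g := fun x => (2 * w x ^+ 2)%:E)).
    exact: (integrableZl mD 2 (L2_sq_integrable Lv)).
  exact: (integrableZl mD 2 (L2_sq_integrable Lw)).
- by move=> x _; have := sqr_ge0 (v x - w x); rewrite sqrrB sqrrD; lra.
Qed.

Lemma L2Z c v : L2 D v -> L2 D (fun x => c * v x).
Proof.
move=> Lv; have /L2P[mv _] := Lv.
apply: (@L2_dom _ (fun x => c ^+ 2 * v x ^+ 2)).
- exact: measurable_funM.
- exact: (integrableZl mD (c ^+ 2) (L2_sq_integrable Lv)).
- by move=> x _; rewrite exprMn.
Qed.

Lemma L2N v : L2 D v -> L2 D (fun x => - v x).
Proof.
by move=> /(L2Z (-1)); congr L2; apply/funext => x; rewrite mulN1r.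
Qed.

Lemma L2B v w : L2 D v -> L2 D w -> L2 D (fun x => v x - w x).
Proof. by move=> Lv Lw; apply: L2D => //; exact: L2N. Qed.

Lemma L2_cst0 : L2 D (fun=> 0).
Proof.
apply/L2P; split; first exact: measurable_cst.
by rewrite /sq integral0_eq// => x _; rewrite expr0n.
Qed.

Lemma L2_sum (I : Type) (r : seq I) (F : I -> V -> R) :
  (forall i, L2 D (F i)) -> L2 D (fun x => \sum_(i <- r) F i x).
Proof.
move=> LF; elim: r => [|i r IH].
  by under eq_fun do rewrite big_nil; exact: L2_cst0.
by under eq_fun do rewrite big_cons; exact: L2D.
Qed.

Definition aeq v w := {ae mu, forall x, D x -> v x = w x}.

Lemma ip_aeq v v' w w' : measurable_fun D v -> measurable_fun D v' ->
  measurable_fun D w -> measurable_fun D w' ->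
  aeq v v' -> aeq w w' -> ip D v w = ip D v' w'.
Proof.
move=> mv mv' mw mw' vv' ww'; rewrite /ip /Rintegral; congr fine.
apply: ae_eq_integral => //.
- by apply/measurable_EFinP; exact: measurable_funM.
- by apply/measurable_EFinP; exact: measurable_funM.
- by move: vv' ww'; apply: filterS2 => x vx wx Dx; rewrite vx// wx.
Qed.

Lemma ip_eq v v' w w' : (forall x, D x -> v x = v' x) ->
  (forall x, D x -> w x = w' x) -> ip D v w = ip D v' w'.
Proof.
move=> vv' ww'; apply: eq_Rintegral => x; rewrite inE => Dx.
by rewrite vv'// ww'.
Qed.

Lemma ipC v w : ip D v w = ip D w v.
Proof. by apply: eq_Rintegral => x _; rewrite mulrC. Qed.

Lemma ipDl v w u : L2 D v -> L2 D w -> L2 D u ->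
  ip D (fun x => v x + w x) u = ip D v u + ip D w u.
Proof.
move=> Lv Lw Lu; rewrite /ip -RintegralD//; [|exact: L2M_integrable|exact: L2M_integrable].
by apply: eq_Rintegral => x _; rewrite mulrDl.
Qed.

Lemma ipZl c v u : L2 D v -> L2 D u -> ip D (fun x => c * v x) u = c * ip D v u.
Proof.
move=> Lv Lu; rewrite /ip -RintegralZl//; last exact: L2M_integrable.
by apply: eq_Rintegral => x _; rewrite mulrA.
Qed.

Lemma ipDr v w u : L2 D v -> L2 D w -> L2 D u ->
  ip D u (fun x => v x + w x) = ip D u v + ip D u w.
Proof. by move=> Lv Lw Lu; rewrite ipC ipDl// ipC [ip D w u]ipC. Qed.

Lemma ipZr c v u : L2 D v -> L2 D u -> ip D u (fun x => c * v x) = c * ip D u v.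
Proof. by move=> Lv Lu; rewrite ipC ipZl// ipC. Qed.

Lemma ipBl v w u : L2 D v -> L2 D w -> L2 D u ->
  ip D (fun x => v x - w x) u = ip D v u - ip D w u.
Proof.
move=> Lv Lw Lu; rewrite ipDl//; last exact: L2N.
congr (_ + _); rewrite -[RHS]mulN1r -ipZl//; apply: ip_eq => // x _; by rewrite mulN1r.
Qed.

Lemma ip_cst0l w : ip D (fun=> 0) w = 0.
Proof.
rewrite /ip /Rintegral integral0_eq// => x _; by rewrite mul0r.
Qed.

Lemma ip_suml (I : Type) (r : seq I) (F : I -> V -> R) u :
  (forall i, L2 D (F i)) -> L2 D u ->
  ip D (fun x => \sum_(i <- r) F i x) u = \sum_(i <- r) ip D (F i) u.
Proof.
move=> LF Lu; elim: r => [|i r IH].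
  by under eq_fun do rewrite big_nil; rewrite big_nil ip_cst0l.
under eq_fun do rewrite big_cons; rewrite ipDl// ?IH ?big_cons//.
exact: L2_sum.
Qed.

Lemma ip_ge0 v : 0 <= ip D v v.
Proof. by apply: Rintegral_ge0 => x _; rewrite -expr2 sqr_ge0. Qed.

(** The Cauchy-Schwarz inequality in Young's form: the free weight [e] lets one
    factor be absorbed when the other one tends to zero. *)
Lemma ip_young v w e : 0 < e -> L2 D v -> L2 D w ->
  `|ip D v w| <= e * ip D v v + e^-1 * ip D w w.
Proof.
move=> e0 Lv Lw.
apply: le_trans (le_normr_Rintegral mD (L2M_integrable Lv Lw)) _.
have -> : e * ip D v v + e^-1 * ip D w w =
    \int[mu]_(x in D) (e * (v x * v x) + e^-1 * (w x * w x)).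
  rewrite RintegralD//; [|exact: (integrableZl mD e (L2M_integrable Lv Lv))|
    exact: (integrableZl mD e^-1 (L2M_integrable Lw Lw))].
  by rewrite !RintegralZl//; exact: L2M_integrable.
apply: le_Rintegral => //.
- have := integrable_abse (L2M_integrable Lv Lw).
  by congr integrable; apply/funext => x.
- apply: (integrableD mD (f := fun x => (e * (v x * v x))%:E) (g := fun x => (e^-1 * (w x * w x))%:E)).
    exact: (integrableZl mD e (L2M_integrable Lv Lv)).
  exact: (integrableZl mD e^-1 (L2M_integrable Lw Lw)).
- move=> x _.
  have h : forall a b : R, 0 <= e * (a * a) + e^-1 * (b * b) - 2 * (a * b).
    move=> a b; have -> : e * (a * a) + e^-1 * (b * b) - 2 * (a * b) = e * (a - e^-1 * b) ^+ 2.
      by field; rewrite lt0r_neq0.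
    by apply: mulr_ge0; [exact: ltW|exact: sqr_ge0].
  have h1 := h (v x) (w x); have h2 := h (v x) (- w x).
  rewrite ler_norml.
  have q1 : 0 <= e * (v x * v x) by apply: mulr_ge0; [exact: ltW|rewrite -expr2; exact: sqr_ge0].
  have q2 : 0 <= e^-1 * (w x * w x) by apply: mulr_ge0; [rewrite invr_ge0; exact: ltW|rewrite -expr2; exact: sqr_ge0].
  move: h1 h2; rewrite mulrNN mulrN => h1 h2.
  by apply/andP; split; lra.
Qed.

Lemma ip_sq v : L2 D v -> (ip D v v)%:E = sq v.
Proof.
move=> Lv; rewrite /ip /Rintegral fineK.
  by apply: eq_integral => x _; rewrite expr2.
by apply: integrable_fin_num => //; exact: L2M_integrable.
Qed.

End L2_theory.

(** * The fundamental lemma of the calculus of variations *)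

Section fundamental_lemma.
Context {R : realType} {n : nat}.
Local Notation V := 'rV[R]_n.
Local Notation mu := (lebesgue_rV n).
Variables (Omega : set V) (oO : open Omega) (bO : bounded_set Omega).
Implicit Types (psi g v w : V -> R).

Let mO : measurable Omega := open_measurable_rV oO.

Lemma L2_cst (c : R) : L2 Omega (fun=> c).
Proof.
apply/L2P; split; first exact: measurable_cst.
rewrite /sq integral_cst// lte_mul_pinfty ?lee_fin ?sqr_ge0//.
by apply: bounded_lebesgue_lty => //; exact: mO.
Qed.

Lemma L2_integrable v : L2 Omega v -> mu.-integrable Omega (EFin \o v).
Proof.
move=> Lv; have := L2M_integrable mO Lv (L2_cst 1).
by under eq_fun do rewrite mulr1.
Qed.

Lemma test_function_L2 psi : test_function Omega psi -> L2 Omega psi.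
Proof.
move=> tpsi.
have cpsi : measurable_fun Omega psi.
  by apply: measurable_funTS; apply: continuous_measurable_rV; exact: test_function_continuous tpsi.
apply: (@L2_dom _ _ _ mO _ (fun x => psi x * psi x)) => //.
apply: integrableS (test_function_integrable (test_functionM tpsi tpsi.1)) => //.
Qed.

Let box_in (a b : V) :=
  forall x : V, (forall i, a ord0 i <= x ord0 i <= b ord0 i) -> Omega x.

Let box_inS a b : box_in a b -> obox a b `<=` Omega.
Proof. by move=> abO x xab; apply: abO => i; have /andP[/ltW -> /ltW ->] := xab i. Qed.

Let integral_box_eq0 g (a b : V) : L2 Omega g ->
  (forall psi, test_function Omega psi -> ip Omega g psi = 0) -> box_in a b ->
  (\int[mu]_(x in Omega) (g x * \1_(obox a b) x)%:E = 0)%E.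
Proof.
move=> Lg g0 abO.
have mg : measurable_fun Omega g by have /L2P[] := Lg.
have tb m := test_box_bump m abO.
have [|||||_ _] := @dominated_convergence _ _ _ mu Omega mO
  (fun m x => (g x * box_bump a b m x)%:E) (fun x => (g x * \1_(obox a b) x)%:E)
  (fun x => `|g x|%:E).
- move=> m; apply/measurable_EFinP; apply: measurable_funM => //.
  by have /L2P[] := test_function_L2 (tb m).
- apply/measurable_EFinP; apply: measurable_funM => //.
  by apply: measurable_funTS; apply: measurable_indic; exact: measurable_obox.
- apply: aeW => x _; apply: cvg_EFin; first exact: nearW.
  by apply: cvgM; [exact: cvg_cst|exact: cvg_box_bump].
- exact: integrable_norm (L2_integrable Lg).
- apply: aeW => x m _; rewrite abse_EFin lee_fin normrM ler_piMr//.
  by have /andP[h1 h2] := box_bump_ge0_le1 a b m x; rewrite ger0_norm.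
rewrite [X in X @ _](_ : _ = fun=> 0%E).
  by move=> h; apply/esym; have := cvg_unique _ (cvg_cst (0 : \bar R)) h; exact.
apply/funext => m; have := g0 _ (tb m); rewrite /ip /Rintegral => h.
rewrite -[LHS]fineK ?h//; apply: integrable_fin_num => //.
exact: L2M_integrable (test_function_L2 (tb m)).
Qed.

(** Fundamental lemma of the calculus of variations. By dominated convergence
    along mollified indicators, [g] has zero integral on each box whose closure
    lies in [Omega]; hence [g] vanishes almost everywhere on each such box, and
    countably many of them cover [Omega]. *)
Lemma test_functions_separate g : L2 Omega g ->
  (forall psi, test_function Omega psi -> ip Omega g psi = 0) ->
  aeq Omega g (fun=> 0).
Proof.
move=> Lg g0; have mg : measurable_fun Omega g by have /L2P[] := Lg.
have box0 a b : box_in a b -> {ae mu, forall x, obox a b x -> g x = 0}.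
  (* Localised to one box, [g] has zero integral on the intersection with any box. *)
  move=> abO; pose h := (fun x => (g x * \1_(obox a b) x)%:E) \_ Omega.
  have inth : mu.-integrable setT h.
    apply/(integrable_mkcond (fun x => (g x * \1_(obox a b) x)%:E) mO).
    apply: le_integrable (L2_integrable Lg) => //.
      apply/measurable_EFinP; apply: measurable_funM => //.
      by apply: measurable_funTS; apply: measurable_indic; exact: measurable_obox.
    move=> x _; rewrite !abse_EFin lee_fin normrM ler_piMr// indicE.
    by case: (_ \in _); rewrite ?normr1 ?normr0.
  have h0 : (\int[mu]_x h x = 0)%E.
    by rewrite -integral_mkcond; exact: integral_box_eq0.
  have : ae_eq mu setT h (cst 0%E).
    apply: integral_boxes_eq0 => // c d.
    have [a' [b' [E sub]]] : exists a' b' : V, obox a b `&` obox c d = obox a' b' /\ box_in a' b'.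
      exists (\row_i Num.max (a ord0 i) (c ord0 i)), (\row_i Num.min (b ord0 i) (d ord0 i)).
      split; first exact: obox_setI.
      move=> x hx; apply: abO => i; have := hx i; rewrite !mxE ge_max le_min.
      by move=> /andP[/andP[-> _] /andP[-> _]].
    rewrite -(integral_box_eq0 Lg g0 sub) integral_mkcond [RHS]integral_mkcond.
    apply: eq_integral => x _; rewrite /h !patchE !indicE -E in_setI.
    have [xO|] := boolP (x \in Omega); last by case: ifP.
    case: (x \in obox c d) => /=; first by rewrite andbT.
    by rewrite andbF mulr0.
  apply: filterS => x /(_ I); rewrite /h patchE => hx xab.
  move: hx; rewrite mem_set; last exact: box_inS xab.
  by rewrite indicE mem_set// mulr1 => -[].
have H : {ae mu, forall x (k : nat), forall q, unpickle k = Some q ->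
    `[< box_in (ratrv q.1) (ratrv q.2) >] -> obox (ratrv q.1) (ratrv q.2) x -> g x = 0}.
  apply/ae_foralln => k.
  case E : (unpickle k) => [q|]; last by apply: aeW.
  have [bi|nbi] := pselect (box_in (ratrv q.1) (ratrv q.2)); last first.
    by apply: aeW => x q' [<-] /asboolP.
  by move: (box0 _ _ bi); apply: filterS => x hx q' [<-] _.
move: H; apply: filterS => x hx Ox.
move: (Ox); rewrite (open_bigcup_obox oO) => -[q _].
case: ifPn => // bi xq; exact: (hx (pickle q) q (pickleK q) bi xq).
Qed.

End fundamental_lemma.

(** * Weak gradients and H^1_0 *)

Section weak_gradients.
Context {R : realType} {n : nat}.
Local Notation V := 'rV[R]_n.
Local Notation mu := (lebesgue_rV n).
Variables (Omega : set V) (oO : open Omega) (bO : bounded_set Omega).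
Implicit Types (psi chi g v w : V -> R) (G H : V -> V) (j : 'I_n).

Let mO : measurable Omega := open_measurable_rV oO.
Local Notation ip := (ip Omega).
Local Notation L2 := (L2 Omega).
Local Notation wgrad := (wgrad Omega).
Local Notation test_function := (test_function Omega).

Lemma L2_measurable v : L2 v -> measurable_fun Omega v.
Proof. by move=> /L2P[]. Qed.

Lemma aeq_ip v v' w w' : L2 v -> L2 v' -> L2 w -> L2 w' ->
  aeq Omega v v' -> aeq Omega w w' -> ip v w = ip v' w'.
Proof. by move=> *; apply: ip_aeq => //; exact: L2_measurable. Qed.

Lemma aeq_refl v : aeq Omega v v.
Proof. exact: aeW. Qed.

Lemma test_partial_L2 psi j : test_function psi -> L2 (partial j psi).
Proof. by move=> tpsi; apply: test_function_L2 => //; exact: test_function_partial. Qed.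

(** The difference of two weak gradients is orthogonal to all test functions. *)
Lemma weak_gradient_unique v G H j : weak_gradient Omega v G ->
  weak_gradient Omega v H ->
  aeq Omega (fun x => G x ord0 j) (fun x => H x ord0 j).
Proof.
move=> wG wH; have [LG Gv] := wG j; have [LH Hv] := wH j.
have : aeq Omega (fun x => G x ord0 j - H x ord0 j) (fun=> 0).
  apply: test_functions_separate => //; first exact: L2B.
  move=> psi tpsi; rewrite (ipBl mO)//; last exact: test_function_L2.
  by apply/eqP; rewrite subr_eq0 -eqr_opp -Gv// -Hv.
by apply: filterS => x GH Ox; apply/eqP; rewrite -subr_eq0 GH.
Qed.

Lemma weak_gradient_lin (a b : R) v w G H : L2 v -> L2 w ->
  weak_gradient Omega v G -> weak_gradient Omega w H ->
  weak_gradient Omega (fun x => a * v x + b * w x) (fun x => a *: G x + b *: H x).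
Proof.
move=> Lv Lw wG wH j; have [LG Gv] := wG j; have [LH Hv] := wH j.
have E : (fun x => (a *: G x + b *: H x) ord0 j) =
    (fun x => a * G x ord0 j + b * H x ord0 j).
  by apply/funext => x; rewrite !mxE.
rewrite E; split; first by apply: L2D => //; exact: L2Z.
move=> psi tpsi; have Lp := test_function_L2 oO tpsi.
have Ldp := test_partial_L2 j tpsi.
rewrite !(ipDl mO) ?(ipZl mO)//; try exact: L2Z.
by rewrite Gv// Hv// opprD !mulrN.
Qed.

(** Integration by parts applied to the product of two test functions. *)
Lemma test_weak_gradient psi : test_function psi ->
  weak_gradient Omega psi (grad psi).
Proof.
move=> tpsi j.
have E : (fun x => grad psi x ord0 j) = partial j psi by apply/funext => x; rewrite mxE.
rewrite E; split; first exact: test_partial_L2.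
move=> chi tchi.
have Lp := test_function_L2 oO tpsi; have Lc := test_function_L2 oO tchi.
have Ldp := test_partial_L2 j tpsi; have Ldc := test_partial_L2 j tchi.
have /(congr1 fine) := integral_partial_test j (test_functionM tpsi tchi.1).
rewrite -[X in X = _]/(\int[mu]_(x in Omega) _) /= => h0.
apply/eqP; rewrite -subr_eq0 opprK; apply/eqP; rewrite -[RHS]h0 /Defs.ip -RintegralD//.
- apply: eq_Rintegral => x _; rewrite addrC partialM//.
    exact: smooth_differentiable tpsi.1.
  exact: smooth_differentiable tchi.1.
- exact: L2M_integrable.
- exact: L2M_integrable.
Qed.

Lemma wgradP v : (exists G, weak_gradient Omega v G) -> weak_gradient Omega v (wgrad v).
Proof. by move=> exG; exact: (@xgetPex _ (fun=> 0) [set G | weak_gradient Omega v G]). Qed.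

Lemma H1_wgrad v : H1 Omega v -> weak_gradient Omega v (wgrad v).
Proof. by move=> [_]; exact: wgradP. Qed.

Lemma H1_L2 v : H1 Omega v -> L2 v.
Proof. by case. Qed.

Lemma H1_wgrad_L2 v j : H1 Omega v -> L2 (fun x => wgrad v x ord0 j).
Proof. by move=> /H1_wgrad /(_ j)[]. Qed.

Lemma test_H1 psi : test_function psi -> H1 Omega psi.
Proof.
move=> tpsi; split; first exact: test_function_L2.
by exists (grad psi); exact: test_weak_gradient.
Qed.

Lemma test_wgrad psi j : test_function psi ->
  aeq Omega (fun x => wgrad psi x ord0 j) (partial j psi).
Proof.
move=> tpsi; have := weak_gradient_unique j (H1_wgrad (test_H1 tpsi)) (test_weak_gradient tpsi).
by apply: filterS => x + Ox => /(_ Ox) ->; rewrite mxE.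
Qed.

Lemma H1_lin (a b : R) v w : H1 Omega v -> H1 Omega w ->
  H1 Omega (fun x => a * v x + b * w x).
Proof.
move=> Hv Hw; split.
  by apply: L2D => //; apply: L2Z => //; exact: H1_L2.
exists (fun x => a *: wgrad v x + b *: wgrad w x); apply: weak_gradient_lin;
  by [exact: H1_L2|exact: H1_wgrad].
Qed.

(** Only almost everywhere: each side is an arbitrary representative. *)
Lemma wgrad_lin (a b : R) v w j : H1 Omega v -> H1 Omega w ->
  aeq Omega (fun x => wgrad (fun x => a * v x + b * w x) x ord0 j)
    (fun x => a * wgrad v x ord0 j + b * wgrad w x ord0 j).
Proof.
move=> Hv Hw.
have := weak_gradient_unique j (H1_wgrad (H1_lin a b Hv Hw))
  (weak_gradient_lin a b (H1_L2 Hv) (H1_L2 Hw) (H1_wgrad Hv) (H1_wgrad Hw)).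
by apply: filterS => x + Ox => /(_ Ox) ->; rewrite !mxE.
Qed.

Lemma weak_gradient_eq v w G : (forall x, Omega x -> v x = w x) ->
  weak_gradient Omega v G -> weak_gradient Omega w G.
Proof.
move=> vw wG j; have [LG Gv] := wG j; split => // psi tpsi.
by rewrite -Gv//; apply: ip_eq => // x Ox; rewrite vw.
Qed.

Lemma wgrad_eq v w : (forall x, Omega x -> v x = w x) -> wgrad v = wgrad w.
Proof.
move=> vw; congr xget; apply/seteqP; split => G; apply: weak_gradient_eq => //.
by move=> x Ox; rewrite vw.
Qed.

Lemma ipvE G H : (forall j, L2 (fun x => G x ord0 j)) ->
  (forall j, L2 (fun x => H x ord0 j)) ->
  ipv Omega G H = \sum_j ip (fun x => G x ord0 j) (fun x => H x ord0 j).
Proof.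
move=> LG LH; rewrite /ipv /dot.
suff K (r : seq 'I_n) :
   mu.-integrable Omega (fun x => (\sum_(j <- r) G x ord0 j * H x ord0 j)%:E) /\
   \int[mu]_(x in Omega) (\sum_(j <- r) G x ord0 j * H x ord0 j) =
   \sum_(j <- r) ip (fun x => G x ord0 j) (fun x => H x ord0 j) by exact: (K _).2.
elim: r => [|j r [IH1 IH2]].
  split; first by under eq_fun do rewrite big_nil; exact: integrable0.
  by under eq_Rintegral do rewrite big_nil; rewrite big_nil /Rintegral integral0.
have I1 := L2M_integrable mO (LG j) (LH j).
split.
  under eq_fun do rewrite big_cons EFinD.
  exact: (integrableD mO I1 IH1).
rewrite big_cons -IH2 /Defs.ip -RintegralD//.
by apply: eq_Rintegral => x _; rewrite big_cons.
Qed.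

(** The squared H^1 distance from [v] to a test function [psi]. Classical partial
    derivatives replace the weak gradient of [psi], which makes the distance
    explicit in [psi]. *)
Definition H1_dist psi v : R :=
  ip (fun x => psi x - v x) (fun x => psi x - v x) +
  \sum_j ip (fun x => partial j psi x - wgrad v x ord0 j)
            (fun x => partial j psi x - wgrad v x ord0 j).

Lemma H1_normE u : H1 Omega u -> H1_norm Omega u =
  (Num.sqrt (ip u u) + Num.sqrt (\sum_j ip (fun x => wgrad u x ord0 j) (fun x => wgrad u x ord0 j)))%:E.
Proof.
move=> Hu; rewrite /H1_norm !normL2E EFinD; congr (_ + _)%E.
  by rewrite -(ip_sq mO) ?poweR_EFin ?powR12_sqrt ?ip_ge0//; exact: H1_L2.
rewrite -ipvE; [|by move=> j; exact: H1_wgrad_L2|by move=> j; exact: H1_wgrad_L2].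
have -> : sq Omega (enorm \o wgrad u) = (ipv Omega (wgrad u) (wgrad u))%:E.
  rewrite /sq /ipv /Rintegral.
  have E : (\int[mu]_(x in Omega) ((enorm \o wgrad u) x ^+ 2)%:E =
     \int[mu]_(x in Omega) (dot (wgrad u x) (wgrad u x))%:E)%E.
    apply: eq_integral => x _; rewrite /= /enorm sqr_sqrtr//.
    by apply: sumr_ge0 => j _; rewrite -expr2 sqr_ge0.
  rewrite E fineK//.
  rewrite /dot; apply: integrable_fin_num => //.
  under eq_fun do rewrite -sumEFin.
  apply: integrable_sum => // j _; apply: L2M_integrable => //; exact: H1_wgrad_L2.
rewrite poweR_EFin powR12_sqrt// /ipv; apply: Rintegral_ge0 => x _.
by apply: sumr_ge0 => j _; rewrite -expr2 sqr_ge0.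
Qed.

Lemma H1_dist_norm psi v : test_function psi -> H1 Omega v ->
  exists x y, [/\ 0 <= x, 0 <= y, H1_dist psi v = x + y &
    H1_norm Omega (psi \- v) = (Num.sqrt x + Num.sqrt y)%:E].
Proof.
move=> tpsi Hv; have Hpsi := test_H1 tpsi.
have E : psi \- v = fun x => 1 * psi x + (-1) * v x.
  by apply/funext => x /=; rewrite mul1r mulN1r.
have Hd : H1 Omega (psi \- v) by rewrite E; exact: H1_lin.
exists (ip (psi \- v) (psi \- v)), (\sum_j ip (fun x => wgrad (psi \- v) x ord0 j) (fun x => wgrad (psi \- v) x ord0 j)); split.
- exact: ip_ge0.
- by apply: sumr_ge0 => j _; exact: ip_ge0.
- rewrite /H1_dist; congr (_ + _); apply: eq_bigr => j _.
  have L1 : L2 (fun x => partial j psi x - wgrad v x ord0 j).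
    by apply: L2B => //; [exact: test_partial_L2|exact: H1_wgrad_L2].
  have L2 : L2 (fun x => wgrad (psi \- v) x ord0 j) by exact: H1_wgrad_L2.
  have ae : aeq Omega (fun x => partial j psi x - wgrad v x ord0 j)
     (fun x => wgrad (psi \- v) x ord0 j).
    have := wgrad_lin 1 (-1) j Hpsi Hv; rewrite -E.
    have := test_wgrad j tpsi.
    by apply: filterS2 => x h1 h2 Ox; rewrite h2// h1// mul1r mulN1r.
  exact: aeq_ip.
- exact: H1_normE.
Qed.

(** Density in a form without sequences or norms, convenient for linear
    combinations and for passing to the limit in quadratic expressions. *)
Lemma H10P v : H10 Omega v <-> H1 Omega v /\
  forall e, 0 < e -> exists2 psi, test_function psi & H1_dist psi v < e.
Proof.
split=> -[Hv].
  move=> [psi [tpsi cpsi]]; split=> // e e0.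
  have se0 : 0 < Num.sqrt e by rewrite sqrtr_gt0.
  have : \forall m \near \oo, (H1_norm Omega (psi m \- v)%R < (Num.sqrt e)%:E)%E.
    apply: (cpsi [set y | (y < (Num.sqrt e)%:E)%E]); apply: open_nbhs_nbhs.
    by split; [exact: open_ereal_lt_ereal|rewrite /= lte_fin].
  case=> m _ /(_ m (leqnn m)) /= h; exists (psi m) => //.
  have [x [y [x0 y0 -> E]]] := H1_dist_norm (tpsi m) Hv.
  move: h; rewrite E lte_fin => h.
  rewrite -[e]sqr_sqrtr; last exact: ltW.
  rewrite -[x]sqr_sqrtr// -[y]sqr_sqrtr//.
  have := sqrtr_ge0 x; have := sqrtr_ge0 y; nra.
move=> dv; split=> //.
have H m : exists psi, test_function psi /\ H1_dist psi v < m.+1%:R^-1.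
  by have [|psi ? ?] := dv (m.+1%:R^-1) _; [rewrite invr_gt0|exists psi].
have [psi psiP] := choice H; exists psi; split; first by move=> m; exact: (psiP m).1.
have bnd m : exists r, [/\ 0 <= r, r ^+ 2 <= 4 * m.+1%:R^-1 & H1_norm Omega (psi m \- v) = r%:E].
  have [tp hd] := psiP m.
  have [x [y [x0 y0 E ->]]] := H1_dist_norm tp Hv.
  exists (Num.sqrt x + Num.sqrt y); split => //.
  rewrite E in hd.
  have := sqr_sqrtr x0; have := sqr_sqrtr y0.
  have := sqr_ge0 (Num.sqrt x - Num.sqrt y); rewrite sqrrB sqrrD.
  move: hd x0 y0; clear; move: (m.+1%:R^-1) (Num.sqrt x) (Num.sqrt y) => c sx sy.
  by nra.
have [r rP] := choice bnd.
rewrite (_ : (fun m => _) = EFin \o r); last by apply/funext => m; have [_ _] := rP m.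
apply: cvg_EFin; first exact: nearW.
apply/cvgrPdist_lt => e e0.
have : \forall m \near \oo, (m.+1%:R^-1 < e ^+ 2 / 4 :> R).
  have := @cvg_harmonic R; move=> /cvgrPdist_lt /(_ (e ^+ 2 / 4)).
  rewrite divr_gt0 ?exprn_gt0// => /(_ isT); apply: filterS => m /=.
  by rewrite sub0r normrN ger0_norm.
apply: filterS => m hm; have [r0 r2 _] := rP m.
rewrite sub0r normrN ger0_norm// -(ltr_pXn2r (n := 2))// ?nnegrE// ?ltW//.
by apply: le_lt_trans r2 _; move: hm; rewrite ltr_pdivlMr// mulrC.
Qed.

End weak_gradients.

(** * Linear structure of H^1_0 and bounded multipliers *)

Section H10_theory.
Context {R : realType} {n : nat}.
Local Notation V := 'rV[R]_n.
Local Notation mu := (lebesgue_rV n).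
Variables (Omega : set V) (oO : open Omega) (bO : bounded_set Omega).
Implicit Types (psi chi v w c : V -> R) (G H b : V -> V) (j : 'I_n).

Let mO : measurable Omega := open_measurable_rV oO.
Local Notation ip := (ip Omega).
Local Notation L2 := (L2 Omega).
Local Notation wgrad := (wgrad Omega).
Local Notation test_function := (test_function Omega).

(** The parallelogram identity. *)
Lemma ip_lin_le (a b : R) v w : L2 v -> L2 w ->
  ip (fun x => a * v x + b * w x) (fun x => a * v x + b * w x) <=
  2 * a ^+ 2 * ip v v + 2 * b ^+ 2 * ip w w.
Proof.
move=> Lv Lw.
have La := L2Z mO a Lv; have Lb := L2Z mO b Lw.
have Lab := L2D mO La Lb.
have E : 2 * a ^+ 2 * ip v v + 2 * b ^+ 2 * ip w w =
  ip (fun x => a * v x + b * w x) (fun x => a * v x + b * w x) +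
  ip (fun x => a * v x - b * w x) (fun x => a * v x - b * w x).
  have LNb := L2N mO Lb; have LN := L2D mO La LNb.
  rewrite (ipDl mO)// [in RHS](ipDl mO)//.
  do 4 rewrite (ipDr mO)//.
  have Ne u u' : L2 u -> L2 u' -> ip (fun x => - u x) u' = - ip u u'.
    move=> Lu Lu'; rewrite -[RHS]mulN1r -(ipZl mO)//.
    by apply: ip_eq => // x _; rewrite mulN1r.
  have Ne' u u' : L2 u -> L2 u' -> ip u' (fun x => - u x) = - ip u' u.
    by move=> Lu Lu'; rewrite ipC Ne// ipC.
  rewrite !Ne// !Ne'// !(ipZl mO)// !(ipZr mO)//.
  rewrite [ip w v]ipC; ring.
by rewrite E lerDl; exact: ip_ge0.
Qed.

(** Combine test functions that approximate [v] and [w]; the tolerances are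
    chosen so that the factors [2 a^2] and [2 b^2] of [ip_lin_le] are absorbed. *)
Lemma H10_lin (a b : R) v w : H10 Omega v -> H10 Omega w ->
  H10 Omega (fun x => a * v x + b * w x).
Proof.
move=> /(H10P oO bO)[Hv dv] /(H10P oO bO)[Hw dw]; apply/(H10P oO bO).
split; first exact: H1_lin.
move=> e e0.
have e1 (t : R) : 0 < e / (4 * (t ^+ 2 + 1)).
  rewrite divr_gt0// mulr_gt0//; have := sqr_ge0 t; lra.
have [psi tpsi dpsi] := dv _ (e1 a); have [chi tchi dchi] := dw _ (e1 b).
exists (fun x => a * psi x + b * chi x).
  by apply: test_functionD; exact: test_functionZ.
have Lp := test_function_L2 oO tpsi; have Lc := test_function_L2 oO tchi.
have Lv := H1_L2 Hv; have Lw := H1_L2 Hw.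
apply: (@le_lt_trans _ _ (2 * a ^+ 2 * H1_dist Omega psi v + 2 * b ^+ 2 * H1_dist Omega chi w)).
  rewrite /H1_dist !mulrDr addrACA; apply: lerD.
    rewrite (_ : (fun x => _ - _) = fun x => a * (psi x - v x) + b * (chi x - w x)).
      by apply: ip_lin_le; exact: L2B.
    by apply/funext => x; ring.
  rewrite !mulr_sumr -big_split/=; apply: ler_sum => j _.
  have Ldp := test_partial_L2 oO j tpsi; have Ldc := test_partial_L2 oO j tchi.
  have LGv := H1_wgrad_L2 j Hv; have LGw := H1_wgrad_L2 j Hw.
  have L1 := L2B mO Ldp LGv; have L2' := L2B mO Ldc LGw.
  apply: le_trans (ip_lin_le a b L1 L2').
  rewrite le_eqVlt; apply/orP; left; apply/eqP.
  have LX : L2 (fun x => partial j (fun x => a * psi x + b * chi x) x -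
        wgrad (fun x => a * v x + b * w x) x ord0 j).
    apply: (L2B mO); last by apply: H1_wgrad_L2; exact: H1_lin.
    by apply: test_partial_L2 => //; apply: test_functionD; exact: test_functionZ.
  have LY : L2 (fun x => a * (partial j psi x - wgrad v x ord0 j) +
      b * (partial j chi x - wgrad w x ord0 j)) by apply: L2D => //; exact: L2Z.
  have ae : aeq Omega (fun x => partial j (fun x => a * psi x + b * chi x) x -
        wgrad (fun x => a * v x + b * w x) x ord0 j)
     (fun x => a * (partial j psi x - wgrad v x ord0 j) +
      b * (partial j chi x - wgrad w x ord0 j)).
    have := wgrad_lin oO bO a b j Hv Hw; apply: filterS => x h Ox.
    have dp := smooth_differentiable x tpsi.1; have dc := smooth_differentiable x tchi.1.
    rewrite h// partialD ?partialZ//; first ring.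
    - exact: smooth_differentiable (smoothZ a tpsi.1).
    - exact: smooth_differentiable (smoothZ b tchi.1).
  exact: aeq_ip.
have K (t d : R) : 0 <= d -> d < e / (4 * (t ^+ 2 + 1)) -> 2 * t ^+ 2 * d < e / 2.
  move=> d0; rewrite ltr_pdivlMr ?mulr_gt0 ?ltr_wpDl ?sqr_ge0// => h.
  have E : 2 * t ^+ 2 * d = d * (4 * (t ^+ 2 + 1)) / 2 - 2 * d by field.
  rewrite E; move: h d0; clear; set z := d * _; move: z => z h d0; lra.
have d0 psi' v' : 0 <= H1_dist Omega psi' v'.
  by apply: addr_ge0; [exact: ip_ge0|apply: sumr_ge0 => j _; exact: ip_ge0].
have h1 := K a _ (d0 _ _) dpsi; have h2 := K b _ (d0 _ _) dchi.
have := ltrD h1 h2; rewrite -splitr => h3; exact: h3.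
Qed.

Lemma L2_aeq v w : L2 v -> measurable_fun Omega w -> aeq Omega v w -> L2 w.
Proof.
move=> /L2P[mv vlty] mw vw; apply/L2P; split => //.
rewrite /sq; move: vlty; congr (_ < _)%E; apply: ae_eq_integral => //.
- by apply/measurable_EFinP; exact: measurable_funX.
- by apply/measurable_EFinP; exact: measurable_funX.
- by move: vw; apply: filterS => x vw Ox; rewrite vw.
Qed.

(** Truncating at the essential bound makes the estimates on products
    pointwise. *)
Lemma W1inf_bounded v : W1inf Omega v -> exists c C, [/\ measurable_fun Omega c,
  forall x, `|c x| <= C & aeq Omega v c].
Proof.
move=> [mv _ vlty].
have vfin : (normL Omega +oo v < +oo)%E.
  apply: le_lt_trans vlty; rewrite leeDl//; exact: Lnorm_ge0.
have [C vC] : exists C : R, {ae mu, forall x, Omega x -> `|v x| <= C}.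
  have [mu0|mu0] := boolP (0 < mu [set: V])%E; last first.
    exists 0, setT; split => //; apply/eqP; rewrite eq_le measure_ge0 andbT.
    by rewrite leNgt.
  move: vfin; rewrite /normL unlock mu0; set E := ess_sup _ _ => Elty.
  have Ege : (0 <= E)%E.
    by rewrite /E; apply: ess_sup_gee => //; apply: nearW => x; rewrite abse_ge0.
  exists (fine E); have := ess_sup_ge mu (abse \o (EFin \o v \_ Omega)).
  apply: filterS => x; rewrite -/E /= patchE => h Ox; move: h.
  have Efin : E \is a fin_num by rewrite ge0_fin_numE.
  by rewrite mem_set// -[in leRHS](fineK Efin) lee_fin.
pose C' := Num.max 0 C.
have C'0 : 0 <= C' by rewrite le_max lexx.
exists (fun x => Num.max (- C') (Num.min C' (v x))), C'; split.
- by apply: measurable_maxr => //; exact: measurable_minr.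
- by move=> x; rewrite ler_norml le_max lexx/= ge_max ge_min lexx/= andbT; lra.
- move: vC; apply: filterS => x h Ox; have {}h := h Ox.
  have : `|v x| <= C' by rewrite le_max h orbT.
  by rewrite ler_norml => /andP[h1 h2]; rewrite min_r// max_r.
Qed.

Lemma L2_bounded c C v : measurable_fun Omega c -> (forall x, `|c x| <= C) ->
  L2 v -> L2 (fun x => c x * v x) /\
  ip (fun x => c x * v x) (fun x => c x * v x) <= C ^+ 2 * ip v v.
Proof.
move=> mc cC Lv; have mv := L2_measurable Lv.
have le x : (c x * v x) ^+ 2 <= C ^+ 2 * v x ^+ 2.
  by rewrite exprMn ler_wpM2r ?sqr_ge0// -real_normK ?num_real// lerXn2r ?nnegrE// (le_trans _ (cC x)).
have I2 := integrableZl mO (C ^+ 2) (L2_sq_integrable Lv).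
have Lcv : L2 (fun x => c x * v x).
  apply: (@L2_dom _ _ _ mO _ (fun x => C ^+ 2 * v x ^+ 2)) => //.
  exact: measurable_funM.
split=> //; rewrite /Defs.ip -RintegralZl//; last exact: L2M_integrable.
apply: le_Rintegral => //.
- exact: L2M_integrable.
- by move=> x _; rewrite -!expr2.
Qed.

Lemma W1inf_mul_L2 a v : W1inf Omega a -> L2 v -> L2 (fun x => a x * v x).
Proof.
move=> Wa Lv; have [c [C [mc cC ac]]] := W1inf_bounded Wa.
apply: (L2_aeq (L2_bounded mc cC Lv).1).
  by apply: measurable_funM; [case: Wa|exact: L2_measurable].
by move: ac; apply: filterS => x h Ox; rewrite h.
Qed.

Lemma W1inf_L2 a : W1inf Omega a -> L2 a.
Proof.
move=> Wa; have := W1inf_mul_L2 Wa (L2_cst oO bO 1).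
by congr L2; apply/funext => x; rewrite mulr1.
Qed.

End H10_theory.

(** * Skew-symmetry of the transport term *)

Lemma sum_collect (R : realFieldType) n (d B D : R) (A E : 'I_n -> R) :
  \sum_j (d * A j + d^-1 * (B) + (d^-1 * E j + d * D) + (E j + B)) =
  d * (\sum_j A j + n%:R * D) + (d^-1 + 1) * (n%:R * B + \sum_j E j).
Proof.
have K c : \sum_(j < n) c = n%:R * c :> R by rewrite sumr_const card_ord mulr_natl.
rewrite !big_split/= !K -!mulr_sumr; ring.
Qed.

Section transport.
Context {R : realType} {n : nat}.
Local Notation V := 'rV[R]_n.
Local Notation mu := (lebesgue_rV n).
Variables (Omega : set V) (oO : open Omega) (bO : bounded_set Omega).
Implicit Types (psi chi v w c : V -> R) (G H b : V -> V) (j : 'I_n).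

Let mO : measurable Omega := open_measurable_rV oO.
Local Notation ip := (ip Omega).
Local Notation L2 := (L2 Omega).
Local Notation wgrad := (wgrad Omega).
Local Notation test_function := (test_function Omega).

Lemma transport_L2 b G : (forall j, W1inf Omega (fun x => b x ord0 j)) ->
  (forall j, L2 (fun x => G x ord0 j)) -> L2 (fun x => dot (b x) (G x)).
Proof.
move=> Wb LG; rewrite /dot.
apply: (@L2_sum _ _ _ mO _ _ (fun j x => b x ord0 j * G x ord0 j)) => j.
exact: (W1inf_mul_L2 oO (Wb j)).
Qed.

Lemma ip_transport b G v : (forall j, W1inf Omega (fun x => b x ord0 j)) ->
  (forall j, L2 (fun x => G x ord0 j)) -> L2 v ->
  ip (fun x => dot (b x) (G x)) v =
  \sum_j ip (fun x => G x ord0 j) (fun x => b x ord0 j * v x).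
Proof.
move=> Wb LG Lv; rewrite /dot.
rewrite (@ip_suml _ _ _ mO _ _ (fun j x => b x ord0 j * G x ord0 j))//; last first.
  by move=> j; exact: (W1inf_mul_L2 oO (Wb j)).
by apply: eq_bigr => j _; apply: eq_Rintegral => x _; ring.
Qed.

(** On test functions the transport term is half of the integral of
    [b . grad (psi ^ 2)], which vanishes because [b] is divergence free. *)
Lemma transport_skew_test b psi : divfree_W1inf_field Omega b ->
  test_function psi ->
  \sum_j ip (partial j psi) (fun x => b x ord0 j * psi x) = 0.
Proof.
move=> [Wb _ divb] tpsi.
have tp2 : test_function (fun x => psi x * psi x) by apply: test_functionM => //; exact: tpsi.1.
have Lp := test_function_L2 oO tpsi; have Lp2 := test_function_L2 oO tp2.
have Lb j := W1inf_L2 oO bO (Wb j).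
have wb j : weak_gradient Omega (fun x => b x ord0 j) (wgrad (fun x => b x ord0 j)).
  by apply: wgradP; case: (Wb j).
have Ldb j : L2 (fun x => wgrad (fun x => b x ord0 j) x ord0 j) by have [] := wb j j.
have E j : ip (partial j psi) (fun x => b x ord0 j * psi x) =
   - 2^-1 * ip (fun x => wgrad (fun x => b x ord0 j) x ord0 j) (fun x => psi x * psi x).
  have := (wb j j).2 _ tp2.
  rewrite (_ : partial j _ = fun x => 2 * (partial j psi x * psi x)); last first.
    apply/funext => x; rewrite partialM; [ring|exact: smooth_differentiable tpsi.1..].
  have Lpp : L2 (fun x => partial j psi x * psi x).
    apply: (test_function_L2 oO); apply: test_functionM; last exact: tpsi.1.
    exact: test_function_partial.
  rewrite (ipZr mO)// => h.
  have -> : ip (partial j psi) (fun x => b x ord0 j * psi x) =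
      ip (fun x => b x ord0 j) (fun x => partial j psi x * psi x).
    by apply: eq_Rintegral => x _; ring.
  lra.
under eq_bigr do rewrite E.
rewrite -mulr_sumr -(ip_suml mO)//.
rewrite (_ : ip _ _ = ip (fun=> 0) (fun x => psi x * psi x)); first by rewrite ip_cst0l mulr0.
apply: aeq_ip => //.
- exact: L2_sum.
- exact: (L2_cst oO bO).
- exact: aeW.
Qed.

(** Write [w = psi - q] with a test function [psi] close to [w] in H^1. The term
    of [psi] vanishes, and each remaining term contains [q] or its gradient, hence
    is small by Young's inequality. *)
Lemma transport_skew b w : divfree_W1inf_field Omega b -> H10 Omega w ->
  ip (fun x => dot (b x) (wgrad w x)) w = 0.
Proof.
move=> db /(H10P oO bO)[Hw dw]; have [Wb _ _] := db.
have Lw := H1_L2 Hw; have LG j := H1_wgrad_L2 j Hw.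
rewrite ip_transport//.
have [c [C cP]] : exists (c : 'I_n -> V -> R) (C : R), forall j,
    [/\ measurable_fun Omega (c j), forall x, `|c j x| <= C & aeq Omega (fun x => b x ord0 j) (c j)].
  have H j := W1inf_bounded (Wb j).
  have [c H'] := choice H; have [C' cP] := choice H'.
  exists c, (\sum_j `|C' j|) => j; have [h1 h2 h3] := cP j; split => // x.
  apply: (le_trans (h2 x)); apply: (le_trans (ler_norm _)).
  by rewrite (bigD1 j)//= lerDl; exact: sumr_ge0.
have Lcv j v : L2 v -> L2 (fun x => c j x * v x).
  by move=> Lv; have [h1 h2 _] := cP j; have [] := L2_bounded oO h1 h2 Lv.
have cv_le j v : L2 v -> ip (fun x => c j x * v x) (fun x => c j x * v x) <= C ^+ 2 * ip v v.
  by move=> Lv; have [h1 h2 _] := cP j; have [] := L2_bounded oO h1 h2 Lv.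
have bc j v u : L2 v -> L2 u -> ip u (fun x => b x ord0 j * v x) = ip u (fun x => c j x * v x).
  move=> Lv Lu; apply: aeq_ip => //; [exact: (W1inf_mul_L2 oO (Wb j))|exact: Lcv|exact: aeq_refl|].
  by have [_ _] := cP j; apply: filterS => x h Ox; rewrite h.
under eq_bigr do rewrite bc//.
set X := \sum_j _.
pose gw := \sum_j ip (fun x => wgrad w x ord0 j) (fun x => wgrad w x ord0 j).
pose ww := n%:R * (C ^+ 2 * ip w w).
(* [d] is the weight in Young's inequality, [eta] the squared distance to [psi]. *)
have main (d eta : R) : 0 < d -> 0 < eta ->
   `|X| <= d * (gw + ww) + (d^-1 + 1) * (n%:R * C ^+ 2 + 1) * eta.
  move=> d0 eta0; have [psi tpsi dpsi] := dw _ eta0.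
  have Lp := test_function_L2 oO tpsi.
  have Ldp j := test_partial_L2 oO j tpsi.
  pose q x := psi x - w x; pose e j x := partial j psi x - wgrad w x ord0 j.
  have Lq : L2 q by exact: L2B.
  have Le j : L2 (e j) by exact: L2B.
  have h0 := transport_skew_test db tpsi.
  have XE : X = - (\sum_j (ip (fun x => wgrad w x ord0 j) (fun x => c j x * q x) +
       ip (e j) (fun x => c j x * w x) + ip (e j) (fun x => c j x * q x))).
    apply/eqP; rewrite -subr_eq0 opprK -big_split/= -[X in _ == X]h0; apply/eqP.
    apply: eq_bigr => j _; rewrite bc//.
    have -> : ip (partial j psi) (fun x => c j x * psi x) =
       ip (fun x => wgrad w x ord0 j + e j x) (fun x => c j x * w x + c j x * q x).
      by apply: ip_eq => x _; rewrite /e /q; ring.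
    have := Lcv j _ Lq; have := Lcv j _ Lw => L1 L2'.
    rewrite (ipDl mO)//; last exact: L2D.
    rewrite !(ipDr mO)//; ring.
  have distE : H1_dist Omega psi w = ip q q + \sum_j ip (e j) (e j) by [].
  have q0 : 0 <= ip q q by exact: ip_ge0.
  have e0 j : 0 <= ip (e j) (e j) by exact: ip_ge0.
  rewrite XE normrN; apply: le_trans (ler_norm_sum _ _ _) _.
  apply: (@le_trans _ _ (\sum_j (d * ip (fun x => wgrad w x ord0 j) (fun x => wgrad w x ord0 j)
     + d^-1 * (C ^+ 2 * ip q q) + (d^-1 * ip (e j) (e j) + d * (C ^+ 2 * ip w w))
     + (ip (e j) (e j) + C ^+ 2 * ip q q)))).
    apply: ler_sum => j _; apply: le_trans (ler_normD _ _) _; apply: lerD; first last.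
      have := ip_young mO ltr01 (Le j) (Lcv j _ Lq); rewrite invr1 !mul1r => h.
      by apply: le_trans h _; rewrite lerD2l; exact: cv_le.
    apply: le_trans (ler_normD _ _) _; apply: lerD.
      apply: le_trans (ip_young mO d0 (LG j) (Lcv j _ Lq)) _.
      by rewrite lerD2l ler_wpM2l ?invr_ge0 ?(ltW d0)//; exact: cv_le.
    have d0' : 0 < d^-1 by rewrite invr_gt0.
    apply: le_trans (ip_young mO d0' (Le j) (Lcv j _ Lw)) _.
    by rewrite invrK lerD2l ler_wpM2l ?(ltW d0)//; exact: cv_le.
  rewrite sum_collect -/gw.
  move: dpsi; rewrite distE; set S := \sum_j ip (e j) (e j) => dpsi.
  have S0 : 0 <= S by apply: sumr_ge0 => j _; exact: e0.
  have nC : 0 <= n%:R * C ^+ 2 by rewrite mulr_ge0 ?sqr_ge0.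
  have d1 : 0 <= d^-1 + 1 by rewrite addr_ge0 ?invr_ge0 ?ltW.
  rewrite /ww.
  rewrite lerD2l -[leRHS]mulrA ler_wpM2l// mulrA.
  apply: (@le_trans _ _ ((n%:R * C ^+ 2 + 1) * (ip q q + S))); last first.
    by rewrite ler_wpM2l ?addr_ge0// ltW.
  rewrite -subr_ge0; set k := n%:R * C ^+ 2 in nC *.
  have -> : (k + 1) * (ip q q + S) - (k * ip q q + S) = k * S + ip q q by ring.
  by rewrite addr_ge0// mulr_ge0.
have gww0 : 0 <= gw + ww.
  rewrite addr_ge0//; first by apply: sumr_ge0 => j _; exact: ip_ge0.
  by rewrite mulr_ge0// mulr_ge0 ?sqr_ge0 ?ip_ge0.
have nC : 0 <= n%:R * C ^+ 2 by rewrite mulr_ge0 ?sqr_ge0.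
apply/eqP; rewrite -normr_le0; apply/ler_addgt0Pl => r r0; rewrite addr0.
(* First make the fixed part small with [d], then the rest with [eta]. *)
pose d := r / 2 / (gw + ww + 1).
have d0 : 0 < d by rewrite !divr_gt0// ltr_wpDl.
have A0 : 0 < (d^-1 + 1) * (n%:R * C ^+ 2 + 1).
  by rewrite mulr_gt0// ?ltr_wpDl// ?invr_ge0 ltW.
pose eta := r / 2 / ((d^-1 + 1) * (n%:R * C ^+ 2 + 1)).
have eta0 : 0 < eta by rewrite !divr_gt0.
apply: le_trans (main d eta d0 eta0) _; rewrite [leRHS]splitr; apply: lerD.
  by rewrite /d -[leLHS]mulrA ler_piMr ?divr_ge0 ?(ltW r0)// mulrC ler_pdivrMr ?mul1r ?lerDl// ltr_wpDl.
by rewrite /eta mulrC divfK// lt0r_neq0.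
Qed.

End transport.

(** * Gradient traces on the cells of a mesh *)

Section smooth_polynomials.
Context {R : realType} {n : nat}.
Local Notation V := 'rV[R]_n.
Implicit Types (f g : V -> R).

Lemma smooth_cst (c : R) : smooth (fun _ : V => c).
Proof. by apply: smooth_algP; exact: SmoothCst. Qed.

Lemma smooth_sum (I : Type) (r : seq I) (P : pred I) (F : I -> V -> R) :
  (forall i, smooth (F i)) -> smooth (fun x => \sum_(i <- r | P i) F i x).
Proof.
move=> sF; elim: r => [|i r IH].
  by under eq_fun do rewrite big_nil; exact: smooth_cst.
by under eq_fun do rewrite big_cons; case: (P i) => //; exact: smoothD.
Qed.

Lemma smooth_prod (I : Type) (r : seq I) (P : pred I) (F : I -> V -> R) :
  (forall i, smooth (F i)) -> smooth (fun x => \prod_(i <- r | P i) F i x).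
Proof.
move=> sF; elim: r => [|i r IH].
  by under eq_fun do rewrite big_nil; exact: smooth_cst.
by under eq_fun do rewrite big_cons; case: (P i) => //; exact: smoothM.
Qed.

Lemma smooth_exp f m : smooth f -> smooth (fun x => f x ^+ m).
Proof.
move=> sf; elim: m => [|m IH]; first by under eq_fun do rewrite expr0; exact: smooth_cst.
by under eq_fun do rewrite exprS; exact: smoothM.
Qed.

Lemma smooth_coord i : smooth (fun x : V => x ord0 i).
Proof.
apply: (@smooth_coind _ _ (fun f => f = (fun x : V => x ord0 i) \/ exists c, f = fun=> c)); last by left.
move=> f [->|[c ->]]; split=> [x|j]; [exact: differentiable_coord|right|exact: differentiable_cst|right].
  by exists ((delta_mx ord0 j : V) ord0 i); apply/funext => x; rewrite /partial derive_val.
by exists 0; apply/funext => x; exact: partial_cst.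
Qed.

Lemma smooth_affine m (A : 'M[R]_(n, m)) (o : V) j :
  smooth (fun x : V => ((x - o) *m A) ord0 j).
Proof.
under eq_fun do rewrite mxE; apply: smooth_sum => l.
rewrite (_ : (fun x => _) = fun x : V => A l j * x ord0 l + - (A l j * o ord0 l)); last first.
  by apply/funext => x; rewrite !mxE; ring.
apply: smoothD; last exact: smooth_cst.
by apply: smoothZ; exact: smooth_coord.
Qed.

Lemma continuous_affine m (A : 'M[R]_(n, m)) (o : V) :
  continuous (fun x : V => (x - o) *m A).
Proof.
by move=> x; apply: (@cvg_rowP _ _ _ (nbhs x)) => j; exact: (smooth_continuous (smooth_affine A o j)).
Qed.

Lemma smooth_poly_affine s k (q : V -> R) (A : 'M[R]_n) (o : V) :
  poly_space s k q -> smooth (fun x : V => q ((x - o) *m A)).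
Proof.
move=> [c qE]; under eq_fun do rewrite qE.
apply: smooth_sum => a; apply: smoothZ; apply: smooth_prod => j; apply: smooth_exp.
exact: smooth_affine.
Qed.

End smooth_polynomials.

Section cells.
Context {R : realType} {n : nat}.
Local Notation V := 'rV[R]_n.
Variables (M : mesh R n) (uM : forall e : 'I_(ncell M), cmat e \in unitmx).
Implicit Types (v w : V -> R) (e : 'I_(ncell M)).

Definition cell_inv e (x : V) : V := (x - corigin e) *m invmx (cmat e).

Lemma cell_mapK e : cancel (cell_map e) (cell_inv e).
Proof. by move=> y; rewrite /cell_inv /cell_map addrC addKr mulmxK. Qed.

Lemma cell_invK e : cancel (cell_inv e) (cell_map e).
Proof. by move=> x; rewrite /cell_inv /cell_map mulmxKV// addrC subrK. Qed.

(** Polynomials in reference coordinates are smooth functions on the whole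
    space, because the cell map is affine and invertible. *)
Lemma cell_space_smooth k e v : cell_space k e v ->
  exists Q, smooth Q /\ forall x, cell e x -> v x = Q x.
Proof.
rewrite /cell_space /cell; case: (mshape M) => [[q Pq vq]|[q Pq vq]].
  exists q; split => //; have := smooth_poly_affine 1%:M 0 Pq.
  by congr smooth; apply/funext => x; rewrite subr0 mulmx1.
exists (fun x => q (cell_inv e x)); split; first exact: smooth_poly_affine Pq.
by move=> _ [y ry <-]; rewrite vq// cell_mapK.
Qed.

Definition refcell_in (s : cell_shape) : set V :=
  match s with
  | Simplex => [set y | (forall j, 0 < y ord0 j) /\ \sum_j y ord0 j < 1]
  | Cube => [set y | forall j, 0 < y ord0 j < 1]
  end.

Lemma continuous_sum_coord : continuous (fun y : V => \sum_j y ord0 j).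
Proof.
by apply: smooth_continuous; apply: smooth_sum => i; exact: smooth_coord.
Qed.

Lemma open_refcell_in s : open (refcell_in s).
Proof.
have oj (j : 'I_n) : open [set y : V | 0 < y ord0 j].
  apply: (@open_comp _ _ (fun y : V => y ord0 j : R) [set r | 0 < r]); last exact: open_gt.
  by move=> x _; exact: coord_continuous.
have oj1 (j : 'I_n) : open [set y : V | y ord0 j < 1].
  apply: (@open_comp _ _ (fun y : V => y ord0 j : R) [set r | r < 1]); last exact: open_lt.
  by move=> x _; exact: coord_continuous.
have oI (P : 'I_n -> set V) : (forall j, open (P j)) -> open [set y | forall j, P j y].
  move=> oP; rewrite openE => y Py.
  have H j : \forall z \near y, P j z by apply: open_nbhs_nbhs; split => //; exact: Py.
  exact: (filter_forall (nbhs_filter y) H).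
case: s => /=.
  apply: openI; first exact: oI.
  apply: (@open_comp _ _ (fun y : V => \sum_j y ord0 j) [set r | r < 1]).
    by move=> x _; exact: continuous_sum_coord.
  exact: open_lt.
have := oI _ (fun j => openI (oj j) (oj1 j)); congr open; apply/seteqP.
split => y hy j; have := hy j; first by move=> [h1 h2]; apply/andP.
by move=> /andP[].
Qed.

Lemma refcell_in_sub s : refcell_in s `<=` refcell s n.
Proof.
case: s => y /=; first by move=> [h1 /ltW h2]; split => // j; exact: ltW.
by move=> h j; have /andP[/ltW -> /ltW ->] := h j.
Qed.

Lemma cell_interior e (y : V) : refcell_in (mshape M) y -> (cell e)° (cell_map e y).
Proof.
move=> yin; rewrite /interior/=.
have : \forall x \near cell_map e y, refcell_in (mshape M) (cell_inv e x).
  apply: open_nbhs_nbhs; split; last by rewrite /= cell_mapK.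
  apply: open_comp; last exact: open_refcell_in.
  by move=> x _; exact: continuous_affine.
apply: filterS => x xin; exists (cell_inv e x); last exact: cell_invK.
exact: refcell_in_sub.
Qed.

Definition refcenter : V := const_mx (n.+1%:R^-1).

(** The segment from a point of a cell to the centre of the cell stays inside. *)
Lemma refcell_segment s (y : V) (t : R) : refcell s n y -> 0 < t <= 1 ->
  refcell_in s (y + t *: (refcenter - y)).
Proof.
move=> ry /andP[t0 t1].
have c0 : 0 < n.+1%:R^-1 :> R by rewrite invr_gt0.
case: s ry => /= [[y0 y1]|y01].
  split=> [j|].
    rewrite !mxE; have -> : y ord0 j + t * (n.+1%:R^-1 - y ord0 j) = (1 - t) * y ord0 j + t * n.+1%:R^-1 by ring.
    by rewrite ltr_wpDl ?mulr_ge0 ?subr_ge0// mulr_gt0.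
  under eq_bigr => j _ do rewrite !mxE.
  have -> : \sum_(j < n) (y ord0 j + t * (n.+1%:R^-1 - y ord0 j)) =
     (1 - t) * (\sum_j y ord0 j) + t * (n%:R * n.+1%:R^-1).
    rewrite (_ : n%:R * _ = \sum_(j < n) n.+1%:R^-1 :> R); last first.
      by rewrite sumr_const card_ord mulr_natl.
    rewrite !mulr_sumr -big_split/=; apply: eq_bigr => j _; ring.
  have n1 : n%:R * n.+1%:R^-1 < 1 :> R by rewrite ltr_pdivrMr ?mul1r ?ltr_nat.
  apply: (@le_lt_trans _ _ ((1 - t) * 1 + t * (n%:R * n.+1%:R^-1))).
    by rewrite lerD2r ler_wpM2l// subr_ge0.
  rewrite mulr1 -ltrBrDl opprB addrCA subrr addr0.
  by rewrite gtr_pMr.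
move=> j; rewrite !mxE.
have -> : y ord0 j + t * (n.+1%:R^-1 - y ord0 j) = (1 - t) * y ord0 j + t * n.+1%:R^-1 by ring.
have /andP[h1 h2] := y01 j.
have c1 : n.+1%:R^-1 < 1 :> R.
  by rewrite invf_lt1// ltr1n ltnS; apply: leq_ltn_trans (ltn_ord j).
apply/andP; split; first by rewrite ltr_wpDl ?mulr_ge0 ?subr_ge0// mulr_gt0.
apply: (@le_lt_trans _ _ ((1 - t) * 1 + t * n.+1%:R^-1)).
  by rewrite lerD2r ler_wpM2l// subr_ge0.
rewrite mulr1 -ltrBrDl opprB addrCA subrr addr0.
by rewrite gtr_pMr.
Qed.

(** Without this the limit that defines a trace would be taken along an improper
    filter. *)
Lemma cell_closure_interior e (x : V) : cell e x -> closure (cell e)° x.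
Proof.
move=> [y ry <-] B Bx.
pose g (t : R) := cell_map e (y + t *: (refcenter - y)).
have g0 : g 0 = cell_map e y by rewrite /g scale0r addr0.
have cg : {for 0, continuous g}.
  apply: (@cvg_rowP _ _ _ (nbhs (0 : R))) => i.
  have E t : g t ord0 i = cell_map e y ord0 i + t * ((refcenter - y) *m cmat e) ord0 i.
    by rewrite /g /cell_map mulmxDl -scalemxAl addrA !mxE.
  under eq_fun do rewrite E; rewrite E; apply: cvgD; first exact: cvg_cst.
  by apply: cvgM; [exact: cvg_id|exact: cvg_cst].
have : \forall t \near (0 : R)^'+, B (g t).
  by apply: (cvg_at_right_filter cg); rewrite g0.
move=> nB.
have n01 : \forall t \near (0 : R)^'+, 0 < t <= 1.
  near=> t; apply/andP; split; first by near: t; exact: nbhs_right_gt.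
  by near: t; apply: nbhs_right_le.
near (0 : R)^'+ => t.
have Bt : B (g t) by near: t.
have t01 : 0 < t <= 1 by near: t.
by exists (g t); split => //; apply: cell_interior; exact: refcell_segment.
Unshelve. all: by end_near. Qed.

(** Inside the cell the function and its smooth extension [Q] have the same
    gradient, and the gradient of [Q] is continuous up to the boundary. *)
Lemma grad_traceE e v Q x : cell e x -> (forall z, cell e z -> v z = Q z) ->
  smooth Q -> grad_trace e v x = grad Q x.
Proof.
move=> ex vQ sQ; have PF : ProperFilter (within (cell e)° (nbhs x)).
  by apply: within_nbhs_proper; exact: cell_closure_interior.
apply: cvg_lim; first exact: rV_hausdorff.
have cQ : grad Q @ nbhs x --> grad Q x.
  apply: (@cvg_rowP _ _ _ (nbhs x)) => j.
  under eq_fun do rewrite mxE; rewrite mxE.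
  exact: (smooth_continuous (smooth_partial j sQ)).
have cw : grad Q @ within (cell e)° (nbhs x) --> grad Q x by exact: cvg_within_filter.
apply: (cvg_trans _ cw); apply: near_eq_cvg.
rewrite near_withinE; near=> y => ey.
apply/rowP => j; rewrite !mxE; apply: partial_near.
have := open_nbhs_nbhs (conj (open_interior (cell e)) ey).
by apply: filterS => z /interior_subset ez; rewrite vQ.
Unshelve. all: by end_near. Qed.

End cells.

(** * The jump form *)

Section refcell_integration.
Context {R : realType} {n : nat}.
Local Notation V := 'rV[R]_n.
Local Notation mu := (lebesgue_rV n).

Lemma refcell_ge0_le1 s (y : V) : refcell s n y -> forall j, 0 <= y ord0 j <= 1.
Proof.
case: s => //= -[y0 y1] j; rewrite y0/= (le_trans _ y1)// (bigD1 j)//= lerDl.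
by apply: sumr_ge0 => i _.
Qed.

Lemma closed_refcell s : closed (refcell s n : set V).
Proof.
have cj (j : 'I_n) (D : set R) : closed D -> closed [set y : V | D (y ord0 j)].
  move=> cD; apply: (@preimage_closed _ _ (fun y : V => y ord0 j : R) D) => // y _.
  exact: coord_continuous.
have cI (D : set R) : closed D -> closed [set y : V | forall j, D (y ord0 j)].
  move=> cD.
  have -> : [set y : V | forall j, D (y ord0 j)] =
      \bigcap_(j in [set: 'I_n]) [set y : V | D (y ord0 j)].
    by apply/seteqP; split => y h j; [move=> _; exact: h|exact: h].
  by apply: closed_bigI => j _; exact: cj.
case: s => /=.
  apply: (@closedI _ [set y : V | forall j, [set r | 0 <= r] (y ord0 j)]
     [set y : V | \sum_j y ord0 j <= 1]).
    by apply: cI; exact: closed_ge.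
  apply: (@preimage_closed _ _ (fun y : V => \sum_j y ord0 j) [set r | r <= 1]).
    by move=> x _; exact: continuous_sum_coord.
  exact: closed_le.
apply: (cI `[0, 1]%classic); exact: interval_closed.
Qed.

Lemma measurable_refcell s : measurable (refcell s n : set V).
Proof.
rewrite -[refcell s n]setCK; apply: measurableC; apply: open_measurable_rV.
by apply: closed_openC; exact: closed_refcell.
Qed.

Lemma bounded_refcell s : bounded_set (refcell s n : set V).
Proof.
exists 1; split; first exact: num_real.
move=> r r1 y ry; apply: le_trans (ltW r1).
rewrite [leLHS]/Num.norm/= mx_normrE; apply/bigmax_leP; split => // -[i j] _ /=.
by rewrite (ord1 i); have /andP[y0 y1] := refcell_ge0_le1 ry j; rewrite ger0_norm.
Qed.

Lemma compact_refcell s : compact (refcell s n : set V).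
Proof. by apply: bounded_closed_compact; [exact: bounded_refcell|exact: closed_refcell]. Qed.

(** Additivity of the integrals over facets rests on this: traces of gradients
    are continuous on the closed facets. *)
Lemma continuous_refcell_integrable s (h : V -> R) : continuous h ->
  mu.-integrable (refcell s n) (EFin \o h).
Proof.
move=> ch; apply: measurable_bounded_integrable.
- exact: measurable_refcell.
- by apply: bounded_lebesgue_lty; [exact: measurable_refcell|exact: bounded_refcell].
- by apply: measurable_funTS; exact: continuous_measurable_rV.
- have := compact_bounded (continuous_compact (continuous_subspaceT ch) (@compact_refcell s)).
  case=> C [Cr hC]; exists C; split => // C' CC' y ry.
  by apply: (hC C') => //; exists y.
Qed.

End refcell_integration.

Section J_form_theory.
Context {R : realType} {p : nat}.
Local Notation V := 'rV[R]_p.+1.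
Variables (M : mesh R p.+1) (uM : forall e : 'I_(ncell M), cmat e \in unitmx).
Implicit Types (v w u z : V -> R) (e : 'I_(ncell M)).

Definition cellwise_smooth v := forall e, exists Q, smooth Q /\ forall x, cell e x -> v x = Q x.

Lemma dotC (x y : V) : dot x y = dot y x.
Proof. by apply: eq_bigr => j _; rewrite mulrC. Qed.

Lemma dot_linl (a b : R) (x y t : V) : dot (a *: x + b *: y) t = a * dot x t + b * dot y t.
Proof.
rewrite /dot !mulr_sumr -big_split/=; apply: eq_bigr => j _; rewrite !mxE; ring.
Qed.

Lemma dot_ge0 (x : V) : 0 <= dot x x.
Proof. by apply: sumr_ge0 => j _; rewrite -expr2 sqr_ge0. Qed.

Lemma grad_trace_lin (a b : R) v w z e x : cellwise_smooth v -> cellwise_smooth w ->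
  (forall y, cell e y -> z y = a * v y + b * w y) -> cell e x ->
  grad_trace e z x = a *: grad_trace e v x + b *: grad_trace e w x.
Proof.
move=> /(_ e)[Q [sQ vQ]] /(_ e)[Q' [sQ' wQ']] zE ex.
rewrite (grad_traceE uM ex vQ sQ) (grad_traceE uM ex wQ' sQ').
rewrite (@grad_traceE _ _ _ uM e z (fun x => a * Q x + b * Q' x) x)//.
- apply/rowP => j; rewrite !mxE partialD ?partialZ//.
  + exact: smooth_differentiable.
  + exact: smooth_differentiable.
  + exact: smooth_differentiable (smoothZ a sQ).
  + exact: smooth_differentiable (smoothZ b sQ').
- by move=> y ey; rewrite zE// vQ// wQ'.
- by apply: smoothD; exact: smoothZ.
Qed.

Lemma grad_trace_continuous e v : cellwise_smooth v ->
  exists2 G : V -> V, (forall j, continuous (fun x => G x ord0 j)) &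
    forall x, cell e x -> grad_trace e v x = G x.
Proof.
move=> /(_ e)[Q [sQ vQ]]; exists (grad Q) => [j|x ex]; last exact: grad_traceE.
under eq_fun do rewrite mxE; exact: smooth_continuous (smooth_partial j sQ).
Qed.

Lemma facet_map_continuous e (i : facet_index (mshape M) p) :
  continuous (@facet_map _ _ M e i).
Proof.
move=> y; have E : facet_map e i =
   fun y => cell_map e (facet_origin i) + (y - 0) *m (facet_mat i *m cmat e).
  by apply/funext => y'; rewrite /facet_map /cell_map subr0 mulmxDl addrA mulmxA.
rewrite E; apply: (@cvgD _ _ _ (nbhs y)); first exact: cvg_cst.
exact: continuous_affine.
Qed.

(** Continuity is required of the integrands only in facet coordinates, since
    traces are arbitrary off the two adjacent cells. *)
Lemma facet_integral_lin e (i : facet_index (mshape M) p) (a b : R) f g h :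
  (exists2 f', continuous f' & forall y, refcell (mshape M) p y -> f (facet_map e i y) = f' y) ->
  (exists2 g', continuous g' & forall y, refcell (mshape M) p y -> g (facet_map e i y) = g' y) ->
  (forall y, refcell (mshape M) p y ->
     h (facet_map e i y) = a * f (facet_map e i y) + b * g (facet_map e i y)) ->
  facet_integral e i h = a * facet_integral e i f + b * facet_integral e i g.
Proof.
move=> [f' cf ff'] [g' cg gg'] hE; rewrite /facet_integral.
set S := Num.sqrt _; set r := refcell _ _.
have mr : measurable r by exact: measurable_refcell.
have If := continuous_refcell_integrable (mshape M) cf.
have Ig := continuous_refcell_integrable (mshape M) cg.
have -> : \int[lebesgue_rV p]_(y in r) f (facet_map e i y) = \int[lebesgue_rV p]_(y in r) f' y.
  by apply: eq_Rintegral => y; rewrite inE => ry; exact: ff'.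
have -> : \int[lebesgue_rV p]_(y in r) g (facet_map e i y) = \int[lebesgue_rV p]_(y in r) g' y.
  by apply: eq_Rintegral => y; rewrite inE => ry; exact: gg'.
have -> : \int[lebesgue_rV p]_(y in r) h (facet_map e i y) =
   \int[lebesgue_rV p]_(y in r) (a * f' y + b * g' y).
  by apply: eq_Rintegral => y; rewrite inE => ry; rewrite hE// ff'// gg'.
rewrite RintegralD//; [|exact: (integrableZl mr a If)|exact: (integrableZl mr b Ig)].
rewrite !RintegralZl//; ring.
Qed.

(** The facets that occur in the sum lie in both adjacent cells, where the traces
    are linear. *)
Lemma J_form_lin gamma b (a c : R) v w z u :
  cellwise_smooth v -> cellwise_smooth w -> cellwise_smooth u ->
  (forall e x, cell e x -> z x = a * v x + c * w x) ->
  J_form M gamma b z u = a * J_form M gamma b v u + c * J_form M gamma b w u.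
Proof.
move=> sv sw su zE; rewrite /J_form.
have K (x y X : R) : X = a * x + c * y -> gamma * X = a * (gamma * x) + c * (gamma * y).
  by move=> ->; ring.
apply: K; rewrite !mulr_sumr -big_split/=; apply: eq_bigr => e _.
rewrite !mulr_sumr -big_split/=; apply: eq_bigr => i _.
rewrite !mulr_sumr -big_split/=; apply: eq_bigr => e' /andP[_ /asboolP fE].
have inc y : refcell (mshape M) p y -> cell e (facet_map e i y) /\ cell e' (facet_map e i y).
  move=> ry; have : facet e i (facet_map e i y) by exists y.
  by rewrite fE => -[].
have [Gu cGu uG] := grad_trace_continuous e su.
have [Gu' cGu' uG'] := grad_trace_continuous e' su.
have cont q : cellwise_smooth q -> exists2 f', continuous f' & forall y, refcell (mshape M) p y ->
   facet_linf e i b * diam (facet e i) ^+ 2 *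
   dot (grad_jump e e' q (facet_map e i y)) (grad_jump e e' u (facet_map e i y)) = f' y.
  move=> sq; have [G cG qG] := grad_trace_continuous e sq.
  have [G' cG' qG'] := grad_trace_continuous e' sq.
  exists (fun y => facet_linf e i b * diam (facet e i) ^+ 2 * \sum_j
     (G (facet_map e i y) ord0 j - G' (facet_map e i y) ord0 j) *
     (Gu (facet_map e i y) ord0 j - Gu' (facet_map e i y) ord0 j)).
    have cc (H : V -> V) j : (forall j, continuous (fun x => H x ord0 j)) ->
       continuous (fun y => H (facet_map e i y) ord0 j).
      move=> cH y; apply: (@continuous_comp _ _ _ (facet_map e i) (fun x => H x ord0 j)).
        exact: facet_map_continuous.
      exact: cH.
    have cS : continuous (fun y => \sum_j
     (G (facet_map e i y) ord0 j - G' (facet_map e i y) ord0 j) *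
     (Gu (facet_map e i y) ord0 j - Gu' (facet_map e i y) ord0 j)).
      apply: continuous_big => [|j _ y]; first exact: add_continuous.
      apply: (@cvgM _ _ (nbhs y)); apply: (@cvgB _ _ _ (nbhs y)); exact: cc.
    have cM (k : R) (S : 'rV[R]_p -> R) : continuous S -> continuous (fun y => k * S y).
      by move=> cS' y; apply: continuousM; [exact: cst_continuous|exact: cS'].
    exact: cM.
  move=> y ry; have [ey ey'] := inc y ry; congr (_ * _).
  by apply: eq_bigr => j _; rewrite /grad_jump qG// qG'// uG// uG'// !mxE.
apply: facet_integral_lin; [exact: cont|exact: cont|].
move=> y ry; have [ey ey'] := inc y ry.
have -> : grad_jump e e' z (facet_map e i y) = a *: grad_jump e e' v (facet_map e i y) +
    c *: grad_jump e e' w (facet_map e i y).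
  rewrite /grad_jump (@grad_trace_lin a c v w z e)//; last exact: zE.
  rewrite (@grad_trace_lin a c v w z e')//; last exact: zE.
  by rewrite !scalerBr opprD addrACA.
have Kx (t d1 d2 : R) : t * (a * d1 + c * d2) = a * (t * d1) + c * (t * d2).
  by rewrite mulrDr mulrCA [t * (c * _)]mulrCA.
rewrite dot_linl. apply: Kx.
Qed.

Lemma J_formC gamma b v u : J_form M gamma b v u = J_form M gamma b u v.
Proof.
rewrite /J_form; have K (x y : R) : x = y -> gamma * x = gamma * y by move=> ->.
apply: K; apply: eq_bigr => e _; apply: eq_bigr => i _; apply: eq_bigr => e' _.
apply: (congr1 (@facet_integral R p M e i)); apply/funext => y.
by apply: (congr1 (fun t => facet_linf e i b * diam (facet e i) ^+ 2 * t)); exact: dotC.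
Qed.

Lemma J_form_ge0 gamma b v : 0 <= gamma -> 0 <= J_form M gamma b v v.
Proof.
move=> g0; apply: mulr_ge0 => //; apply: sumr_ge0 => e _; apply: sumr_ge0 => i _.
apply: sumr_ge0 => e' _; apply: mulr_ge0; first exact: sqrtr_ge0.
apply: Rintegral_ge0 => y _; apply: mulr_ge0; last exact: dot_ge0.
apply: mulr_ge0; last exact: sqr_ge0.
by apply: fine_ge0; exact: Lnorm_ge0.
Qed.

End J_form_theory.

(** * Positivity of the mesh function *)

Section mesh_size.
Context {R : realType} {p : nat}.
Local Notation V := 'rV[R]_p.+1.
Variables (M : mesh R p.+1) (uM : forall e : 'I_(ncell M), cmat e \in unitmx).
Implicit Types (v w u : V -> R) (e : 'I_(ncell M)).

Lemma dot_eq0 (x : V) : dot x x = 0 -> x = 0.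
Proof.
move=> /eqP; rewrite psumr_eq0; last by move=> j _; rewrite -expr2 sqr_ge0.
move=> /allP h; apply/rowP => j; rewrite mxE; apply/eqP.
by have := h j (mem_index_enum _); rewrite /= mulf_eq0 orbb.
Qed.

Lemma cell_bounded e : bounded_set (cell e).
Proof.
apply: compact_bounded; apply: continuous_compact; last exact: compact_refcell.
apply: continuous_subspaceT => y.
have -> : cell_map e = fun y => corigin e + (y - 0) *m cmat e.
  by apply/funext => y'; rewrite subr0.
apply: (@cvgD _ _ _ (nbhs y)); first exact: cvg_cst.
exact: continuous_affine.
Qed.

Lemma refcell0 s : refcell s p.+1 (0 : V).
Proof.
case: s => /=.
  split=> [j|]; first by rewrite mxE.
  by rewrite big1 ?ler01// => j _; rewrite mxE.
by move=> j; rewrite mxE lexx ler01.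
Qed.

Lemma refcell_delta s j : refcell s p.+1 (delta_mx ord0 j : V).
Proof.
case: s => /=.
  split=> [l|]; first by rewrite mxE.
  rewrite (bigD1 j)//= big1 ?mxE ?eqxx ?addr0// => l lj.
  by rewrite mxE (negbTE lj) andbF.
by move=> l; rewrite mxE eqxx/=; case: (l == j); rewrite ?lexx ?ler01.
Qed.

Lemma diam_cell_gt0 e : 0 < diam (cell e).
Proof.
pose x0 := cell_map e 0; pose x1 := cell_map e (delta_mx ord0 ord0).
have cx0 : cell e x0 by exists 0 => //; exact: refcell0.
have cx1 : cell e x1 by exists (delta_mx ord0 ord0) => //; exact: refcell_delta.
apply: (@lt_le_trans _ _ (enorm (x1 - x0))).
  rewrite sqrtr_gt0 lt_neqAle dot_ge0 andbT eq_sym; apply/eqP => /dot_eq0.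
  rewrite /x1 /x0 /cell_map opprD addrACA subrr add0r -mulmxBl subr0 => h.
  have : delta_mx ord0 ord0 = 0 :> V.
    by rewrite -(mulmxK (uM e) (delta_mx ord0 ord0)) h mul0mx.
  by move=> /rowP /(_ ord0); rewrite !mxE !eqxx => /eqP; rewrite oner_eq0.
rewrite /diam; apply: ub_le_sup; last by exists (x1, x0).
have [C [_ hC]] := cell_bounded e.
pose D := `|C| + 1.
have D0 : 0 <= D by rewrite addr_ge0.
have cD x : cell e x -> forall j, `|x ord0 j| <= D.
  move=> ex j; have : `|x| <= D.
    by apply: hC => //; rewrite (le_lt_trans (ler_norm _))// ltrDl.
  apply: le_trans; rewrite [leRHS]/Num.norm/= mx_normrE.
  by apply/bigmax_geP; right => /=; exists (ord0, j).
exists (Num.sqrt (\sum_(j < p.+1) (2 * D) ^+ 2)) => _ [[x y] [/= cx cy] <-].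
rewrite /enorm ler_wsqrtr// /dot; apply: ler_sum => j _; rewrite -expr2.
rewrite -real_normK ?num_real// lerXn2r ?nnegrE ?mulr_ge0// !mxE.
by rewrite (le_trans (ler_normB _ _))// mulrDl mul1r lerD// cD.
Qed.

Lemma lagrange_node_cell k x : (0 < k)%N -> lagrange_node M k x -> exists e, cell e x.
Proof.
move=> k0 [e [a [ea ->]]]; exists e, (\row_j ((a j)%:R / k%:R)) => //.
have k0' : 0 < k%:R :> R by rewrite ltr0n.
have aj j : 0 <= ((a j)%:R / k%:R : R) <= 1.
  by rewrite divr_ge0//= ler_pdivrMr// mul1r ler_nat -ltnS.
case: (mshape M) ea => /= [ea|_] //.
  split=> [j|]; first by rewrite mxE; have /andP[] := aj j.
  under eq_bigr do rewrite mxE; rewrite -mulr_suml ler_pdivrMr// mul1r.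
  by rewrite -natr_sum ler_nat.
by move=> j; rewrite mxE.
Qed.

Lemma lagrange_node1 e (a : {ffun 'I_p.+1 -> 'I_2}) : exponent (mshape M) a ->
  lagrange_node M 1 (cell_map e (\row_j (a j)%:R)).
Proof.
move=> ea; exists e, a; split => //; congr cell_map; apply/rowP => j.
by rewrite !mxE divr1.
Qed.

Lemma mesh_function_vertex Omega (hh : V -> R) (z : V) : mesh_function Omega M hh ->
  lagrange_node M 1 z -> 0 < hh z.
Proof.
move=> [_ hE] z1; rewrite hE//; have [e ez] := lagrange_node_cell (ltn0Sn 0) z1.
have aez : `[< cell e z >] by apply/asboolP.
apply: divr_gt0.
  rewrite (bigD1 e)//= ltr_wpDr//; last exact: diam_cell_gt0.
  by apply: sumr_ge0 => e' _; apply: ltW; exact: diam_cell_gt0.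
by rewrite ltr0n; apply/card_gt0P; exists e; rewrite inE.
Qed.

Lemma convex_comb_gt0 (I : finType) (c h : I -> R) : (forall i, 0 <= c i) ->
  \sum_i c i = 1 -> (forall i, 0 < c i -> 0 < h i) -> 0 < \sum_i c i * h i.
Proof.
move=> c0 c1 h0.
have ch i : 0 <= c i * h i.
  have [ci|ci] := ltP 0 (c i); first by rewrite mulr_ge0// ltW// h0.
  by rewrite (_ : c i = 0) ?mul0r//; apply/eqP; rewrite eq_le ci c0.
rewrite lt_neqAle sumr_ge0 ?andbT//; apply/negP; rewrite eq_sym psumr_eq0//.
move=> /allP H; have : \sum_i c i = 0.
  apply: big1 => i _; apply/eqP; have := H i (mem_index_enum _).
  rewrite /= mulf_eq0 => /orP[//|hi]; rewrite eq_le c0 andbT leNgt.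
  by apply/negP => /h0; rewrite (eqP hi) ltxx.
by rewrite c1 => /eqP; rewrite oner_eq0.
Qed.

Definition simplex_vertex (l : option 'I_p.+1) : V :=
  if l is Some j then delta_mx ord0 j else 0.

Definition barycentric (y : V) (l : option 'I_p.+1) : R :=
  if l is Some j then y ord0 j else 1 - \sum_j y ord0 j.

Lemma sum_option (I : finType) (F : option I -> R) :
  \sum_l F l = F None + \sum_i F (Some i).
Proof.
rewrite (bigD1 None)//=; congr (_ + _).
rewrite (reindex_omap Some id) => [|[]//]; apply: eq_bigl => i; by rewrite eqxx.
Qed.

Lemma barycentric_sum y : \sum_l barycentric y l = 1.
Proof. by rewrite sum_option /= subrK. Qed.

Lemma barycentricE y : y = \sum_l barycentric y l *: simplex_vertex l.
Proof.
apply/rowP => j; rewrite summxE sum_option /= !mxE mulr0 add0r (bigD1 j)//=.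
rewrite !mxE !eqxx mulr1 big1 ?addr0// => l lj.
by rewrite !mxE [j == l]eq_sym (negbTE lj) andbF mulr0.
Qed.

(** Each monomial of total degree at most one is constant or a coordinate. *)
Lemma poly_simplex1_affine (q : V -> R) (I : finType) (c : I -> R) (z : I -> V) :
  poly_space Simplex 1 q -> \sum_i c i = 1 ->
  q (\sum_i c i *: z i) = \sum_i c i * q (z i).
Proof.
move=> [d qE] c1; rewrite qE.
under [RHS]eq_bigr => i _ do rewrite qE mulr_sumr.
rewrite exchange_big/=; apply: eq_bigr => a ea.
under [RHS]eq_bigr => i _ do rewrite mulrCA.
rewrite -mulr_sumr; congr (_ * _).
have [a0|[j aj]] : (forall j, a j = ord0) \/ exists j, a j != ord0.
  have [/forallP h|/forallPn[j h]] := boolP [forall j, a j == ord0].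
    by left=> j; exact/eqP.
  by right; exists j.
  rewrite big1; last by move=> j _; rewrite a0 expr0.
  rewrite -[LHS]c1; apply: eq_bigr => i _; rewrite big1 ?mulr1// => j _.
  by rewrite a0 expr0.
have aj1 : a j = 1%N :> nat.
  by move: aj; case: (a j) => -[|[|m]] //= i2; rewrite -val_eqE.
have al l : l != j -> a l = 0%N :> nat.
  move=> lj; apply/eqP; move: ea; rewrite /exponent (bigD1 j)//= aj1 (bigD1 l)//=.
  by rewrite addnA; case: (nat_of_ord (a l)).
have mono (y : V) : \prod_l y ord0 l ^+ a l = y ord0 j.
  rewrite (bigD1 j)//= aj1 expr1 big1 ?mulr1// => l lj.
  by rewrite al// expr0.
rewrite mono summxE; apply: eq_bigr => i _; by rewrite mono mxE.
Qed.

Definition cube_weight (y : V) (b : {ffun 'I_p.+1 -> 'I_2}) : R :=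
  \prod_j (if b j == ord0 then 1 - y ord0 j else y ord0 j).

(** For a monomial, distributing the product over the sum of the two faces in
    each direction shows that the weighted values at the vertices add up to the
    monomial itself. *)
Lemma poly_cube1_multilinear (q : V -> R) (y : V) : poly_space Cube 1 q ->
  q y = \sum_b cube_weight y b * q (\row_j (b j)%:R).
Proof.
move=> [d qE]; rewrite qE.
under [RHS]eq_bigr => b _ do rewrite qE mulr_sumr.
rewrite exchange_big/=; apply: eq_bigr => a _.
under [RHS]eq_bigr => b _ do rewrite mulrCA.
rewrite -mulr_sumr; congr (_ * _).
transitivity (\prod_j \sum_(t : 'I_2)
  ((if t == ord0 then 1 - y ord0 j else y ord0 j) * (t%:R) ^+ a j)).
  apply: eq_bigr => j _; rewrite big_ord_recl big_ord1 /= expr1n mulr1.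
  by case: (a j) => -[|[|m]] //= _; rewrite ?expr0 ?expr1 ?mulr1 ?mulr0 ?add0r ?subrK.
rewrite bigA_distr_bigA; apply: eq_bigr => b _.
rewrite /cube_weight -big_split/=; apply: eq_bigr => j _; by rewrite mxE.
Qed.

Lemma cube_weight_ge0 y b : refcell Cube p.+1 y -> 0 <= cube_weight y b.
Proof.
move=> y01; apply: prodr_ge0 => j _; have /andP[h0 h1] := y01 j.
by case: ifP => _; rewrite ?subr_ge0.
Qed.

Lemma cube_weight_sum y : \sum_b cube_weight y b = 1.
Proof.
rewrite -(bigA_distr_bigA (fun j (t : 'I_2) => if t == ord0 then 1 - y ord0 j else y ord0 j)).
by apply: big1 => j _; rewrite big_ord_recl big_ord1 /= subrK.
Qed.

(** The mesh function is a convex combination of its positive values at the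
    vertices of the cell. *)
Lemma mesh_function_gt0 Omega (hh : V -> R) e x : mesh_function Omega M hh ->
  cell e x -> 0 < hh x.
Proof.
move=> mh [y ry <-]; have vert := mesh_function_vertex mh.
have l1 := @lagrange_node1 e.
have [[_ /(_ e) cs] _] := mh; move: cs ry l1; rewrite /cell_space /cell.
case: (mshape M) => [[q Pq hq]|[q Pq hq]] ry l1.
  have E : cell_map e y = \sum_l barycentric y l *: cell_map e (simplex_vertex l).
    under eq_bigr do rewrite /cell_map scalerDr scalemxAl.
    by rewrite big_split/= -scaler_suml barycentric_sum scale1r -mulmx_suml -barycentricE.
  rewrite hq; last by exists y.
  rewrite E (poly_simplex1_affine _ Pq (barycentric_sum y)).
  have [y0 y1] := ry.
  apply: convex_comb_gt0; first by case=> [j|] /=; rewrite ?subr_ge0.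
    exact: barycentric_sum.
  move=> l _; rewrite -hq; last first.
    exists (simplex_vertex l) => //; case: l => [j|] /=.
      exact: (refcell_delta Simplex j).
    exact: (refcell0 Simplex).
  apply: vert; pose a : {ffun 'I_p.+1 -> 'I_2} :=
    [ffun j => if l == Some j then ord_max else ord0].
  have ea : exponent Simplex a.
    rewrite /exponent; case: l @a => [j|] a.
      rewrite (bigD1 j)//= ffunE eqxx big1// => l lj.
      by rewrite ffunE; case: eqP => // -[jl]; rewrite jl eqxx in lj.
    by rewrite big1// => j _; rewrite ffunE.
  have := l1 a ea; congr (lagrange_node _ _ (cell_map _ _)).
  apply/rowP => j; rewrite mxE ffunE; case: l {a ea} => [l|] /=; rewrite !mxE//=.
  rewrite (inj_eq (@Some_inj _)) eq_sym; by case: (j == l).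
rewrite hq// (poly_cube1_multilinear _ Pq).
apply: convex_comb_gt0; [by move=> b; exact: cube_weight_ge0|exact: cube_weight_sum|].
move=> b _; rewrite -hq; last first.
  move=> j; rewrite mxE ler0n/= lern1; by case: (b j) => -[|[|m]].
by apply: vert; exact: l1.
Qed.

End mesh_size.

(** * A complementarity problem in finite dimension *)

Section complementarity.
Context {R : realType} {m : nat}.
Local Notation V := 'rV[R]_m.
Variables (kap : R) (kap0 : 0 < kap).
Implicit Types (x y z w : V) (r s t : R).

Lemma trunc_ge0_le r : 0 <= trunc kap r <= kap.
Proof. by rewrite /trunc le_max lexx ge_max ge_min lexx orbT (ltW kap0). Qed.

Lemma trunc_id r : 0 <= r <= kap -> trunc kap r = r.
Proof. by move=> /andP[h1 h2]; rewrite /trunc min_l// max_r. Qed.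

Lemma trunc_le0 r : r <= 0 -> trunc kap r = 0.
Proof. by move=> h; rewrite /trunc max_l// ge_min h. Qed.

Lemma trunc_ge r : kap <= r -> trunc kap r = kap.
Proof. by move=> h; rewrite /trunc min_r// max_r// ltW. Qed.

Lemma trunc_lipschitz r s : `|trunc kap r - trunc kap s| <= `|r - s|.
Proof.
wlog sr : r s / s <= r.
  move=> H; have [h|/ltW h] := leP s r; first exact: H.
  by rewrite distrC [leRHS]distrC; exact: H.
have mon : trunc kap s <= trunc kap r.
  by rewrite /trunc; apply: le_max2 => //; exact: le_min2.
rewrite !ger0_norm ?subr_ge0//.
have [r0|/ltW r0] := leP r 0.
  by rewrite !trunc_le0 ?subrr ?subr_ge0// (le_trans sr).
have [sk|/ltW sk] := leP kap s.
  by rewrite !trunc_ge ?subrr ?subr_ge0// (le_trans sk).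
apply: lerB.
  by rewrite /trunc ge_max r0 ge_min lexx.
by rewrite /trunc le_max le_min lexx sk orbT.
Qed.

Lemma trunc_continuous : continuous (trunc kap).
Proof.
move=> r; apply/cvgrPdist_le => e e0; near=> s.
apply: le_trans (trunc_lipschitz _ _) _; near: s.
exact: cvgr_dist_le.
Unshelve. all: by end_near. Qed.

(** The hypothesis says that [r * (t' - w) >= 0] for all [t'] in the box, a
    condition in which the step is absent. Thus a fixed point for one step
    is a fixed point for the individual steps [1 / d i] as well. *)
Lemma trunc_step (w r s t : R) : 0 <= w <= kap -> 0 < s -> 0 < t ->
  w = trunc kap (w - s * r) -> trunc kap (w - t * r) = w.
Proof.
move=> wk s0 t0 wE; have /andP[w0 w1] := wk.
have [r0|r0|->] := ltrgtP r 0.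
- have wk' : w = kap.
    apply/eqP; rewrite eq_le w1/= leNgt; apply/negP => wlt.
    have sr : 0 < - (s * r) by rewrite -mulrN mulr_gt0// oppr_gt0.
    move: wE; rewrite /trunc max_r; last first.
      by rewrite le_min (ltW kap0) andbT addr_ge0// ltW.
    rewrite /Num.min; case: ifP => _ wE; move: wlt; rewrite {1}wE ?ltxx//.
    by move: sr; lra.
  apply: etrans (trunc_ge _) (esym wk'); rewrite wk' lerDl -mulrN mulr_ge0 ?ltW// oppr_gt0.
  exact: r0.
- have w0' : w = 0.
    apply/eqP; rewrite eq_le w0 andbT leNgt; apply/negP => wgt.
    have sr : 0 < s * r by rewrite mulr_gt0.
    move: wE; rewrite /trunc min_l; last by lra.
    rewrite /Num.max; case: ifP => _ wE; last by move: wgt; rewrite wE ltxx.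
    by lra.
  by rewrite trunc_le0// w0' sub0r oppr_le0 mulr_ge0 ?ltW.
- by rewrite mulr0 subr0 trunc_id.
Qed.

Definition sqn (x : V) : R := \sum_i x ord0 i ^+ 2.

Lemma sqn_ge0 x : 0 <= sqn x.
Proof. by apply: sumr_ge0 => i _; exact: sqr_ge0. Qed.

Variables (A : 'M[R]_m) (b : V).
Hypothesis A_pos : forall z, z != 0 -> 0 < \sum_j (z *m A) ord0 j * z ord0 j.

Definition quad (z : V) : R := \sum_j (z *m A) ord0 j * z ord0 j.

Lemma continuous_mulmx m1 (B : 'M[R]_(m, m1)) : continuous (fun z : V => z *m B).
Proof.
have -> : (fun z : V => z *m B) = (fun z => (z - 0) *m B).
  by apply/funext => z; rewrite subr0.
exact: continuous_affine.
Qed.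

Lemma continuous_coordM (f g : V -> R) : continuous f -> continuous g ->
  continuous (fun x => f x * g x).
Proof. by move=> cf cg x; apply: continuousM; [exact: cf|exact: cg]. Qed.

Lemma continuous_sumf (I : finType) (F : I -> V -> R) : (forall i, continuous (F i)) ->
  continuous (fun x => \sum_i F i x).
Proof. by move=> cF; apply: continuous_big => [|i _]; [exact: add_continuous|exact: cF]. Qed.

Lemma continuous_mulcoord (B : 'M[R]_m) j : continuous (fun z : V => (z *m B) ord0 j).
Proof.
move=> z; apply: (@continuous_comp _ _ _ (fun z : V => z *m B) (fun z : V => z ord0 j : R)).
  exact: continuous_mulmx.
exact: coord_continuous.
Qed.

(** The square of the length changes by [- s (2 <zA, z> - s |zA|^2)]. By
    homogeneity it suffices to bound the two terms on the unit sphere of the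
    maximum norm, which is compact. *)
Lemma contraction_step : exists2 s, 0 < s & forall z, z != 0 ->
  sqn (z - s *: (z *m A)) < sqn z.
Proof.
pose S := [set z : V | `|z| = 1].
have cS : compact S.
  apply: bounded_closed_compact.
    by exists 1; split; [exact: num_real|move=> c c1 z /= ->; exact: ltW].
  apply: (@preimage_closed _ _ (fun z : V => `|z|) [set 1]) => [z _|]; first exact: norm_continuous.
  exact: closed_eq.
have SnzE z : z != 0 -> S (`|z|^-1 *: z).
  move=> z0; rewrite /S/= normrZ ger0_norm ?invr_ge0// mulVf// normr_eq0//.
have expand s z : sqn (z - s *: (z *m A)) = sqn z - s * (2 * quad z - s * sqn (z *m A)).
  rewrite /sqn /quad !(mulr_sumr, mulrBr) -!sumrB; apply: eq_bigr => i _; rewrite !mxE; ring.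
(* In dimension zero the sphere is empty and there is nothing to prove. *)
have [S0|/set0P[z1 Sz1]] := eqVneq S set0.
  exists 1 => // z z0; have := SnzE _ z0; by rewrite S0.
have cq : continuous quad.
  apply: continuous_sumf => j; apply: continuous_coordM; first exact: continuous_mulcoord.
  exact: coord_continuous.
have cn : continuous (fun z => sqn (z *m A)).
  apply: continuous_sumf => j; apply: (@continuous_coordM (fun z => (z *m A) ord0 j));
  exact: continuous_mulcoord.
have [z2] := EVT_min_rV (ex_intro _ _ Sz1) cS (continuous_subspaceT cq).
rewrite inE => Sz2 qmin.
have [z3] := EVT_max_rV (ex_intro _ _ Sz1) cS (continuous_subspaceT cn).
rewrite inE => Sz3 nmax.
have nz z : S z -> z != 0 by move=> Sz; rewrite -normr_eq0 Sz oner_eq0.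
have q0 : 0 < quad z2 by apply: A_pos; exact: nz.
set N := sqn (z3 *m A) in nmax.
have N0 : 0 <= N by exact: sqn_ge0.
pose s := quad z2 / (N + 1).
have s0 : 0 < s by rewrite divr_gt0// ltr_wpDl.
exists s => // z z0; rewrite expand ltrBlDr ltrDl mulr_gt0// subr_gt0.
pose t := `|z|; pose u := t^-1 *: z.
have t0 : 0 < t by rewrite normr_gt0.
have Su : S u by exact: SnzE.
have zE : z = t *: u by rewrite /u scalerA divff ?scale1r// gt_eqF.
have qE : quad z = t ^+ 2 * quad u.
  rewrite zE /quad mulr_sumr; apply: eq_bigr => j _; rewrite -scalemxAl !mxE; ring.
have nE : sqn (z *m A) = t ^+ 2 * sqn (u *m A).
  rewrite zE /sqn mulr_sumr; apply: eq_bigr => j _; rewrite -scalemxAl !mxE; ring.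
rewrite qE nE mulrCA [ltRHS]mulrCA ltr_pM2l ?exprn_gt0//.
have h1 : sqn (u *m A) <= N by apply: nmax; rewrite inE.
have h2 : quad z2 <= quad u by apply: qmin; rewrite inE.
apply: (@le_lt_trans _ _ (quad z2)); last by lra.
rewrite /s mulrAC ler_pdivrMr ?ltr_wpDl// ler_pM2l//; lra.
Qed.

(** Existence for the obstacle problem on the box: the residual of the
    projected step is minimal at a fixed point, since a further step would
    strictly decrease it. *)
Lemma projection_fixpoint : exists s w, [/\ 0 < s,
  forall i, 0 <= w ord0 i <= kap &
  forall i, w ord0 i = trunc kap (w ord0 i - s * ((w *m A) ord0 i - b ord0 i))].
Proof.
have [s s0 hs] := contraction_step.
pose g (w : V) : V := \row_i trunc kap (w ord0 i - s * ((w *m A) ord0 i - b ord0 i)).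
have gK w i : 0 <= g w ord0 i <= kap by rewrite mxE trunc_ge0_le.
pose K := [set w : V | forall i, `[0, kap]%classic (w ord0 i)].
have cK : compact K.
  by apply: (@rV_compact _  _ (fun=> `[0, kap]%classic)) => _; exact: segment_compact.
have Kg w : K (g w) by move=> i; rewrite /= in_itv/=; exact: gK.
pose f w := sqn (w - g w).
have cf : continuous f.
  apply: continuous_sumf => i.
  have ci : continuous (fun w : V => (w - g w) ord0 i).
    have -> : (fun w : V => (w - g w) ord0 i) = fun w => w ord0 i -
        trunc kap (w ord0 i - s * ((w *m A) ord0 i - b ord0 i)).
      by apply/funext => w; rewrite !mxE.
    move=> w; apply: (@cvgB _ _ _ (nbhs w)); first exact: coord_continuous.
    apply: (@continuous_comp _ _ _ (fun w : V => w ord0 i - s * ((w *m A) ord0 i - b ord0 i)) (trunc kap)).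
      apply: (@cvgB _ _ _ (nbhs w)); first exact: coord_continuous.
      apply: (@cvgM _ _ (nbhs w)); first exact: cvg_cst.
      apply: (@cvgB _ _ _ (nbhs w)); first exact: continuous_mulcoord.
      exact: cvg_cst.
    exact: trunc_continuous.
  exact: (@continuous_coordM (fun w : V => (w - g w) ord0 i)).
have [w] := EVT_min_rV (ex_intro _ (g 0) (Kg 0)) cK (continuous_subspaceT cf).
rewrite inE => Kw wmin.
have gw : g w = w.
  apply/eqP; apply: contraT => ne.
  have : f w <= f (g w) by apply: wmin; rewrite inE; exact: Kg.
  rewrite leNgt => /negP; case.
  apply: le_lt_trans (hs (w - g w) _); last by rewrite subr_eq0 eq_sym.
  rewrite /f /sqn; apply: ler_sum => i _.
  rewrite -real_normK ?num_real// -[leRHS]real_normK ?num_real//.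
  rewrite lerXn2r ?nnegrE//.
  have -> : (g w - g (g w)) ord0 i = trunc kap (w ord0 i - s * ((w *m A) ord0 i - b ord0 i))
     - trunc kap (g w ord0 i - s * ((g w *m A) ord0 i - b ord0 i)) by rewrite !mxE.
  apply: le_trans (trunc_lipschitz _ _) _.
  rewrite mulmxBl le_eqVlt; apply/orP; left; apply/eqP; congr `|_|.
  by move: (g w *m A) (w *m A) (g w) => y1 y2 y3; rewrite !mxE; ring.
exists s, w; split; [by []|by move=> i; have := gK w i; rewrite gw|].
by move=> i; rewrite -{1}gw mxE.
Qed.

(** From a solution [w] of the variational inequality the unknown is recovered
    as [w] minus the residual divided by the weights, and truncation returns
    [w]. *)
Lemma complementarity_exists (d : 'I_m -> R) : (forall i, 0 < d i) ->
  exists u : 'I_m -> R, forall j,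
    \sum_i trunc kap (u i) * A i j + d j * (u j - trunc kap (u j)) = b ord0 j.
Proof.
move=> d0; have [s [w [s0 wk wE]]] := projection_fixpoint.
pose u j := w ord0 j - (d j)^-1 * ((w *m A) ord0 j - b ord0 j).
have uw j : trunc kap (u j) = w ord0 j.
  by apply: (trunc_step (wk j) s0 _ (wE j)); rewrite invr_gt0.
exists u => j; under eq_bigr do rewrite uw.
have -> : \sum_i w ord0 i * A i j = (w *m A) ord0 j by rewrite mxE.
rewrite uw /u; field; by rewrite gt_eqF.
Qed.

End complementarity.

(** * The abstract truncated Galerkin problem *)

Section linear_functionals.
Context {R : realType} {n : nat}.
Local Notation V := 'rV[R]_n.
Implicit Types (v w z : V -> R) (G : (V -> R) -> R).

(** Linearity up to equality on [D]: functions of the finite element space only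
    matter on the closed domain, which is all that a basis expansion controls. *)
Definition linear_on (P : (V -> R) -> Prop) (D : set V) G :=
  forall (a b : R) v w z, P v -> P w -> P z ->
  (forall y, D y -> z y = a * v y + b * w y) -> G z = a * G v + b * G w.

Lemma linear_onD P D G G' : linear_on P D G -> linear_on P D G' ->
  linear_on P D (fun v => G v + G' v).
Proof. by move=> l l' a b v w z *; rewrite (l a b v w)// (l' a b v w)//; ring. Qed.

Lemma linear_onZ P D c G : linear_on P D G -> linear_on P D (fun v => c * G v).
Proof. by move=> l a b v w z *; rewrite (l a b v w)//; ring. Qed.

Lemma linear_onB P D G G' : linear_on P D G -> linear_on P D G' ->
  linear_on P D (fun v => G v - G' v).
Proof. by move=> l l' a b v w z *; rewrite (l a b v w)// (l' a b v w)//; ring. Qed.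

Lemma linear_onW (P P' : (V -> R) -> Prop) (D D' : set V) G :
  (forall v, P' v -> P v) -> D `<=` D' -> linear_on P D G -> linear_on P' D' G.
Proof.
move=> PP DD l a b v w z Pv Pw Pz E; apply: l; [exact: PP|exact: PP|exact: PP|].
by move=> y /DD; exact: E.
Qed.

End linear_functionals.

Section truncated_problem.
Context {R : realType} {n m : nat}.
Local Notation V := 'rV[R]_n.
Implicit Types (u v w z : V -> R) (c : 'I_m -> R).
Variables (D : set V) (VP : (V -> R) -> Prop) (x : 'I_m -> V) (phi : 'I_m -> V -> R).
Variables (B S : (V -> R) -> (V -> R) -> R) (F : (V -> R) -> R).
Variables (d : 'I_m -> R) (kap : R).
Hypothesis kap0 : 0 < kap.
Hypothesis VPlin : forall (a b : R) v w, VP v -> VP w -> VP (fun y => a * v y + b * w y).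
Hypothesis VP0 : VP (fun=> 0).
Hypothesis VPphi : forall i, VP (phi i).
Hypothesis phix : forall i j, phi i (x j) = (i == j)%:R.
Hypothesis span : forall v, VP v -> exists c : 'I_m -> R, forall y, D y -> v y = \sum_i c i * phi i y.
Hypothesis Dx : forall i, D (x i).
Hypothesis B_linl : forall u, VP u -> linear_on VP D (fun v => B v u).
Hypothesis B_linr : forall u, VP u -> linear_on VP D (fun v => B u v).
Hypothesis F_lin : linear_on VP D F.
Hypothesis B_pos : forall v, VP v -> (exists i, v (x i) != 0) -> 0 < B v v.
Hypothesis d_gt0 : forall i, 0 < d i.
Hypothesis SE : forall v w, S v w = \sum_i d i * v (x i) * w (x i).

Local Notation plus := (vplus x phi kap).
Local Notation minus := (vminus x phi kap).

Definition combo c : V -> R := fun y => \sum_i c i * phi i y.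

Lemma VP_combo c : VP (combo c).
Proof.
rewrite /combo; elim: (index_enum _) => [|i r IH].
  by under eq_fun do rewrite big_nil; exact: VP0.
under eq_fun do rewrite big_cons.
have := VPlin (c i) 1 (VPphi i) IH; congr VP; apply/funext => y; by rewrite mul1r.
Qed.

Lemma combo_node c j : combo c (x j) = c j.
Proof.
rewrite /combo (bigD1 j)//= phix eqxx mulr1 big1 ?addr0// => i ij.
by rewrite phix (negbTE ij) mulr0.
Qed.

Lemma VP_nodes v y : VP v -> D y -> v y = combo (fun i => v (x i)) y.
Proof.
move=> /span[c vE] Dy; rewrite vE//; apply: eq_bigr => i _; congr (_ * _).
by rewrite vE//; apply/esym; exact: combo_node.
Qed.

(** A linear functional is determined by its values on the basis. *)
Lemma linear_nodes (G : (V -> R) -> R) v :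
  linear_on VP D G -> VP v -> G v = \sum_i v (x i) * G (phi i).
Proof.
move=> Glin Pv.
have G0 : G (fun=> 0) = 0.
  by rewrite (Glin 0 0 (fun=> 0) (fun=> 0))// ?mul0r ?addr0// => y _; rewrite mul0r addr0.
have Gc c (r : seq 'I_m) : VP (fun y => \sum_(i <- r) c i * phi i y) /\
    G (fun y => \sum_(i <- r) c i * phi i y) = \sum_(i <- r) c i * G (phi i).
  elim: r => [|i r [IH1 IH2]].
    by under eq_fun do rewrite big_nil; rewrite big_nil.
  have P1 : VP (fun y => \sum_(j <- i :: r) c j * phi j y).
    have := VPlin (c i) 1 (VPphi i) IH1; congr VP; apply/funext => y.
    by rewrite big_cons mul1r.
  split=> //; rewrite big_cons -IH2 -[X in _ + X]mul1r; apply: Glin => // y _.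
  by rewrite big_cons mul1r.
rewrite -(Gc _ _).2 (Glin 1 0 (combo (fun i => v (x i))) (fun=> 0)) ?mul0r ?addr0 ?mul1r//.
  exact: VP_combo.
by move=> y Dy; rewrite ?mul0r ?addr0 ?mul1r; exact: VP_nodes.
Qed.

Lemma F_nodes v : VP v -> F v = \sum_j v (x j) * F (phi j).
Proof. exact: linear_nodes F_lin. Qed.

Lemma B_nodesr u v : VP u -> VP v -> B u v = \sum_j v (x j) * B u (phi j).
Proof.
by move=> Pu; apply: linear_nodes; exact: B_linr.
Qed.

Lemma B_nodesl u v : VP u -> VP v -> B u v = \sum_i u (x i) * B (phi i) v.
Proof.
by move=> Pu Pv; exact: (linear_nodes (B_linl Pv)).
Qed.

Lemma plusE u : plus u = combo (fun i => trunc kap (u (x i))). Proof. by []. Qed.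

Lemma VP_plus u : VP (plus u). Proof. exact: VP_combo. Qed.

Lemma plus_node u j : plus u (x j) = trunc kap (u (x j)).
Proof. by rewrite plusE combo_node. Qed.

Lemma minus_node u j : minus u (x j) = u (x j) - trunc kap (u (x j)).
Proof. by rewrite /vminus plus_node. Qed.

Lemma VPB u v : VP u -> VP v -> VP (u \- v).
Proof.
move=> Pu Pv; have := VPlin 1 (-1) Pu Pv; congr VP; apply/funext => y /=.
by rewrite mul1r mulN1r.
Qed.

Lemma VP_minus u : VP u -> VP (minus u).
Proof. by move=> Pu; apply: VPB => //; exact: VP_plus. Qed.

Lemma B_subl u v w : VP u -> VP v -> VP w -> B (v \- w) u = B v u - B w u.
Proof.
move=> Pu Pv Pw; rewrite (@B_linl u Pu 1 (-1) v w (v \- w))//; first by rewrite mul1r mulN1r.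
- exact: VPB.
- by move=> y _ /=; rewrite mul1r mulN1r.
Qed.

Lemma nodes_eq v w : VP v -> VP w -> (forall i, v (x i) = w (x i)) ->
  forall y, D y -> v y = w y.
Proof.
move=> Pv Pw vw y Dy; rewrite VP_nodes// [RHS]VP_nodes//.
by apply: eq_bigr => i _; rewrite vw.
Qed.

(** The truncation is the projection onto [[0, kap]]. *)
Lemma trunc_vi (r t : R) : 0 <= t <= kap -> (r - trunc kap r) * (t - trunc kap r) <= 0.
Proof.
move=> /andP[t0 tk]; have [r0|r0] := leP r 0.
  by rewrite trunc_le0// !subr0 mulr_le0_ge0.
have [rk|rk] := leP kap r.
  by rewrite trunc_ge// mulr_ge0_le0 ?subr_ge0 ?subr_le0.
by rewrite trunc_id ?subrr ?mul0r// !ltW.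
Qed.

Definition truncated_solution u := VP u /\ forall v, VP v -> B (plus u) v + S (minus u) v = F v.

Lemma truncated_solution_exists : exists u, truncated_solution u.
Proof.
pose A : 'M[R]_m := \matrix_(i, j) B (phi i) (phi j).
have Apos (z : 'rV[R]_m) : z != 0 -> 0 < \sum_j (z *m A) ord0 j * z ord0 j.
  move=> z0; have Pz := VP_combo (fun i => z ord0 i).
  have := B_pos Pz; rewrite B_nodesr//.
  under eq_bigr => j _ do rewrite B_nodesl// combo_node mulrC.
  under eq_bigr => j _ do under eq_bigr => i _ do rewrite combo_node.
  have -> : \sum_j (z *m A) ord0 j * z ord0 j =
     \sum_j (\sum_i z ord0 i * B (phi i) (phi j)) * z ord0 j.
    by apply: eq_bigr => j _; rewrite mxE; congr (_ * _); apply: eq_bigr => i _; rewrite mxE.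
  apply; apply/not_existsP => h; move/eqP: z0; apply; apply/rowP => i; rewrite mxE.
  by have /negP := h i; rewrite combo_node negbK => /eqP.
have [u hu] := complementarity_exists kap0 (\row_j F (phi j)) Apos d_gt0.
exists (combo u); split; first exact: VP_combo.
move=> v Pv; rewrite F_nodes// B_nodesr//; last exact: VP_plus.
rewrite SE -big_split/=; apply: eq_bigr => j _.
rewrite minus_node combo_node B_nodesl//; last exact: VP_plus.
have := hu j; rewrite mxE => <-.
rewrite [RHS]mulrDr; congr (_ + _); last by rewrite mulrC.
by congr (_ * _); apply: eq_bigr => i _; rewrite plus_node combo_node mxE.
Qed.

Lemma S_nodes_inj v w : (forall i, S v (phi i) = S w (phi i)) -> forall i, v (x i) = w (x i).
Proof.
move=> h i.
have E u : S u (phi i) = d i * u (x i).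
  rewrite SE (bigD1 i)//= phix eqxx mulr1 big1 ?addr0// => j ji.
  by rewrite phix eq_sym (negbTE ji) mulr0.
by have := h i; rewrite !E => /(mulfI (lt0r_neq0 (d_gt0 i))).
Qed.

Lemma truncated_solution_vi u v : truncated_solution u -> VP v -> (forall i, 0 <= v (x i) <= kap) ->
  B (plus u) (v \- plus u) >= F (v \- plus u).
Proof.
move=> [Pu uE] Pv vk; have Pp := VP_plus u; have Pd := VPB Pv Pp.
rewrite -uE// gerDl SE; apply: sumr_le0 => i _.
rewrite -mulrA; apply: mulr_ge0_le0; first exact: ltW.
rewrite minus_node /= plus_node.
by apply: trunc_vi; exact: vk.
Qed.

(** Testing the difference of the two equations with the difference of the
    truncations gives a nonpositive energy, because truncation and its complement
    are monotone. Hence the truncations agree, and then so do the complements,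
    which are determined by [S]. *)
Lemma truncated_solution_unique_nodes u u' : truncated_solution u -> truncated_solution u' -> forall i, u (x i) = u' (x i).
Proof.
move=> [Pu uE] [Pu' uE'].
have Pp := VP_plus u; have Pp' := VP_plus u'; have Pz := VPB Pp Pp'.
have zE : B (plus u \- plus u') (plus u \- plus u') =
   S (minus u') (plus u \- plus u') - S (minus u) (plus u \- plus u').
  rewrite B_subl//; have := uE _ Pz; have := uE' _ Pz; lra.
have Sle : S (minus u') (plus u \- plus u') - S (minus u) (plus u \- plus u') <= 0.
  rewrite !SE -sumrB; apply: sumr_le0 => i _.
  rewrite !minus_node /= !plus_node -!mulrA -mulrBr; apply: mulr_ge0_le0; first exact: ltW.
  have := trunc_vi (u (x i)) (trunc_ge0_le kap0 (u' (x i))).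
  have := trunc_vi (u' (x i)) (trunc_ge0_le kap0 (u (x i))).
  move: (u (x i)) (u' (x i)) (trunc _ _) (trunc _ _) => r r' t t'; nra.
have z0 i : plus u (x i) = plus u' (x i).
  apply/eqP; rewrite -subr_eq0; apply: contraT => ne.
  have := B_pos Pz (ex_intro _ i ne); by rewrite zE ltNge Sle.
have pp : plus u = plus u'.
  apply/funext => y; rewrite !plusE; apply: eq_bigr => i _.
  by have := z0 i; rewrite !plus_node => ->.
have mm i : minus u (x i) = minus u' (x i).
  move: i; apply: S_nodes_inj => i; have := uE _ (VPphi i); have := uE' _ (VPphi i).
  rewrite pp; lra.
move=> i; have := mm i; have := z0 i; rewrite /vminus => -> h.
by move: h => /addIr.
Qed.

Theorem truncated_problem :
  [/\ exists u, truncated_solution u,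
      forall u, truncated_solution u ->
        (VP (plus u) /\ forall i, 0 <= plus u (x i) <= kap) /\
        forall v, VP v -> (forall i, 0 <= v (x i) <= kap) ->
          B (plus u) (v \- plus u) >= F (v \- plus u),
      forall u, truncated_solution u ->
        let residual_eq w := forall v, VP v -> S w v = F v - B (plus u) v in
        [/\ VP (minus u), residual_eq (minus u)
          & forall w, VP w -> residual_eq w -> forall y, D y -> w y = minus u y]
    & forall u u', truncated_solution u -> truncated_solution u' ->
        forall y, D y -> u y = u' y].
Proof.
split.
- exact: truncated_solution_exists.
- move=> u us; split; last by move=> v; exact: truncated_solution_vi.
  by split; [exact: VP_plus|move=> i; rewrite plus_node; exact: trunc_ge0_le].
- move=> u [Pu uE] res; have Pm := VP_minus Pu.
  have rm : res (minus u) by move=> v Pv; rewrite -uE// addrC addKr.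
  split=> // w Pw rw; apply: nodes_eq => //; apply: S_nodes_inj => i.
  by rewrite rw ?rm.
- move=> u u' us us'; apply: nodes_eq; [exact: us.1|exact: us'.1|].
  exact: truncated_solution_unique_nodes.
Qed.

End truncated_problem.

(** * Linearity and definiteness of the forms *)

Section forms.
Context {R : realType} {n : nat}.
Local Notation V := 'rV[R]_n.
Local Notation mu := (lebesgue_rV n).
Variables (Omega : set V) (oO : open Omega) (bO : bounded_set Omega).
Implicit Types (u v w z : V -> R) (b : V -> V) (j : 'I_n).

Let mO : measurable Omega := open_measurable_rV oO.
Local Notation H1 := (H1 Omega).
Local Notation L2 := (L2 Omega).

Lemma ip_linear_l u : L2 u -> linear_on L2 Omega (fun v => ip Omega v u).
Proof.
move=> Lu a b v w z Lv Lw Lz E.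
rewrite -!(ipZl mO)// -(ipDl mO)//; [|exact: L2Z|exact: L2Z].
exact: ip_eq.
Qed.

Lemma ip_linear_r u : L2 u -> linear_on L2 Omega (fun v => ip Omega u v).
Proof. by move=> Lu a b v w z *; rewrite ![ip _ u _]ipC; exact: ip_linear_l. Qed.

Lemma ip_wgrad_linear (F : 'I_n -> V -> R) : (forall j, L2 (F j)) ->
  linear_on H1 Omega (fun v => \sum_j ip Omega (fun x => wgrad Omega v x ord0 j) (F j)).
Proof.
move=> LF a b v w z Hv Hw Hz E.
rewrite !mulr_sumr -big_split/=; apply: eq_bigr => j _.
have Lv := H1_wgrad_L2 j Hv; have Lw := H1_wgrad_L2 j Hw; have Lz := H1_wgrad_L2 j Hz.
have La := L2Z mO a Lv; have Lb := L2Z mO b Lw.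
have Lab := L2D mO La Lb.
rewrite -(ipZl mO a Lv (LF j)) -(ipZl mO b Lw (LF j)) -(ipDl mO La Lb (LF j)).
rewrite (@wgrad_eq _ _ Omega z (fun x => a * v x + b * w x))// in Lz *.
by apply: aeq_ip => //; [exact: wgrad_lin|exact: aeq_refl].
Qed.

Lemma ipv_wgrad_linear_l u : H1 u ->
  linear_on H1 Omega (fun v => ipv Omega (wgrad Omega v) (wgrad Omega u)).
Proof.
move=> Hu a b v w z Hv Hw Hz E.
have Lg q : H1 q -> forall j, L2 (fun x => wgrad Omega q x ord0 j).
  by move=> Hq j; exact: H1_wgrad_L2.
rewrite !(ipvE oO)//; try exact: Lg.
exact: (ip_wgrad_linear (Lg _ Hu)).
Qed.

Lemma ipvC (G H : V -> V) : ipv Omega G H = ipv Omega H G.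
Proof.
by apply: eq_Rintegral => x _; apply: eq_bigr => j _; rewrite mulrC.
Qed.

Lemma ipv_wgrad_linear_r u : H1 u ->
  linear_on H1 Omega (fun v => ipv Omega (wgrad Omega u) (wgrad Omega v)).
Proof. by move=> Hu a b v w z *; rewrite ![ipv _ (wgrad _ u) _]ipvC; exact: ipv_wgrad_linear_l. Qed.

Lemma transport_linear_l b u : (forall j, W1inf Omega (fun x => b x ord0 j)) -> L2 u ->
  linear_on H1 Omega (fun v => ip Omega (fun x => dot (b x) (wgrad Omega v x)) u).
Proof.
move=> Wb Lu a c v w z Hv Hw Hz E.
have Lg q : H1 q -> forall j, L2 (fun x => wgrad Omega q x ord0 j).
  by move=> Hq j; exact: H1_wgrad_L2.
have Lbu j : L2 (fun x => b x ord0 j * u x) by exact: (W1inf_mul_L2 oO (Wb j)).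
rewrite !(ip_transport oO)//; try exact: Lg.
exact: (ip_wgrad_linear Lbu).
Qed.

Lemma transport_linear_r b u : (forall j, W1inf Omega (fun x => b x ord0 j)) -> H1 u ->
  linear_on L2 Omega (fun v => ip Omega (fun x => dot (b x) (wgrad Omega u x)) v).
Proof.
move=> Wb Hu; apply: ip_linear_r; apply: (transport_L2 oO) => // j.
exact: H1_wgrad_L2.
Qed.

(** By continuity [v] is bounded away from zero on a box around [x0]. *)
Lemma ip_gt0 v (x0 : V) : L2 v -> {within closure Omega, continuous v} ->
  Omega x0 -> v x0 != 0 -> 0 < ip Omega v v.
Proof.
move=> Lv cv Ox0 v0; rewrite -lte_fin (ip_sq mO)//.
have cvO : {within Omega, continuous v} by apply: continuous_subspaceW cv; exact: subset_closure.
have cx0 : {for x0, continuous v}.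
  by move: cvO; rewrite continuous_open_subspace// => h; apply: h; rewrite inE.
pose c := `|v x0| / 2.
have c0 : 0 < c by rewrite divr_gt0// normr_gt0.
pose U := [set y | Omega y /\ c <= `|v y|].
have Ux0 : U° x0.
  have nv : \forall y \near x0, c <= `|v y|.
    move: cx0 => /cvgrPdist_le /(_ c c0); apply: filterS => y h.
    have := ler_normD (v x0 - v y) (v y); rewrite subrK => k.
    have : `|v x0| = c + c by rewrite -splitr.
    by move: h k; lra.
  by apply: filterI => //; exact: open_nbhs_nbhs.
have [a [b [_ _ xab abU]]] := obox_nbhs (open_interior U) Ux0.
have sub : obox a b `<=` U.
  by move=> y yab; apply: interior_subset; apply: abU => i; have /andP[/ltW -> /ltW ->] := yab i.
have ab i : a ord0 i < b ord0 i by have /andP[h1 h2] := xab i; exact: lt_trans h2.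
apply: (@lt_le_trans _ _ (\int[mu]_(x in obox a b) (cst (c ^+ 2)%:E) x)%E).
  rewrite integral_cst; last exact: measurable_obox.
  have hp : (0 < (\prod_i (b ord0 i - a ord0 i))%:E)%E.
    by rewrite lte_fin; apply: prodr_gt0 => i _; rewrite subr_gt0.
  rewrite -(lebesgue_rV_obox (fun i => ltW (ab i))) in hp.
  by apply: mule_gt0 => //; rewrite lte_fin exprn_gt0.
apply: (@le_trans _ _ (\int[mu]_(x in obox a b) (v x ^+ 2)%:E)%E).
  apply: ge0_le_integral => //.
  - exact: measurable_obox.
  - by move=> x _; rewrite lee_fin sqr_ge0.
  - apply/measurable_EFinP; apply: measurable_funX.
    apply: measurable_funS (L2_measurable Lv) => //; by move=> y /sub[].
  - move=> y /sub[_ cy]; rewrite lee_fin -[leRHS]real_normK ?num_real//.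
    by rewrite lerXn2r ?nnegrE// ltW.
apply: ge0_subset_integral => //.
- exact: measurable_obox.
- by apply/measurable_EFinP; apply: measurable_funX; exact: L2_measurable.
- by move=> y _; rewrite lee_fin sqr_ge0.
- by move=> y /sub[].
Qed.

End forms.

(** * The finite element scheme *)

Section finite_element_space.
Context {R : realType} {p : nat}.
Local Notation V := 'rV[R]_p.+1.
Variables (Omega : set V) (oO : open Omega) (bO : bounded_set Omega).
Variables (M : mesh R p.+1) (hM : conforming_partition Omega M) (k : nat).
Implicit Types (u v w z : V -> R) (b : V -> V) (e : 'I_(ncell M)).
Local Notation VP := (fe_space Omega M k).

Lemma cell_sub e : cell e `<=` closure Omega.
Proof. by case: hM => _ -> _ _ y ey; exists e. Qed.

Lemma poly_space_lin s l (a c : R) (q q' : V -> R) : poly_space s l q -> poly_space s l q' ->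
  poly_space s l (fun y => a * q y + c * q' y).
Proof.
move=> [d qE] [d' qE']; exists (fun i => a * d i + c * d' i) => y.
rewrite qE qE' !mulr_sumr -big_split/=; apply: eq_bigr => i _; ring.
Qed.

Lemma fe_space_lin (a c : R) v w : VP v -> VP w -> VP (fun y => a * v y + c * w y).
Proof.
move=> [[cv sv] Hv] [[cw sw] Hw]; split; last exact: H10_lin.
split; first by move=> y; apply: cvgD; apply: cvgM; [exact: cvg_cst|exact: cv|exact: cvg_cst|exact: cw].
move=> e; move: (sv e) (sw e); rewrite /cell_space.
case: (mshape M) => -[q Pq vq] [q' Pq' wq']; exists (fun y => a * q y + c * q' y);
  try exact: poly_space_lin.
- by move=> y ey; rewrite vq// wq'.
- by move=> y ey; rewrite vq// wq'.
Qed.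

Lemma fe_space_H10 v : VP v -> H10 Omega v. Proof. by case. Qed.

Lemma fe_space_H1 v : VP v -> H1 Omega v. Proof. by case=> _ []. Qed.

Lemma fe_space_L2 v : VP v -> L2 Omega v. Proof. by move=> /fe_space_H1 /H1_L2. Qed.

Lemma fe_space_cellwise v : VP v -> cellwise_smooth M v.
Proof.
move=> [[_ sv] _] e; apply: (@cell_space_smooth _ _ _ _ k); [by case: hM|exact: sv].
Qed.

Local Notation lin := (linear_on VP (closure Omega)).

Let VPin (P : (V -> R) -> Prop) G : (forall v, VP v -> P v) -> linear_on P Omega G -> lin G.
Proof. by move=> H; apply: linear_onW => //; exact: subset_closure. Qed.

Lemma J_linear_l gamma b u : VP u -> lin (fun v => J_form M gamma b v u).
Proof.
move=> Pu a c v w z Pv Pw Pz E.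
apply: J_form_lin; [by case: hM|exact: fe_space_cellwise..|].
by move=> e y ey; apply: E; exact: cell_sub ey.
Qed.

Lemma J_linear_r gamma b u : VP u -> lin (fun v => J_form M gamma b u v).
Proof.
move=> Pu a c v w z Pv Pw Pz E; rewrite ![J_form _ _ _ u _]J_formC.
exact: J_linear_l.
Qed.

Lemma aJ_linear_l eps mu gamma b u : divfree_W1inf_field Omega b -> VP u ->
  lin (fun v => aJ_form Omega M eps mu gamma b v u).
Proof.
move=> [Wb _ _] Pu; have Hu := fe_space_H1 Pu; have Lu := fe_space_L2 Pu.
apply: linear_onD; last exact: J_linear_l.
apply: linear_onD; last first.
  apply: linear_onZ; apply: (VPin fe_space_L2); exact: ip_linear_l.
apply: linear_onD.
  apply: linear_onZ; apply: (VPin fe_space_H1); exact: ipv_wgrad_linear_l.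
by apply: (VPin fe_space_H1); exact: transport_linear_l.
Qed.

Lemma aJ_linear_r eps mu gamma b u : divfree_W1inf_field Omega b -> VP u ->
  lin (fun v => aJ_form Omega M eps mu gamma b u v).
Proof.
move=> [Wb _ _] Pu; have Hu := fe_space_H1 Pu; have Lu := fe_space_L2 Pu.
apply: linear_onD; last exact: J_linear_r.
apply: linear_onD; last first.
  apply: linear_onZ; apply: (VPin fe_space_L2); exact: ip_linear_r.
apply: linear_onD.
  apply: linear_onZ; apply: (VPin fe_space_H1); exact: ipv_wgrad_linear_r.
by apply: (VPin fe_space_L2); exact: transport_linear_r.
Qed.

Lemma F_linear eps mu gamma theta dt b g w : divfree_W1inf_field Omega b ->
  L2 Omega g -> VP w -> lin (fun v => F_form Omega M eps mu gamma theta dt b g w v).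
Proof.
move=> [Wb _ _] Lg Pw; have Hw := fe_space_H1 Pw; have Lw := fe_space_L2 Pw.
apply: linear_onB; last by apply: linear_onZ; exact: J_linear_r.
apply: linear_onB; last first.
  apply: linear_onZ; apply: (VPin fe_space_L2); exact: ip_linear_r.
apply: linear_onB; last first.
  apply: linear_onZ; apply: (VPin fe_space_L2); exact: transport_linear_r.
apply: linear_onB; last first.
  apply: linear_onZ; apply: (VPin fe_space_H1); exact: ipv_wgrad_linear_r.
by apply: linear_onZ; apply: (VPin fe_space_L2); exact: ip_linear_r.
Qed.

(** The transport term vanishes and the three other terms are squares. *)
Lemma aJ_ge0 eps mu gamma b v : 0 < eps -> 0 <= mu -> 0 <= gamma ->
  divfree_W1inf_field Omega b -> VP v -> 0 <= aJ_form Omega M eps mu gamma b v v.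
Proof.
move=> e0 m0 g0 db Pv; rewrite /aJ_form /a_form (transport_skew oO bO db (fe_space_H10 Pv)) addr0.
rewrite addr_ge0 ?J_form_ge0// addr_ge0// mulr_ge0 ?ip_ge0 ?(ltW e0)//.
by apply: Rintegral_ge0 => y _; exact: dot_ge0.
Qed.

End finite_element_space.

Theorem theorem3p4 (R : realType) (p : nat) (hd : p.+1 = 2%N \/ p.+1 = 3%N)
  (Omega : set 'rV[R]_p.+1) (hOmega : polyhedral_lipschitz_domain Omega)
  (T eps mu : R) (hT : 0 < T) (heps : 0 < eps) (hmu : 0 <= mu)
  (beta : R -> 'rV[R]_p.+1 -> 'rV[R]_p.+1)
  (hbeta : forall j : 'I_p.+1,
     bochner T +oo%E (W1inf Omega) (W1inf_norm Omega)
       (fun t x => beta t x ord0 j))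
  (hdiv : {ae lebesgue_measure, forall t : R, 0 <= t <= T ->
     div_free Omega (beta t)})
  (f : R -> 'rV[R]_p.+1 -> R)
  (hf : bochner T 2%:E (L2 Omega) (normL Omega 2%:E) f)
  (u0 : 'rV[R]_p.+1 -> R)
  (kappa : R -> R) (hkappa : forall t, 0 <= t <= T -> 0 < kappa t)
  (hbound : forall u : R -> 'rV[R]_p.+1 -> R,
     weak_solution Omega T eps mu beta f u0 u ->
     {ae lebesgue_measure, forall t : R, 0 <= t <= T ->
       {ae lebesgue_rV p.+1, forall z, Omega z -> 0 <= u t z <= kappa t}})
  (M : mesh R p.+1) (hM : conforming_partition Omega M)
  (sigma : R) (hsigma : shape_regular M sigma)
  (k : nat) (hk : (1 <= k)%N)
  (NP : nat) (x : 'I_NP -> 'rV[R]_p.+1) (hx : internal_nodes Omega M k x)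
  (phi : 'I_NP -> 'rV[R]_p.+1 -> R) (hphi : lagrange_basis Omega M k x phi)
  (hh : 'rV[R]_p.+1 -> R) (hhh : mesh_function Omega M hh)
  (gamma alpha : R) (hgamma : 0 <= gamma) (halpha : 0 < alpha)
  (N n : nat) (hN : (0 < N)%N) (hn : (1 <= n <= N)%N)
  (theta : R) (htheta : 2^-1 <= theta <= 1) :
  let dt := T / N%:R in
  let tn := n%:R * dt in
  let tp := n.-1%:R * dt in
  let tmid := theta * tn + (1 - theta) * tp in
  forall (hbetan : divfree_W1inf_field Omega (beta tn))
         (hbetap : divfree_W1inf_field Omega (beta tp))
         (hfmid : L2 Omega (f tmid))
         (uprev : 'rV[R]_p.+1 -> R) (huprev : fe_space Omega M k uprev),
  let VP := fe_space Omega M k in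
  let VPplus := fe_admissible Omega M k x (kappa tn) in
  let plus := vplus x phi (kappa tn) in
  let minus := vminus x phi (kappa tn) in
  let aJ := aJ_form Omega M eps mu gamma (beta tn) in
  let s := s_form M alpha eps mu dt (beta tn) hh x in
  let F := F_form Omega M eps mu gamma theta dt (beta tp) (f tmid)
             (vplus x phi (kappa tp) uprev) in
  let Pn u := VP u /\ forall v, VP v ->
    ip Omega (plus u) v + dt * theta * aJ (plus u) v + dt * s (minus u) v
    = F v in
  [/\ exists u, Pn u,
      forall u, Pn u -> VPplus (plus u) /\
        forall v, VPplus v ->
          ip Omega (plus u) (v \- plus u)
          + dt * theta * aJ (plus u) (v \- plus u) >= F (v \- plus u),
      forall u, Pn u ->
        let residual_eq w := forall v, VP v ->
          dt * s w v
          = F v - ip Omega (plus u) v - dt * theta * aJ (plus u) v in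
        [/\ VP (minus u), residual_eq (minus u)
          & forall w, VP w -> residual_eq w ->
              forall z, closure Omega z -> w z = minus u z]
    & forall u u', Pn u -> Pn u' -> forall z, closure Omega z -> u z = u' z].

Proof.
move=> dt tn tp tmid hbetan hbetap hfmid uprev huprev VP VPplus plus minus aJ s F Pn.
have [[oO _] [_ bO] _ _] := hOmega.
have [uM cO _ _] := hM.
have dt0 : 0 < dt by rewrite divr_gt0// ltr0n.
have [phiV phix span] := hphi.
have kap0 : 0 < kappa tn.
  apply: hkappa; apply/andP; split; first by rewrite mulr_ge0// ltW.
  rewrite /tn /dt mulrA ler_pdivrMr ?ltr0n// mulrC ler_wpM2l ?(ltW hT)// ler_nat.
  by case/andP: hn.
have th0 : 0 <= theta by case/andP: htheta => h _; apply: le_trans h; rewrite invr_ge0.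
have xin i : Omega (x i) /\ lagrange_node M k (x i).
  by have [_ rx] := hx; have : range x (x i) by []; rewrite rx => -[].
have xD i : closure Omega (x i) by apply: subset_closure; exact: (xin i).1.
have VPlin a c v w : VP v -> VP w -> VP (fun y => a * v y + c * w y).
  exact: fe_space_lin.
have VP0 : VP (fun=> 0).
  have := VPlin 0 0 _ _ huprev huprev; congr VP; apply/funext => y.
  by rewrite !mul0r addr0.
pose B u v := ip Omega u v + dt * theta * aJ u v.
pose S u v := dt * s u v.
pose d i := dt * alpha * (eps * hh (x i) ^+ (p.+1 - 2)
     + linf (patch_of M (x i)) (beta tn) * hh (x i) ^+ (p.+1 - 1)
     + (dt^-1 + mu) * hh (x i) ^+ p.+1).
have Bl u : VP u -> linear_on VP (closure Omega) (fun v => B v u).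
  move=> Pu; apply: linear_onD.
    apply: (linear_onW (@fe_space_L2 _ _ _ _ _) (@subset_closure _ Omega)).
    by apply: ip_linear_l => //; exact: fe_space_L2 Pu.
  by apply: linear_onZ; exact: aJ_linear_l.
have Br u : VP u -> linear_on VP (closure Omega) (fun v => B u v).
  move=> Pu; apply: linear_onD.
    apply: (linear_onW (@fe_space_L2 _ _ _ _ _) (@subset_closure _ Omega)).
    by apply: ip_linear_r => //; exact: fe_space_L2 Pu.
  by apply: linear_onZ; exact: aJ_linear_r.
have Pprev : VP (vplus x phi (kappa tp) uprev) by exact: (VP_plus x (kappa tp) VPlin VP0 phiV).
have Fl : linear_on VP (closure Omega) F.
  exact: (F_linear oO bO hM eps mu gamma theta dt hbetap hfmid Pprev).
have Bpos v : VP v -> (exists i, v (x i) != 0) -> 0 < B v v.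
  move=> Pv [i vi]; apply: ltr_wpDr.
    apply: mulr_ge0; first by apply: mulr_ge0 => //; exact: ltW.
    exact: (aJ_ge0 oO bO heps hmu hgamma hbetan Pv).
  apply: (ip_gt0 oO (fe_space_L2 Pv) _ (xin i).1 vi); by case: Pv => -[].
have dpos i : 0 < d i.
  have [e ex] := lagrange_node_cell hk (xin i).2.
  have h0 : 0 < hh (x i) by exact: mesh_function_gt0 hhh ex.
  have l0 : 0 <= linf (patch_of M (x i)) (beta tn) by apply: fine_ge0; exact: Lnorm_ge0.
  apply: mulr_gt0; first exact: mulr_gt0.
  apply: ltr_wpDr.
    by apply: mulr_ge0; [rewrite addr_ge0 ?invr_ge0// ltW|rewrite exprn_ge0// ltW].
  apply: ltr_wpDr; first by apply: mulr_ge0 => //; rewrite exprn_ge0// ltW.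
  by apply: mulr_gt0 => //; exact: exprn_gt0.
have SE v w : S v w = \sum_i d i * v (x i) * w (x i).
  rewrite /S /s /s_form !mulr_sumr; apply: eq_bigr => i _; rewrite /d; ring.
have [Ha Hb Hc Hd] := truncated_problem kap0 VPlin VP0 phiV phix span xD Bl Br Fl Bpos dpos SE.
split.
- exact: Ha.
- move=> u /Hb[Hp Hvi]; split; first exact: Hp.
  move=> v [Pv vk]; exact: Hvi.
- move=> u /Hc[Pm rm um] res.
  have resE w : res w <-> (forall v, VP v -> S w v = F v - B (plus u) v).
    have E v : F v - ip Omega (plus u) v - dt * theta * aJ (plus u) v = F v - B (plus u) v.
      by rewrite /B opprD addrA.
    by split=> h v Pv; [rewrite -E; exact: h|rewrite E; exact: h].
  split=> //; first exact/resE.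
  by move=> w Pw /resE; exact: um.
- exact: Hd.
Qed.
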